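(* Let $\pi=1\pi'\in S_n$, where $\pi'$ is a dominant permutation of $\{2,\ldots,n\}$. Then the normalized volume of $\mathcal{P}(T(\pi))$ is equal to the number of reduced pipe dreams of $\pi$. This can be written as $$\mathrm{vol}(\mathcal{P}(T(\pi)))=\mathfrak{G}^{\beta=0}_{\pi}(\mathbf{1}),$$ where $\mathbf{1}=(1,\ldots,1)$.
   Context: Permutations and diagrams. A permutation $\pi\in S_n$ is written in one-line notation $\pi_1\cdots\pi_n$. Positions in the $n\times n$ grid are (row, column), rows numbered top to bottom and columns left to right. The diagram of $\pi$ is $D(\pi)=\{(\pi_j,i): i<j,\ \pi_i>\pi_j\}$. $\pi=1\pi'$ with $\pi'$ dominant means $\pi_1=1$ and $\pi'=\pi_2\cdots\pi_n$ is a $132$-avoiding permutation of $\{2,\ldots,n\}$; equivalently $D(\pi)$ is the Young diagram of a partition whose north-west most box is at $(2,2)$. Pipe dreams. A pipe dream for $\pi$ is a tiling of the $n\times n$ grid by crosses (two strands cross straight) and elbows (one strand joins the left edge to the top edge, another joins the bottom edge to the right edge) such that all tiles at $(a,b)$ with $a+b\ge n+1$ are elbows, and if the strands entering from the left in rows $1,\ldots,n$ are labelled $1,\ldots,n$ and followed (ignoring second crossings among the same strands), they exit at the top reading $\pi_1,\ldots,\pi_n$ from left to right. It is reduced if no two strands cross twice. $PD(\pi)$ is the simplicial complex with vertices the entries $(a,b)$, $a+b\le n$, and facets the sets of elbow positions (in this triangle) of reduced pipe dreams for $\pi$. $\mathrm{Pipes}(\pi)$ is the set of all pipe dreams of $\pi$,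 reduced and nonreduced; for $P\in\mathrm{Pipes}(\pi)$, $F(P)$ is the (interior) face of $PD(\pi)$ given by the elbow positions of $P$. $\beta$-Grothendieck polynomial. $\mathfrak{G}^{\beta}_\pi(\mathbf{x})=\sum_{P\in\mathrm{Pipes}(\pi)}\beta^{\mathrm{codim}_{PD(\pi)}F(P)}\prod_{(i,j)\in\mathrm{cross}(P)}x_i$, where $\mathbf{x}=(x_1,\ldots,x_{n-1})$ and $\mathrm{cross}(P)$ is the set of positions (row $i$, column $j$) of the crosses of $P$. The region $R(\pi)$. The bottom reduced pipe dream of $\pi$ has crosses at the boxes obtained by pushing $D(\pi)$ left (left-justifying each row); the top reduced pipe dream has crosses at the boxes obtained by pushing $D(\pi)$ up. The core region $\mathrm{cr}(\pi)$ is the union of the cross positions of these two pipe dreams, and $R(\pi)=\mathrm{cr}(\pi)\cup\{(1,1)\}$. The tree $T(\pi)$. Traverse the southeast boundary of $R(\pi)$ from its SW corner to its NE corner as a sequence of east steps (E) and north steps (N). Let $A$ consist of all N steps together with those E steps such that E bounds the bottom reduced pipe dream (the box of $R(\pi)$ directly above E is a cross of it) but the N step directly preceding E (if the preceding step is an N step) does not bound it (the box directly left of that N step is not a cross of it). Label the steps of $A$ by $1,\ldots,m$ in the order traversed; an E step not in $A$ receives the label of the N step directly preceding it. Place a dot in each box of $R(\pi)$ that is an elbow in the bottom reduced pipe dream, then let the dots in each column drop south so that they occupy the lowest boxes of that column of $R(\pi)$. $T(\pi)$ is the tree on $[m]$ with an edge $(i,j)$, $i<j$, whenever there is a dot in the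 box in the column of the E step labelled $i$ and the row of the N step labelled $j$. Root polytope and volume. With $e_i$ the standard basis of $\mathbb{R}^m$, $\mathcal{P}(T(\pi))$ is the convex hull of $0$ and all $e_i-e_j$, $1\le i<j\le m$, lying in the cone of nonnegative combinations of the vectors $e_i-e_j$, $(i,j)\in E(T(\pi))$, $i<j$. The normalized volume of a $d$-dimensional polytope is $d!$ times its usual volume, where the volume is taken in the affine span relative to the lattice of integer points in that span; it is denoted $\mathrm{vol}$ here and is an integer for lattice polytopes. *)

(* Defs.v *)
From HB Require Import structures.
From mathcomp Require Import all_boot all_order all_fingroup all_algebra.
From mathcomp Require Import all_classical all_reals all_analysis.

Set Implicit Arguments.
Unset Strict Implicit.
Unset Printing Implicit Defensive.

Import Order.TTheory GRing.Theory Num.Theory.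

(* A permutation of S_N with N = n.+1 is an element of 'S_n.+1.  Rows,
   columns, values and strands are elements of 'I_n.+1, i.e. numbered from 0:
   the box written (a, b) in 1-based matrix coordinates is (a - 1, b - 1). *)
Definition box (n : nat) := ('I_n.+1 * 'I_n.+1)%type.

(* w = 1 w' with w' a 132-avoiding permutation of {2, ..., N}. *)
Definition one_dominant n (w : 'S_n.+1) : Prop :=
  w ord0 = ord0 /\
  forall i j k : 'I_n.+1, (0 < i)%N -> (i < j)%N -> (j < k)%N ->
    ~ ((w i < w k)%N /\ (w k < w j)%N).

Definition diagram n (w : 'S_n.+1) : {set box n} :=
  [set (w ij.2, ij.1) | ij : box n & (ij.1 < ij.2)%N && (w ij.2 < w ij.1)%N].

(* a + b <= N in 1-based coordinates. *)
Definition triangle n : {set box n} :=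
  [set p : box n | (p.1.+1 + p.2.+1 <= n.+1)%N].

(* A tiling is given by its set C of crosses, all other tiles being elbows.
   Strands move right and up, so the tiles are visited row by row from the
   bottom, each row from left to right.  [up j] is the strand on the top edge
   of the last visited tile of column j, [right] the strand on the right edge
   of the last visited tile of the current row, and [crossings] lists the pairs
   of strands met at the cross tiles visited so far, with repetitions.
   [Some i] is the strand entering from the left in row i; strands entering the
   grid from below carry no label, and never reach the triangle. *)
Record strands (n : nat) := Strands {
  up : 'I_n.+1 -> option 'I_n.+1;
  right : option 'I_n.+1;
  crossings : seq {set option 'I_n.+1}
}.

(* The second crossing of a pair of strands is ignored: the labels then
   continue as they would at an elbow. *)
Definition visit_tile n (C : {set box n}) (i : 'I_n.+1) (st : strands n)
    (j : 'I_n.+1) : strands n :=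
  let a := right st in
  let b := up st j in
  let turn := fun k => if k == j then a else up st k in
  if (i, j) \in C then
    if [set a; b] \in crossings st
    then Strands turn b ([set a; b] :: crossings st)
    else Strands (up st) a ([set a; b] :: crossings st)
  else Strands turn b (crossings st).

Definition visit_row n (C : {set box n}) (st : strands n) (i : 'I_n.+1) :=
  foldl (visit_tile C i) (Strands (up st) (Some i) (crossings st))
    (enum 'I_n.+1).

Definition trace_strands n (C : {set box n}) : strands n :=
  foldl (visit_row C) (Strands (fun=> None) None [::]) (rev (enum 'I_n.+1)).

(* Pipes(w), a pipe dream being identified with cross(P). *)
Definition pipes n (w : 'S_n.+1) : {set {set box n}} :=
  [set C : {set box n} | (C \subset triangle n) &&
    [forall j, up (trace_strands C) j == Some (w j)]].

Definition reduced n (C : {set box n}) : bool := uniq (crossings (trace_strands C)).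

Definition reduced_pipes n (w : 'S_n.+1) : {set {set box n}} :=
  [set C in pipes w | reduced C].

(* F(P) *)
Definition elbows n (C : {set box n}) : {set box n} := triangle n :\: C.

(* The faces of PD(w). *)
Definition pd_complex n (w : 'S_n.+1) : {set {set box n}} :=
  [set F : {set box n} | [exists C in reduced_pipes w, F \subset elbows C]].

(* dim PD(w) - dim F; the two "- 1" in "dimension = cardinality - 1" cancel. *)
Definition codim n (w : 'S_n.+1) (F : {set box n}) : nat :=
  (\max_(G in pd_complex w) #|G|) - #|F|.

(* The value of the beta-Grothendieck polynomial of w at beta and at
   x = (x_1, ..., x_n), so that x`_i stands for x_(i+1).  No cross lies in the
   last row, whose variable does not occur. *)
Definition grothendieck (K : comNzRingType) n (w : 'S_n.+1) (beta : K)
    (x : n.-tuple K) : K :=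
  (\sum_(C in pipes w)
     beta ^+ codim w (elbows C) * \prod_(p in C) x`_(p.1))%R.

(* Crosses of the bottom (resp. top) reduced pipe dream: the diagram with each
   row pushed left (resp. each column pushed up). *)
Definition bottom_pd n (w : 'S_n.+1) : {set box n} :=
  [set p : box n | (p.2 < #|[set q in diagram w | q.1 == p.1]|)%N].

Definition top_pd n (w : 'S_n.+1) : {set box n} :=
  [set p : box n | (p.1 < #|[set q in diagram w | q.2 == p.2]|)%N].

Definition core_region n (w : 'S_n.+1) : {set box n} :=
  bottom_pd w :|: top_pd w.

Definition region n (w : 'S_n.+1) : {set box n} :=
  (ord0, ord0) |: core_region w.

(* A step of the south-east boundary of a region, recorded with the box of the
   region that it bounds: the box directly above an east step, the box directly
   to the left of a north step. *)
Definition step n := (bool * box n)%type.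
Definition East n (p : box n) : step n := (true, p).
Definition North n (p : box n) : step n := (false, p).

Definition lowest_in_column n (A : {set box n}) (p : box n) : bool :=
  (p \in A) && [forall r : 'I_n.+1, (p.1 < r)%N ==> ((r, p.2) \notin A)].

Definition last_in_row n (A : {set box n}) (p : box n) : bool :=
  (p \in A) && [forall c : 'I_n.+1, (p.2 < c)%N ==> ((p.1, c) \notin A)].

(* The south-east boundary of a Young diagram A, from its south-west corner to
   its north-east corner. *)
Definition boundary_row n (A : {set box n}) (r : 'I_n.+1) : seq (step n) :=
  [seq East (r, c) | c <- enum 'I_n.+1 & lowest_in_column A (r, c)] ++
  [seq North (r, c) | c <- enum 'I_n.+1 & last_in_row A (r, c)].

Definition boundary n (A : {set box n}) : seq (step n) :=
  flatten [seq boundary_row A r | r <- rev (enum 'I_n.+1)].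

(* Membership in the set of steps that get a label of their own; [prev] is the
   preceding step, if any. *)
Definition own_label n (bot : {set box n}) (prev : option (step n))
    (e : step n) : bool :=
  match e with
  | (false, _) => true
  | (true, p) =>
      (p \in bot) && (if prev is Some (false, q) then q \notin bot else true)
  end.

(* [k] is the label of the preceding step, so that an east step without a label
   of its own receives the label of the north step before it.  If w is the
   identity, the region is one box, its east step has no predecessor, and it
   receives the label 0, i.e. none. *)
Fixpoint label_steps n (bot : {set box n}) (prev : option (step n)) (k : nat)
    (s : seq (step n)) : seq (step n * nat) :=
  if s is e :: s' then
    let k' := if own_label bot prev e then k.+1 else k in
    (e, k') :: label_steps bot (Some e) k' s'
  else [::].

Definition labelled_boundary n (w : 'S_n.+1) : seq (step n * nat) :=
  label_steps (bottom_pd w) None 0 (boundary (region w)).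

(* m, the last label *)
Definition nb_labels n (w : 'S_n.+1) : nat :=
  last 0 [seq el.2 | el <- labelled_boundary w].

(* The boxes occupied by the dots (the elbows of the bottom pipe dream in the
   region) once they have dropped to the bottom of their columns. *)
Definition dots n (w : 'S_n.+1) : {set box n} :=
  [set p in region w |
    (#|[set q in region w | (q.2 == p.2) && (p.1 < q.1)%N]| <
     #|[set q in region w :\: bottom_pd w | q.2 == p.2]|)%N].

(* The edges (i, j), i < j, of T(w); the vertex i : 'I_m stands for the label
   i + 1. *)
Definition tree_edge n (w : 'S_n.+1) : rel 'I_(nb_labels w) := fun i j =>
  (i < j)%N &&
  [exists p in dots w,
    [exists r, (East (r, p.2), i.+1) \in labelled_boundary w] &&
    [exists c, (North (p.1, c), j.+1) \in labelled_boundary w]].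
Arguments tree_edge {n} w.

Local Open Scope classical_set_scope.
Local Open Scope ring_scope.

Definition convex_hull (R : realType) m (S : set 'rV[R]_m) : set 'rV[R]_m :=
  [set x | exists k (c : 'I_k -> R) (p : 'I_k -> 'rV[R]_m),
    [/\ forall i, S (p i), forall i, 0 <= c i, \sum_i c i = 1
      & x = \sum_i c i *: p i]].

Definition conic_hull (R : realType) m (S : set 'rV[R]_m) : set 'rV[R]_m :=
  [set x | exists k (c : 'I_k -> R) (p : 'I_k -> 'rV[R]_m),
    [/\ forall i, S (p i), forall i, 0 <= c i & x = \sum_i c i *: p i]].

Definition affine_span (R : realType) m (S : set 'rV[R]_m) : set 'rV[R]_m :=
  [set x | exists k (c : 'I_k -> R) (p : 'I_k -> 'rV[R]_m),
    [/\ forall i, S (p i), \sum_i c i = 1 & x = \sum_i c i *: p i]].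

Definition root_vector (R : realType) m (i j : 'I_m) : 'rV[R]_m :=
  delta_mx 0 i - delta_mx 0 j.

(* P(T), for a graph T on 'I_m with edges (i, j), i < j, given by [E]. *)
Definition root_polytope (R : realType) m (E : rel 'I_m) : set 'rV[R]_m :=
  convex_hull ([set 0] `|`
    ([set x | exists i j : 'I_m, (i < j)%N /\ x = root_vector R i j] `&`
     conic_hull
       [set x | exists i j : 'I_m, [/\ (i < j)%N, E i j & x = root_vector R i j]])).
Arguments root_polytope R {m} E.

(* Lebesgue measure on R^d, as an iterated product measure. *)
Fixpoint lebesgue_tuple (R : realType) d : set (d.-tuple R) -> \bar R :=
  match d return set (d.-tuple R) -> \bar R with
  | 0 => \d_([tuple] : 0.-tuple R)
  | d'.+1 => fun A =>
      ((@lebesgue_measure R) \x (@lebesgue_tuple R d'))%E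
        [set p : R * d'.-tuple R | A [tuple of p.1 :: p.2]]
  end.

(* The point of R^m with coordinates t in the frame with origin p0 and basis
   the rows of B. *)
Definition frame_point (R : realType) d m (p0 : 'rV[int]_m) (B : 'M[int]_(d, m))
    (t : 'rV[R]_d) : 'rV[R]_m :=
  map_mx intr p0 + t *m map_mx intr B.

(* The frame identifies R^d with the affine span of A, and Z^d with the integer
   points of that span; in particular d is the dimension of A. *)
Definition lattice_frame (R : realType) d m (A : set 'rV[R]_m)
    (p0 : 'rV[int]_m) (B : 'M[int]_(d, m)) : Prop :=
  [/\ row_free (map_mx intr B : 'M[R]_(d, m)),
      affine_span A = range (@frame_point R d m p0 B)
    & forall z : 'rV[int]_m, affine_span A (map_mx intr z) ->
        exists y : 'rV[int]_d, z = p0 + y *m B].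

(* d! times the volume relative to the lattice of integer points in the affine
   span.  Two lattice frames of A differ by a translation and an element of
   GL_d(Z), so the value does not depend on the frame that is chosen. *)
Definition normalized_volume (R : realType) m (A : set 'rV[R]_m) : \bar R :=
  xget 0%E [set v | exists d (p0 : 'rV[int]_m) (B : 'M[int]_(d, m)),
    lattice_frame A p0 B /\
    v = ((d`!)%:R%:E *
         lebesgue_tuple [set t : d.-tuple R |
           A (frame_point p0 B (\row_i tnth t i))])%E].

(* Main.v *)
(* Let L r be the number of boxes of the diagram in row r.  Both sides count the
   walks along the boundary of the partition L 1 >= L 2 >= ... that start at
   level 0, climb one level at each east step, and drop by any amount down to a
   level >= 0 at each north step.

   Pipe dreams: build a pipe dream row by row from the bottom and record the
   order of the strands on the top edges.  It is reduced when two strands only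
   cross while still in increasing order.  The orders from which w can still be
   reached decompose into blocks, each block being a strand followed by the
   larger strands that it must cross in the next row, and the number of ways to
   finish depends only on the number of blocks, which moves like a walk.  At
   beta = 0 only faces of codimension 0 count; these are the reduced pipe
   dreams, because all pipe dreams of w cross the same pairs of strands.

   Tree: the vertices of T(w), in the order of their labels, spell a word in
   sources, sinks and hubs in which every hub is joined to the next one.  The
   root polytope of a graph consists of the points of the cone of its edges
   whose positive coordinates have sum at most 1: a flow can be rerouted past
   every vertex that has both in- and outflow.  The coefficients of the points
   on the edges are unimodular coordinates, in which the volume can be
   integrated out one letter at a time; this gives the recursion of the walks.  *)

From HB Require Import structures.
Require Import Defs.
From mathcomp Require Import all_boot all_order all_fingroup all_algebra.
From mathcomp Require Import ring lra zify.

Set Implicit Arguments.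
Unset Strict Implicit.
Unset Printing Implicit Defensive.

(** * Words and the trees they encode *)

(** The two counts do not start from the same word: pipe dreams give a word of sources and sinks
    only, the tree gives one with hubs. They agree because, for walks, a hub acts as a sink followed
    by a source. The volume alone satisfies no recursion. Integrating out one letter requires the
    volume for every inflow [x] into the next hub and every budget [r] left for the positive
    coordinates. For [x], [r] >= 0 this is a polynomial with nonnegative integer coefficients in the
    products of the divided powers x^j/j! and r^k/k!. The same coefficients express the number of
    walks from level [b] in terms of the binomials C(b+j-1, j), because partial sums act on these as
    integrals act on divided powers. Inflow 0 and level 0 both single out the coefficient with j =
    0. Sinks can make the inflow negative. The formula then survives only if no source can refill
    the hub, whence [good_word]. *)

Inductive letter := Source | Sink | Hub.

(* Between two hubs the sources come first; otherwise the volume is not given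
   by [volume_fun]. *)
Definition sourceless (w : seq letter) := if w is Source :: _ then false else true.
Fixpoint good_word (w : seq letter) : bool :=
  match w with
  | [::] => true
  | Sink :: w' => sourceless w' && good_word w'
  | _ :: w' => good_word w'
  end.

Fixpoint walks (b : nat) (w : seq letter) : nat :=
  match w with
  | [::] => 1
  | Source :: w' => walks b.+1 w'
  | Sink :: w' => \sum_(i < b.+1) walks i w'
  | Hub :: w' => \sum_(i < b.+1) walks i.+1 w'
  end%N.

(* A tree is encoded by a word in which each letter carries a vertex: a source
   or a sink hangs on the next hub, a hub is joined to the hub after it, and
   [z] is the last hub. *)
Fixpoint hub (z : nat) (o : seq (letter * nat)) : nat :=
  match o with
  | [::] => z
  | (Hub, v) :: _ => v
  | _ :: o' => hub z o'
  end.

Fixpoint word_edges (z : nat) (o : seq (letter * nat)) : seq (nat * nat) :=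
  match o with
  | [::] => [::]
  | (Sink, v) :: o' => (hub z o', v) :: word_edges z o'
  | (_, v) :: o' => (v, hub z o') :: word_edges z o'
  end.

Definition letters (o : seq (letter * nat)) : seq letter := [seq e.1 | e <- o].
Definition word_vertices (z : nat) (o : seq (letter * nat)) : seq nat :=
  rcons [seq e.2 | e <- o] z.

Lemma size_word_edges z o : size (word_edges z o) = size (letters o).
Proof. by elim: o => [|[[] v] o IH] //=; rewrite IH. Qed.

Lemma hub_vertices z o : hub z o \in word_vertices z o.
Proof.
rewrite /word_vertices; elim: o => [|[[] v] o IH] /=; rewrite inE ?eqxx //.
- by rewrite IH orbT.
- by rewrite IH orbT.
Qed.

Lemma word_edges_vertices z o e : e \in word_edges z o ->
  (e.1 \in word_vertices z o) && (e.2 \in word_vertices z o).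
Proof.
have H := hub_vertices z; rewrite /word_vertices in H *.
by elim: o => [|[[] v] o IH] //=; rewrite !inE => /orP[/eqP ->|/IH/andP[-> ->]] /=;
  rewrite ?eqxx ?H ?orbT.
Qed.

(** * The diagram of a one-dominant permutation *)

(** Compare cardinalities: [c \in A] puts 1, ..., c into [A], while [c \notin A] confines [A] to the
    c - 1 positive numbers below [c]. *)
Lemma initial_set n (A : {set 'I_n.+1}) (c : 'I_n.+1) : ord0 \notin A ->
  (forall i j : 'I_n.+1, 0 < i -> i <= j -> j \in A -> i \in A) ->
  (c \in A) = (0 < c <= #|A|).
Proof.
move=> A0 Adown; have [c0|c0] := posnP c.
  by rewrite (_ : c = ord0) ?(negbTE A0) //; exact/val_inj.
rewrite /=; apply/idP/idP => [cA|].
  have inj : {in 'I_c &, injective (fun i : 'I_c => inord i.+1 : 'I_n.+1)}.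
    move=> i j _ _ /(congr1 val) /=; rewrite !inordK; first by case=> /val_inj.
      by have := ltn_ord j; have := ltn_ord c; lia.
    by have := ltn_ord i; have := ltn_ord c; lia.
  rewrite -{1}(card_ord c) -(card_in_imset inj); apply/subset_leq_card/fintype.subsetP => x /imsetP[i _ ->].
  by apply: Adown cA; rewrite inordK //; have := ltn_ord i; have := ltn_ord c; lia.
apply: contraLR => cA; rewrite -ltnNge.
suff : #|A| <= #|'I_c.-1| by rewrite card_ord -ltnS prednK.
apply: leq_trans (leq_imset_card (fun i : 'I_c.-1 => inord i.+1 : 'I_n.+1) _).
apply/subset_leq_card/fintype.subsetP => x xA.
have x0 : 0 < x by rewrite lt0n; apply: contraNneq A0 => x0; rewrite (_ : ord0 = x) //; exact/val_inj.
have xc : x.-1 < c.-1.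
  have [cx|] := leqP c x; last by lia.
  by rewrite (Adown c x) in cA.
apply/imsetP; exists (Ordinal xc) => //.
by apply: val_inj; rewrite /= inordK ?prednK // ltnW // ltn_ord.
Qed.

Section OneDominant.
Variables (n : nat) (w : 'S_n.+1).

(** Rows are natural numbers here, so that [r.+1] is always a row; rows past the grid are empty. *)
Definition row_length (r : nat) := #|[set q in diagram w | q.1 == r :> nat]|.

Lemma mem_diagram (r c : 'I_n.+1) :
  ((r, c) \in diagram w) = (c < (w^-1)%g r) && (r < w c).
Proof.
apply/imsetP/andP => [[[i j]] /[!inE] /= /andP[ij wij] [-> ->]|[h1 h2]].
  by rewrite permK.
by exists (c, (w^-1)%g r); rewrite ?inE /= permKV ?h1.
Qed.

Lemma row_length_card (r : 'I_n.+1) : row_length r = #|[set c | (r, c) \in diagram w]|.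
Proof.
have inj : injective (fun c : 'I_n.+1 => (r, c)) by move=> i j [].
rewrite /row_length -(card_imset _ inj); apply: eq_card => -[a c]; rewrite !inE /=; apply/andP/imsetP => [[D /eqP ar]|[d]].
  by exists c; rewrite ?inE; have -> : r = a by apply: val_inj.
by rewrite inE => D [-> ->].
Qed.

Lemma row_length_out r : n < r -> row_length r = 0.
Proof.
move=> nr; apply/eqP; rewrite cards_eq0; apply/eqP/setP => -[a c]; rewrite !inE /=.
by apply/negbTE; rewrite negb_and; apply/orP; right; have := ltn_ord a; apply: contraTneq => ->; lia.
Qed.

Hypothesis wdom : one_dominant w.

Lemma one_dominant0 : w ord0 = ord0. Proof. by case: wdom. Qed.

Lemma one_dominant_inv0 : (w^-1)%g ord0 = ord0.
Proof. by rewrite -[in LHS]one_dominant0 permK. Qed.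

(** A gap at column i to the left of a box (r, j) would give positions i < j < w^-1 r with values w
    i < r < w j, a 132 pattern. Column 0 is empty because [w] fixes 0. *)
Lemma diagramE (r c : 'I_n.+1) : ((r, c) \in diagram w) = (0 < c <= row_length r).
Proof.
rewrite row_length_card -initial_set ?inE //.
  by rewrite mem_diagram one_dominant0 /= ltn0 andbF.
move=> i j i0 ij; rewrite !inE !mem_diagram => /andP[jr rj].
have [ij'|ji] := ltnP i j; last first.
  by rewrite (_ : i = j) ?jr //; apply: val_inj; apply/eqP; rewrite eqn_leq ij.
rewrite (ltn_trans ij' jr) /= ltnNge; apply/negP => wir.
have [_ /(_ i j ((w^-1)%g r) i0 ij' jr)] := wdom; apply.
rewrite permKV; split => //; rewrite ltn_neqAle wir andbT.
apply/eqP => /val_inj wi; move: jr; rewrite -wi permK.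
by move=> ji; have := ltn_trans ij' ji; rewrite ltnn.
Qed.

Lemma row_length0 : row_length 0 = 0.
Proof.
rewrite -[0]/(val (@ord0 n)) row_length_card; apply/eqP; rewrite cards_eq0.
by apply/eqP/setP => c; rewrite !inE mem_diagram one_dominant_inv0 ltn0.
Qed.

(** A box (r.+1, c) without a box (r, c) above it would put the values r, w c, r.+1 in this order of
    positions, a 132 pattern. Row 0 is excluded because its value sits at position 0. *)
Lemma row_lengthS r : 0 < r -> row_length r.+1 <= row_length r.
Proof.
move=> r0; have [rn|nr] := ltnP r n; last by rewrite row_length_out.
pose a := Ordinal (ltnW rn : r < n.+1); pose b := Ordinal (rn : r.+1 < n.+1).
rewrite -[r.+1]/(val b) -[in leqRHS](erefl : val a = r) !row_length_card.
apply/subset_leq_card/fintype.subsetP => c; rewrite !inE !mem_diagram => /andP[cb bc].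
have ac : a < w c by rewrite (ltn_trans _ bc) /=.
rewrite ac andbT ltnNge; apply/negP => ca.
have {}ca : (w^-1)%g a < c.
  rewrite ltn_neqAle ca andbT; apply/eqP => /val_inj ca'; move: ac; rewrite -ca' permKV ltnn //.
have a0 : 0 < (w^-1)%g a.
  rewrite lt0n; apply/eqP => H; have /(congr1 w) : (w^-1)%g a = ord0 by exact: val_inj.
  by rewrite permKV one_dominant0 => /(congr1 val) /= E; rewrite E in r0.
have [_ /(_ _ c ((w^-1)%g b) a0 ca cb)] := wdom; apply.
by rewrite !permKV.
Qed.

(** The map [w] sends the columns of row [r] injectively to the n - r values above [r]. *)
Lemma row_length_leq r : r <= n -> row_length r + r <= n.
Proof.
move=> rn; pose a := Ordinal (rn : r < n.+1).
rewrite -[r in row_length r]/(val a) row_length_card.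
suff H : #|[set c | (a, c) \in diagram w]| <= #|'I_(n - r)| by rewrite card_ord in H; lia.
rewrite -(card_imset _ (@perm_inj _ w)).
apply: leq_trans (leq_imset_card (fun i : 'I_(n - r) => inord (r + i.+1) : 'I_n.+1) _).
apply/subset_leq_card/fintype.subsetP => x /imsetP[c]; rewrite inE mem_diagram => /andP[_ ac] ->.
have H : w c - r.+1 < n - r by rewrite /= in ac; have := ltn_ord (w c); lia.
apply/imsetP; exists (Ordinal H) => //; apply: val_inj; rewrite /= inordK.
  by rewrite /= in ac; lia.
by rewrite /= in ac; have := ltn_ord (w c); lia.
Qed.

(** Each nonempty column of the diagram starts in row 1, so pushing it up shifts it by one row: row
    [r] of the top pipe dream is row [r.+1] of the diagram. *)
Lemma column_diagramE (r c : 'I_n.+1) :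
  (r < #|[set q in diagram w | q.2 == c]|) = (0 < c <= row_length r.+1).
Proof.
pose A := [set i | (i, c) \in diagram w].
have -> : #|[set q in diagram w | q.2 == c]| = #|A|.
  have inj : injective (fun i : 'I_n.+1 => (i, c)) by move=> i j [].
  rewrite -(card_imset _ inj); apply: eq_card => -[a d]; rewrite !inE /=.
  apply/andP/imsetP => [[D /eqP dc]|[i]]; first by exists a; rewrite ?inE -dc.
  by rewrite inE => D [-> ->].
have A0 : ord0 \notin A by rewrite inE diagramE row_length0; case: (val c).
have Adown (i j : 'I_n.+1) : 0 < i -> i <= j -> j \in A -> i \in A.
  move=> i0 ij; rewrite !inE !diagramE => /andP[-> cj] /=; apply: leq_trans cj _.
  have : forall k, row_length (i + k) <= row_length i.
    elim=> [|k IH]; first by rewrite addn0.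
    by rewrite addnS (leq_trans _ IH) // row_lengthS // addn_gt0 i0.
  by move/(_ (j - i)); rewrite subnKC.
have [rn|nr] := ltnP r n.
  have := initial_set (Ordinal (rn : r.+1 < n.+1)) A0 Adown.
  by rewrite !inE diagramE /= => ->.
have -> : (0 < c <= row_length r.+1) = false by rewrite row_length_out ?ltnS //; case: (val c).
apply/negbTE; rewrite -leqNgt (leq_trans _ nr) //.
have : A \subset [set~ ord0] by apply/fintype.subsetP => x; rewrite !inE; apply: contraTneq => ->; rewrite inE in A0.
by move/subset_leq_card; rewrite cardsC1 card_ord.
Qed.

Definition one_line : seq nat := [seq val (w i) | i <- enum 'I_n.+1].

(** The order in which the strands r, ..., n have to leave at the top. *)
Definition values_from (r : nat) : seq nat := [seq v <- one_line | r <= v].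

Lemma one_line_uniq : uniq one_line.
Proof. by rewrite /one_line (map_inj_uniq (inj_comp val_inj perm_inj)) enum_uniq. Qed.

Lemma size_one_line : size one_line = n.+1.
Proof. by rewrite size_map size_enum_ord. Qed.

Lemma mem_one_line v : (v \in one_line) = (v <= n).
Proof.
apply/mapP/idP => [[i _ ->]|vn]; first by rewrite -ltnS /=; exact: ltn_ord.
by exists ((w^-1)%g (Ordinal (vn : v < n.+1))); rewrite ?mem_enum // permKV.
Qed.

Lemma values_from_uniq r : uniq (values_from r).
Proof. exact/filter_uniq/one_line_uniq. Qed.

Lemma mem_values_from r v : (v \in values_from r) = (r <= v <= n).
Proof. by rewrite mem_filter mem_one_line. Qed.

Lemma values_from_out : values_from n.+1 = [::].
Proof.
apply/eqP; rewrite -[_ == _]negbK -has_filter; apply/negP => /hasP[v].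
by rewrite mem_one_line ltnNge => ->.
Qed.

Lemma one_lineE : one_line = 0 :: values_from 1.
Proof.
rewrite /values_from /one_line enum_ordSl /= one_dominant0 /=; congr (_ :: _).
apply/esym/all_filterP/allP => _ /mapP[_ /mapP[i _ ->] ->].
rewrite lt0n -[0]/(val (@ord0 n)) -one_dominant0; apply/eqP => /val_inj/perm_inj H.
by have := neq_lift (w ord0) i; rewrite H one_dominant0 eqxx.
Qed.

(** Row [r] of the diagram counts the larger values that precede [r]. The larger values after [r]
    increase, since a descent among them would form a 132 pattern with [r]. *)
Lemma values_fromE_sorted r : 0 < r <= n ->
  values_from r = take (row_length r) (values_from r.+1) ++
                  r :: drop (row_length r) (values_from r.+1) /\
  sorted ltn (drop (row_length r) (values_from r.+1)).
Proof.
move=> /andP[r0 rn]; pose a := Ordinal (rn : r < n.+1); pose i := (w^-1)%g a.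
have wi : w i = a by rewrite permKV.
have i0 : 0 < i.
  rewrite lt0n; apply/eqP => H; have E : i = ord0 by exact: val_inj.
  by move: wi; rewrite E one_dominant0 => /(congr1 val) /= E'; rewrite -E' in r0.
set en := enum 'I_n.+1.
have enE : en = take i en ++ i :: drop i.+1 en.
  have := drop_nth i (_ : i < size en); rewrite size_enum_ord => /(_ (ltn_ord i)).
  by rewrite nth_ord_enum => <-; rewrite cat_take_drop.
pose val_w (c : 'I_n.+1) := val (w c).
have neq_i c : (c != i) -> (r <= val_w c) = (r < val_w c).
  move=> ci; rewrite [RHS]ltn_neqAle; case: eqP => // E.
  by case/eqP: ci; apply: (@perm_inj _ w); apply: val_inj; rewrite wi.
have enlt c : c \in take i en -> c < i.
  rewrite -(mem_map val_inj) map_take val_enum_ord take_iota mem_iota add0n /=.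
  by rewrite ltn_min => /andP[].
have engt c : c \in drop i.+1 en -> i < c.
  by rewrite -(mem_map val_inj) map_drop val_enum_ord drop_iota mem_iota => /andP[].
pose pre := [seq v <- map val_w (take i en) | r < v].
pose post := [seq v <- map val_w (drop i.+1 en) | r < v].
have olE : one_line = map val_w (take i en) ++ r :: map val_w (drop i.+1 en).
  by rewrite /one_line -/en {1}enE map_cat /= /val_w wi.
have E1 : values_from r.+1 = pre ++ post.
  by rewrite /values_from olE filter_cat /= ltnn.
have E2 : values_from r = pre ++ r :: post.
  rewrite /values_from olE filter_cat /= leqnn /pre /post.
  congr (_ ++ _ :: _); apply: eq_in_filter => v /mapP[c cin ->]; apply: neq_i.
    by apply: contraTneq (enlt c cin) => ->; rewrite ltnn.
  by apply: contraTneq (engt c cin) => ->; rewrite ltnn.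
have spre : size pre = row_length r.
  rewrite size_filter count_map -[r in RHS]/(val a) row_length_card cardE.
  rewrite /enum_mem size_filter -enumT -/en.
  rewrite [RHS](eq_count (a2 := fun c : 'I_n.+1 => (c < i) && (r < val_w c))); last first.
    by move=> c; rewrite [LHS]inE mem_diagram.
  rewrite enE count_cat /= ltnn /= add0n -enE.
  rewrite [X in _ = _ + X](eq_in_count (a2 := pred0)) ?count_pred0 ?addn0; last first.
    by move=> c /engt ic; rewrite ltnNge (ltnW ic).
  by apply: eq_in_count => c /enlt ci; rewrite ci.
rewrite E1 E2 take_size_cat // drop_size_cat //; split=> //.
rewrite /post filter_map sorted_map.
pose P (c : 'I_n.+1) := (i < c) && (r < val_w c).
apply: (@sub_in_sorted _ P (fun c d : 'I_n.+1 => c < d)).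
- move=> c d /andP[ic rc] /andP[_ rd] cd.
  have [//|dc] := ltnP (w c) (w d).
  have wcd : val (w d) != val (w c).
    by apply: contraTneq cd => /val_inj/perm_inj ->; rewrite ltnn.
  case: wdom => _ /(_ i c d i0 ic cd); case; rewrite wi; split => //.
  by rewrite ltn_neqAle wcd.
- apply/allP => c; rewrite mem_filter => /andP[rc /engt ic]; exact/andP.
- apply: sorted_filter; first by move=> x y z; exact: ltn_trans.
  rewrite -[sorted _ _](@sorted_map _ _ (val : 'I_n.+1 -> nat) ltn) map_drop val_enum_ord drop_iota.
  exact: iota_ltn_sorted.
Qed.

End OneDominant.

(** * Counting reduced pipe dreams row by row *)

Lemma big_uniq_sub (I : eqType) (s t : seq I) (F : I -> nat) : uniq s -> uniq t ->
  {subset t <= s} -> (forall x, x \in s -> F x != 0 -> x \in t) ->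
  \sum_(x <- s) F x = \sum_(x <- t) F x.
Proof.
move=> us ut ts Fst; rewrite (bigID (mem t)) /= [X in _ + X]big1_seq ?addn0.
  rewrite -big_filter; apply: perm_big; apply: uniq_perm => //; first exact: filter_uniq.
  by move=> x; rewrite mem_filter andb_idr //; exact: ts.
by move=> x /andP[xt xs]; apply/eqP; apply: contraNT xt => /Fst -> //.
Qed.

Lemma cat_notin_split (T : eqType) (m : T) (y A p t : seq T) : y ++ A = p ++ m :: t -> m \notin y ->
  exists2 q, p = y ++ q & A = q ++ m :: t.
Proof.
elim: y p => [|c y IH] [|d p] /=; first by move=> -> _; exists [::].
- by move=> -> _; exists (d :: p).
- by case=> -> _; rewrite inE eqxx.
- case=> -> E; rewrite inE negb_or => /andP[_ my].
  by have [q -> ->] := IH _ E my; exists q.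
Qed.

Lemma cat_notin_inj (T : eqType) (m : T) (A B A' B' : seq T) :
  A ++ m :: B = A' ++ m :: B' -> m \notin A -> m \notin A' -> A = A' /\ B = B'.
Proof.
move=> E mA mA'; have [q A'E [E']] := cat_notin_split E mA.
case: q A'E E' => [|c q]; first by rewrite cats0 => -> [].
by move=> A'E [cm _]; move: mA'; rewrite A'E mem_cat inE cm eqxx orbT.
Qed.

(* The sum of [F] over the strand orders that one row of tiles can produce from
   the order [s] by crossings of pairs that have not crossed before, when [a]
   is the strand that enters the row. *)
Fixpoint row_sum (a : nat) (s : seq nat) (F : seq nat -> nat) : nat :=
  match s with
  | [::] => F [:: a]
  | b :: s' => row_sum b s' (fun t => F (a :: t)) +
      (if a < b then row_sum a s' (fun t => F (b :: t)) else 0)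
  end.

Lemma eq_row_sum a s F G : F =1 G -> row_sum a s F = row_sum a s G.
Proof.
elim: s a F G => [|b s IH] a F G FG /=; first exact: FG.
by rewrite (IH b _ (fun t => G (a :: t))) ?(IH a _ (fun t => G (b :: t))) // => t; exact: FG.
Qed.

(* In one row, the strand [b] of a block [(b, z)] crosses the strands of [z], all
   larger than [b]: the row turns the order [block_front] into [block_back]. *)
Definition block_front (bl : seq (nat * seq nat)) := flatten [seq e.1 :: e.2 | e <- bl].
Definition block_back (bl : seq (nat * seq nat)) := flatten [seq rcons e.2 e.1 | e <- bl].
Definition valid_blocks (bl : seq (nat * seq nat)) := all (fun e => all (ltn e.1) e.2) bl.

Lemma block_front_cat u v : block_front (u ++ v) = block_front u ++ block_front v.
Proof. by rewrite /block_front map_cat flatten_cat. Qed.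

Lemma block_back_cat u v : block_back (u ++ v) = block_back u ++ block_back v.
Proof. by rewrite /block_back map_cat flatten_cat. Qed.

Lemma block_front_cons b z bl : block_front ((b, z) :: bl) = b :: z ++ block_front bl.
Proof. by []. Qed.

Lemma block_back_cons b z bl : block_back ((b, z) :: bl) = rcons z b ++ block_back bl.
Proof. by []. Qed.

Lemma perm_block bl : perm_eq (block_front bl) (block_back bl).
Proof.
elim: bl => [|[b z] bl IH] //; rewrite /block_front /block_back /= -cat_cons.
by apply: perm_cat => //; rewrite perm_sym perm_rcons.
Qed.

(** The front starts with the head [b] of the first block. As [b] is smaller than the rest of its
    block, the first [b] in the back marks where that block ends. *)
Lemma block_inj u v : valid_blocks u -> valid_blocks v ->
  block_front u = block_front v -> block_back u = block_back v -> u = v.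
Proof.
elim: u v => [|[b z] u IH] [|[c y] v] //= /andP[bz vu] /andP[cy vv].
rewrite /block_front /block_back /= => -[bc Ef]; rewrite -bc in cy *.
rewrite !cat_rcons => Eb.
have notin (x : seq nat) : all (ltn b) x -> b \notin x.
  by move=> /allP H; apply/negP => /H; rewrite /= ltnn.
have [zy Eb'] := cat_notin_inj Eb (notin _ bz) (notin _ cy).
rewrite zy in Ef *; congr (_ :: _); apply: IH => //.
by move/eqP: Ef; rewrite eqseq_cat // => /andP[_ /eqP].
Qed.

(** The branches mirror those of [row_sum]: an elbow at [b] closes the block of [a], a cross puts
    [b] into it. *)
Fixpoint block_decomps (a : nat) (z q : seq nat) : seq (seq (nat * seq nat)) :=
  match q with
  | [::] => [:: [:: (a, z)]]
  | b :: q' => [seq (a, z) :: bl | bl <- block_decomps b [::] q'] ++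
      (if a < b then block_decomps a (rcons z b) q' else [::])
  end.

Definition decompositions (q : seq nat) :=
  if q is b :: q' then block_decomps b [::] q' else [:: [::]].

Lemma row_sum_block a z q F :
  row_sum a q (fun t => F (z ++ t)) = \sum_(bl <- block_decomps a z q) F (block_back bl).
Proof.
elim: q a z F => [|b q IH] a z F /=.
  by rewrite big_seq1 /block_back /= cats0 cats1.
rewrite big_cat big_map /=; congr (_ + _).
  rewrite (IH b [::] (fun t => F (z ++ a :: t))); apply: eq_bigr => bl _.
  by rewrite /block_back /= cat_rcons.
case: ifP => ab; last by rewrite big_nil.
rewrite -IH; apply: eq_row_sum => t; by rewrite cat_rcons.
Qed.

Lemma block_decomps_sound a z q bl : bl \in block_decomps a z q -> all (ltn a) z ->
  [/\ valid_blocks bl, block_front bl = a :: z ++ q & exists y, exists r, bl = (a, z ++ y) :: r].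
Proof.
elim: q a z bl => [|b q IH] a z bl /=.
  rewrite inE => /eqP -> az; split; rewrite /valid_blocks /block_front /= ?az //.
  by exists [::], [::]; rewrite cats0.
rewrite mem_cat => /orP[/mapP[bl' H ->] az|].
  have [v f _] := IH _ _ _ H isT; split.
  - by rewrite /valid_blocks /= az.
  - by rewrite /block_front /= -/(block_front bl') f.
  - by exists [::], bl'; rewrite cats0.
case: ifP => // ab H az; have [|v f [y [r E]]] := IH _ _ _ H.
  by rewrite all_rcons /= ab.
by split; rewrite ?f ?cat_rcons //; exists (b :: y), r; rewrite E cat_rcons.
Qed.

Lemma block_decomps_complete a z y r : valid_blocks ((a, z ++ y) :: r) ->
  (a, z ++ y) :: r \in block_decomps a z (y ++ block_front r).
Proof.
elim: r a z y => [|[b y'] r IHr] a z y; elim: y z => [|c y IHy] z.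
- by rewrite /= cats0 inE.
- move=> v; rewrite /= mem_cat; apply/orP; right.
  have -> : a < c by move: v; rewrite /valid_blocks /= all_cat /= => /andP[/andP[_ /andP[]]].
  by have := IHy (rcons z c); rewrite cat_rcons; apply.
- move=> v; rewrite /= mem_cat; apply/orP; left; rewrite cats0.
  apply/mapP; exists ((b, y') :: r) => //.
  by apply: (IHr b [::] y'); move: v; rewrite /valid_blocks /= => /andP[].
- move=> v; rewrite /= mem_cat; apply/orP; right.
  have -> : a < c by move: v; rewrite /valid_blocks /= all_cat /= => /andP[/andP[_ /andP[]]].
  by have := IHy (rcons z c); rewrite cat_rcons; apply.
Qed.

Lemma block_decomps_uniq a z q : all (ltn a) z -> uniq (block_decomps a z q).
Proof.
elim: q a z => [|b q IH] a z az //=.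
rewrite cat_uniq map_inj_uniq; last by move=> u v [].
rewrite IH //=; case: ifP => // ab.
have az' : all (ltn a) (rcons z b) by rewrite all_rcons /= ab.
rewrite IH // andbT; apply/hasPn => bl H; apply/negP => /mapP[bl' _ E].
have [_ _ [y [r]]] := block_decomps_sound H az'; rewrite E => -[/(congr1 size)].
by rewrite size_cat size_rcons => /eqP; rewrite -[X in X == _]addn0 addSnnS eqn_add2l.
Qed.

Lemma decompositionsP q bl : reflect (valid_blocks bl /\ block_front bl = q) (bl \in decompositions q).
Proof.
apply: (iffP idP) => [|[]].
  case: q => [|b q] /=; first by rewrite inE => /eqP ->.
  by move=> /block_decomps_sound[].
case: bl => [|[b y] r]; first by move=> _ <-.
by move=> v <-; exact: (@block_decomps_complete b [::] y r).
Qed.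

Lemma decompositions_uniq q : uniq (decompositions q).
Proof. by case: q => [|b q] //; exact: block_decomps_uniq. Qed.

(** Being smaller than all others, [m] may cross any number [j] of strands before it turns up; the
    strand that it meets there then heads the first block of what is left. *)
Lemma row_sum_min m s F : all (ltn m) s ->
  row_sum m s F = \sum_(j < (size s).+1) \sum_(bl <- decompositions (drop j s))
    F (take j s ++ m :: block_back bl).
Proof.
elim: s F => [|b s IH] F; first by rewrite big_ord1 /= big_seq1.
move=> /= /andP[mb ms]; rewrite mb big_ord_recl /= IH //; congr (_ + _).
exact: (@row_sum_block b [::] s (fun t => F (m :: t))).
Qed.

(** The head of a block precedes the other strands of the block and is smaller. Only larger strands
    precede [m], so [m] is a head. *)
Lemma block_split_min m bl p t : valid_blocks bl -> all (ltn m) p ->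
  block_front bl = p ++ m :: t ->
  exists P, exists z, exists Q,
    [/\ bl = P ++ (m, z) :: Q, block_front P = p & z ++ block_front Q = t].
Proof.
elim: bl p => [|[b y] bl IH] p; first by case: p.
rewrite /valid_blocks /= => /andP[bY v]; case: p => [|c p] /=.
  by move=> _ [-> <-]; exists [::], y, bl.
move=> /andP[mc mp] [bc E].
have my : m \notin y.
  apply/negP => /(allP bY); rewrite /= bc => /ltn_trans/(_ mc).
  by rewrite ltnn.
have [q pE qE] := cat_notin_split E my.
have mq : all (ltn m) q by move: mp; rewrite pE all_cat => /andP[].
have [P [z [Q [-> PE QE]]]] := IH _ v mq qE.
by exists ((b, y) :: P), z, Q; split; rewrite // /block_front /= -/(block_front P) PE bc pE.
Qed.

(** In the back order a head follows the larger strands of its block, so an increasing order leaves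
    only heads. *)
Lemma sorted_back_singles Q : valid_blocks Q -> sorted ltn (block_back Q) ->
  Q = [seq (b, [::]) | b <- block_back Q].
Proof.
elim: Q => [|[b z] Q IH] //; rewrite /valid_blocks /= => /andP[bz v] srt.
have [z0 sQ] : z = [::] /\ sorted ltn (block_back Q).
  move: srt; rewrite /block_back /= -/(block_back Q).
  case: z bz => [|c z] /=; first by move=> _ /path_sorted.
  move=> /andP[bc _]; rewrite -cats1 -catA cat_path /= => /andP[pz /andP[lb _]].
  have : path ltn c (z ++ [:: b]) by rewrite cat_path pz /= lb.
  move/(order_path_min ltn_trans); rewrite all_cat /= andbT => /andP[_ cb].
  by move: (ltn_trans bc cb); rewrite ltnn.
by rewrite {1}(IH v sQ) z0 /block_back.
Qed.

Lemma block_front_singles s : block_front [seq (b, [::]) | b <- s] = s.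
Proof. by elim: s => [|b s IH] //=; rewrite /block_front /= -/(block_front _) IH. Qed.

Lemma block_back_singles s : block_back [seq (b, [::]) | b <- s] = s.
Proof. by elim: s => [|b s IH] //=; rewrite /block_back /= -/(block_back _) IH. Qed.

Lemma valid_blocks_singles s : valid_blocks [seq (b, [::]) | b <- s].
Proof. by elim: s. Qed.

Lemma walks_nseq b k v : walks b (nseq k Source ++ v) = walks (b + k) v.
Proof. by elim: k b => [|k IH] b /=; rewrite ?addn0 // IH addSnnS. Qed.

(* The south-east boundary of the diagram along the rows [k], ..., 1. *)
Fixpoint row_word (L : nat -> nat) (k : nat) : seq letter :=
  if k is k'.+1 then nseq (L k'.+1 - L k'.+2) Source ++ Sink :: row_word L k' else [::].

(** [m] counts the rows still to be filled, from the bottom up: the next one is row [m'], entered by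
    strand [m']. *)
Fixpoint completions (target : seq nat) (m : nat) (s : seq nat) : nat :=
  if m is m'.+1 then row_sum m' s (completions target m') else s == target.

(** * The strand orders that can be completed, and in how many ways *)

Section Completions.
Variables (n : nat) (w : 'S_n.+1).
Hypothesis wdom : one_dominant w.
Local Notation L := (row_length w).
Local Notation xs := (values_from w).

Let L_le r : r <= n -> L r + r <= n. Proof. exact: row_length_leq. Qed.
Let LS r : 0 < r -> L r.+1 <= L r. Proof. exact: row_lengthS. Qed.

Let xsE r : 0 < r <= n -> xs r = take (L r) (xs r.+1) ++ r :: drop (L r) (xs r.+1).
Proof. by case/(values_fromE_sorted wdom). Qed.

Let xs_sorted r : 0 < r <= n -> sorted ltn (drop (L r) (xs r.+1)).
Proof. by case/(values_fromE_sorted wdom). Qed.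

Let size_xs r : 0 < r <= n.+1 -> size (xs r) = n.+1 - r.
Proof.
move=> /andP[r0 rn]; have -> : size (xs r) = size (iota r (n.+1 - r)); last exact: size_iota.
apply/eqP; rewrite -uniq_size_uniq ?iota_uniq ?values_from_uniq // => v.
by rewrite mem_values_from mem_iota subnKC.
Qed.

Let xs_gt r : all (ltn r) (xs r.+1).
Proof. by apply/allP => v; rewrite mem_values_from => /andP[]. Qed.

Let notin_gt r (s : seq nat) : all (ltn r) s -> r \notin s.
Proof. by move/allP => H; apply/negP => /H /=; rewrite ltnn. Qed.

(** In the front [m] heads a block. In the back it stands at position [L m] of [xs m] with an
    increasing sequence behind it, so the blocks behind it are single strands; removing [m] leaves
    [xs m.+1]. *)
Lemma completions_support_split m s t : 0 < m <= n -> all (ltn m) s ->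
  forall bl, valid_blocks bl -> block_front bl = s ++ m :: t -> block_back bl = xs m ->
  exists P, exists z, exists Q, [/\ bl = P ++ (m, z) :: Q, block_front P = s,
    z ++ block_front Q = t, block_back P ++ z ++ block_front Q = xs m.+1 &
    size (block_front P) + size z = L m /\ Q = [seq (b, [::]) | b <- drop (L m) (xs m.+1)]].
Proof.
move=> mn ms bl v fE bE; have [P [z [Q [blE PE tE]]]] := block_split_min v ms fE.
exists P, z, Q; move: v; rewrite blE /valid_blocks all_cat /= => /and3P[vP vz vQ].
have xm : m \notin xs m.+1 by exact/notin_gt/xs_gt.
have : (block_back P ++ z) ++ m :: block_back Q = take (L m) (xs m.+1) ++ m :: drop (L m) (xs m.+1).
  by rewrite -xsE // -bE blE block_back_cat /block_back /= cat_rcons catA.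
move/cat_notin_inj => [||Et Ed].
- rewrite mem_cat negb_or -(perm_mem (perm_block P)) PE !notin_gt //.
- by apply: contra xm; exact: mem_take.
have QE : Q = [seq (b, [::]) | b <- block_back Q].
  by apply: sorted_back_singles => //; rewrite Ed xs_sorted.
have fbQ : block_front Q = block_back Q by rewrite {1}QE block_front_singles.
split=> //; first by rewrite fbQ catA Et Ed cat_take_drop.
split; last by rewrite QE Ed.
rewrite (perm_size (perm_block P)) -size_cat Et size_takel // size_xs; last first.
    by case/andP: mn => _ mn; rewrite ltnS.
  by case/andP: mn => _ /L_le; lia.
Qed.

Let row_sum_nonzero m s F : all (ltn m) s -> row_sum m s F != 0 ->
  exists j, exists bl, [/\ j <= size s, bl \in decompositions (drop j s)
    & F (take j s ++ m :: block_back bl) != 0].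
Proof.
move=> ms; rewrite row_sum_min // sum_nat_eq0 negb_forall => /existsP[j].
rewrite /= => H; suff /hasP[bl blin blF] : has (fun bl => F (take j s ++ m :: block_back bl) != 0) (decompositions (drop j s)).
  by exists j, bl; split=> //; rewrite -ltnS.
apply: contraNT H => /hasPn H; rewrite big1_seq // => bl /andP[_ /H].
by rewrite negbK => /eqP.
Qed.

(** An order can only be completed if blocks turn it into [xs m]. Inductively, these are the blocks
    in front of the newly entered strand in the next order, followed by the blocks that the row
    itself uses. *)
Lemma completions_support m s : 0 < m <= n.+1 -> all (leq m) s ->
  completions (one_line w) m s != 0 ->
  exists bl, [/\ valid_blocks bl, block_front bl = s & block_back bl = xs m].
Proof.
elim: m s => [//|[_|m IH]] s mn ms /=.
  move=> /row_sum_nonzero[//|j [bl [js /decompositionsP[v f]]]].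
  rewrite eqb0 negbK (one_lineE wdom) => /eqP E.
  exists bl; move: E f; case: (j) => [|j']; first by rewrite take0 drop0 /= => -[-> ->].
  case: (s) ms => [|c s'] /=; first by move=> _ [-> ->].
  by move=> /andP[c0 _] [c0' _]; rewrite c0' in c0.
move=> /row_sum_nonzero[//|j [bl [js /decompositionsP[v f]] H]].
have [||bl' [v' f' b']] := IH _ _ _ H.
- by case/andP: mn => _ /ltnW.
- have sub : all (leq m.+1) s by apply: sub_all ms => x; exact: ltnW.
  rewrite all_cat /= leqnn -{1}(cat_take_drop j s) all_cat in sub *.
  move/andP: sub => [-> sub] /=; rewrite -(perm_all _ (perm_block bl)) f //.
have mt : all (ltn m.+1) (take j s) by rewrite -(cat_take_drop j s) all_cat in ms; case/andP: ms.
have mn' : 0 < m.+1 <= n by case/andP: mn.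
have [P [z [Q [blE PE tE bE _]]]] := completions_support_split mn' mt v' f' b'.
exists (P ++ bl); split.
- by rewrite /valid_blocks all_cat -/(valid_blocks bl) v andbT; move: v'; rewrite blE /valid_blocks all_cat => /andP[].
- by rewrite block_front_cat PE f cat_take_drop.
- by rewrite block_back_cat -tE.
Qed.

Let all_gt_back m bl : block_back bl = xs m.+1 -> all (ltn m) (block_front bl).
Proof. by move=> E; rewrite (perm_all _ (perm_block bl)) E. Qed.

(** Here [m] has crossed the first [i] blocks. It must end behind exactly [L m] strands and can only
    move further to the right: with too many crossed nothing can follow, otherwise its next block
    takes the missing strands. *)
Lemma completions_prefix m bl : 0 < m <= n ->
  valid_blocks bl -> block_back bl = xs m.+1 -> forall i, i <= size bl ->
  (forall P z Q, valid_blocks (P ++ (m, z) :: Q) -> block_back (P ++ (m, z) :: Q) = xs m ->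
    completions (one_line w) m (block_front (P ++ (m, z) :: Q)) = walks (size P) (row_word L m.-1)) ->
  completions (one_line w) m (block_front (take i bl) ++ m :: block_back (drop i bl)) =
  if size (block_front (take i bl)) <= L m then walks i (row_word L m.-1) else 0.
Proof.
move=> mn v bE i ibl IH; have xm := xs_gt m.
set P := take i bl; set X := block_back (drop i bl).
have PX : block_back P ++ X = xs m.+1 by rewrite -block_back_cat cat_take_drop.
have vP : valid_blocks P by move: v; rewrite -(cat_take_drop i bl) /valid_blocks all_cat => /andP[].
have gtP : all (ltn m) (block_front P).
  by rewrite (perm_all _ (perm_block P)); move: xm; rewrite -PX all_cat => /andP[].
have gtX : all (ltn m) X by move: xm; rewrite -PX all_cat => /andP[].
have szP : size (block_back P) = size (block_front P) by rewrite (perm_size (perm_block P)).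
case: ifP => [PL|/negP PL].
  (* The strands that [m] still has to cross in order to reach position [L m]. *)
  set z := take (L m - size (block_front P)) X.
  set r := drop (L m - size (block_front P)) X.
  have E : block_front P ++ m :: X = block_front (P ++ (m, z) :: [seq (b, [::]) | b <- r]).
    by rewrite block_front_cat block_front_cons block_front_singles cat_take_drop.
  rewrite E IH ?size_takel //.
    have vr := valid_blocks_singles r; rewrite /valid_blocks in vP vr *.
    rewrite all_cat vP /= vr andbT.
    by rewrite -(cat_take_drop (L m - size (block_front P)) X) all_cat in gtX; case/andP: gtX.
  rewrite block_back_cat block_back_cons block_back_singles cat_rcons xsE //.
  rewrite -PX take_cat drop_cat szP ltnNge PL /= catA //.
apply/eqP; apply: contra_notT PL => H.
have [||bl' [v' f' b']] := completions_support _ _ H.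
- by case/andP: mn => -> /= mn; exact: leqW.
- rewrite all_cat /= leqnn (sub_all _ gtP) ?(sub_all _ gtX) // => x; exact: ltnW.
have [P' [z [Q [_ P'E _ _ [sz _]]]]] := completions_support_split mn gtP v' f' b'.
by rewrite -P'E -sz leq_addr.
Qed.

(** The support condition forces the entering strand to cross whole blocks of [bl] and the other
    blocks to act as they do in [bl]; the pairs of a position and a decomposition then reduce to the
    number [i] of blocks crossed. *)
Lemma row_sum_prefixes m bl (F : seq nat -> nat) : valid_blocks bl -> all (ltn m) (block_front bl) ->
  (forall j b, j <= size (block_front bl) -> b \in decompositions (drop j (block_front bl)) ->
    F (take j (block_front bl) ++ m :: block_back b) != 0 ->
    exists P, block_front P = take j (block_front bl) /\ P ++ b = bl) ->
  row_sum m (block_front bl) F =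
  \sum_(i < (size bl).+1) F (block_front (take i bl) ++ m :: block_back (drop i bl)).
Proof.
move=> v gt supp; set s := block_front bl in gt supp *.
rewrite row_sum_min // -(big_mkord xpredT (fun j => \sum_(b <- decompositions (drop j s)) F (take j s ++ m :: block_back b))).
rewrite -(big_mkord xpredT (fun i => F (block_front (take i bl) ++ m :: block_back (drop i bl)))).
pose G (x : nat * seq (nat * seq nat)) := F (take x.1 s ++ m :: block_back x.2).
rewrite /index_iota !subn0.
transitivity (\sum_(x <- [seq (j, b) | j <- iota 0 (size s).+1, b <- decompositions (drop j s)]) G x).
  by rewrite big_allpairs_dep.
have take_front i : take (size (block_front (take i bl))) s = block_front (take i bl).
  by rewrite /s -{2}(cat_take_drop i bl) block_front_cat take_size_cat.
have drop_front i : drop (size (block_front (take i bl))) s = block_front (drop i bl).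
  by rewrite /s -{2}(cat_take_drop i bl) block_front_cat drop_size_cat.
rewrite (@big_uniq_sub _ _ [seq (size (block_front (take i bl)), drop i bl) | i <- iota 0 (size bl).+1]).
- by rewrite big_map; apply: eq_bigr => i _; rewrite /G /= take_front.
- apply: allpairs_uniq_dep => //; first exact: iota_uniq.
    by move=> j _; exact: decompositions_uniq.
  by move=> [j b] [j' b'] _ _ [-> ->].
- rewrite map_inj_in_uniq ?iota_uniq // => i j; rewrite !mem_iota !add0n !ltnS /= => ib jb.
  by case=> _ /(congr1 size); rewrite !size_drop; lia.
- move=> _ /mapP[i _ ->]; apply/allpairsPdep.
  exists (size (block_front (take i bl))), (drop i bl); split=> //.
    have := congr1 size (block_front_cat (take i bl) (drop i bl)).
    by rewrite cat_take_drop size_cat -/s mem_iota add0n /= ltnS => ->; exact: leq_addr.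
  apply/decompositionsP; rewrite drop_front; split=> //.
  by move: v; rewrite -{1}(cat_take_drop i bl) /valid_blocks all_cat => /andP[].
- move=> _ /allpairsPdep[j [b [js bd ->]]] H.
  rewrite mem_iota add0n ltnS in js.
  have [P [PE E]] := supp j b js bd H.
  apply/mapP; exists (size P); first by rewrite mem_iota add0n ltnS -E size_cat leq_addr.
  by rewrite -E take_size_cat // drop_size_cat // PE size_takel.
Qed.

Lemma state_shape m P z Q : 0 < m <= n -> valid_blocks (P ++ (m, z) :: Q) ->
  block_back (P ++ (m, z) :: Q) = xs m ->
  [/\ size (block_front P) + size z = L m, Q = [seq (b, [::]) | b <- drop (L m) (xs m.+1)]
    & all (ltn m) (block_front P)].
Proof.
move=> mn v bE; have xm : m \notin xs m.+1 by exact/notin_gt/xs_gt.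
have E : (block_back P ++ z) ++ m :: block_back Q = xs m.
  by rewrite -bE block_back_cat block_back_cons cat_rcons catA.
have mPz : m \notin block_back P ++ z.
  have := values_from_uniq w m; rewrite -E cat_uniq => /and3P[_ + _].
  by apply: contra => H; apply/hasP; exists m; rewrite ?inE ?eqxx.
move: (E); rewrite xsE // => /cat_notin_inj[//||Et Ed]; first by apply: contra xm; exact: mem_take.
have vQ : valid_blocks Q by move: v; rewrite /valid_blocks all_cat /= => /and3P[].
split.
- rewrite (perm_size (perm_block P)) -size_cat Et size_takel // size_xs; last first.
    by case/andP: mn => _ mn; rewrite ltnS.
  by case/andP: mn => _ /L_le; lia.
- rewrite -Ed -(sorted_back_singles vQ) // Ed; exact: xs_sorted.
- rewrite (perm_all _ (perm_block P)); apply/allP => x xP.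
  have := mem_take (n0 := L m) (s := xs m.+1) (x := x).
  by rewrite -Et mem_cat xP => /(_ isT) /(allP (xs_gt m)).
Qed.

(** The number of blocks crossed in one row is the number of blocks in front of the entering strand
    afterwards; it is the level to which the walk drops. *)
Lemma completions_state m P z Q : 0 < m <= n -> valid_blocks (P ++ (m, z) :: Q) ->
  block_back (P ++ (m, z) :: Q) = xs m ->
  completions (one_line w) m (block_front (P ++ (m, z) :: Q)) = walks (size P) (row_word L m.-1).
Proof.
elim: m P z Q => [//|[_|m IH]] P z Q mn v bE.
  set bl := P ++ _ in v bE *.
  rewrite /= row_sum_prefixes //; last 2 first.
  - exact: all_gt_back.
  - move=> j b js /decompositionsP[vb fb].
    rewrite eqb0 negbK (one_lineE wdom) => /eqP E; exists [::].
    case: j js fb E => [|j] js fb; first by rewrite take0 /= => -[E]; split=> //; apply: block_inj; rewrite ?fb ?drop0 // E.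
    have := all_gt_back bE; case: (block_front bl) js => [//|c s'] js /= /andP[c0 _] [c0' _].
    by rewrite c0' in c0.
  (* The target starts with 0, so strand 0 turns up at once and only [i = 0] contributes. *)
  rewrite big_ord_recl /= take0 drop0 /= bE (one_lineE wdom) eqxx big1 // => i _.
  apply/eqP; rewrite eqb0; apply/eqP.
  have := all_gt_back bE; rewrite -{1}(cat_take_drop (lift ord0 i) bl) block_front_cat all_cat => /andP[+ _].
  case E : (take (lift ord0 i) bl) => [|[c y] t].
    move: (congr1 size E); rewrite size_take /=; case: ifP => // _ /=.
    by have := ltn_ord i; lia.
  by rewrite block_front_cons /= => /andP[c0 _] [c0' _]; rewrite c0' in c0.
have mn' : 0 < m.+1 <= n by case/andP: mn => _ /ltnW.
have [szP QE gtP] := state_shape mn v bE.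
set bl := P ++ _ in v bE *.
rewrite -[completions _ _ _]/(row_sum m.+1 (block_front bl) (completions (one_line w) m.+1)).
rewrite row_sum_prefixes //; last 2 first.
- exact: all_gt_back.
- move=> j b js /decompositionsP[vb fb] H.
  have gt := all_gt_back bE.
  have gtj : all (ltn m.+1) (take j (block_front bl)).
    by move: gt; rewrite -{1}(cat_take_drop j (block_front bl)) all_cat => /andP[].
  have [||bl' [v' f' b']] := completions_support _ _ H.
  + by case/andP: mn' => -> /= ?; exact: leqW.
  + rewrite all_cat /= leqnn (sub_all _ gtj) /=; last by move=> x; exact: ltnW.
    rewrite -(perm_all _ (perm_block b)) fb; apply: (@sub_all _ (ltn m.+1)); first by move=> x; exact: ltnW.
    by move: gt; rewrite -{1}(cat_take_drop j (block_front bl)) all_cat => /andP[].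
  have [P' [z' [Q' [E' PE' tE' bE' _]]]] := completions_support_split mn' gtj v' f' b'.
  exists P'; split=> //; apply: block_inj => //.
  + by rewrite /valid_blocks all_cat -/(valid_blocks b) vb andbT; move: v'; rewrite E' /valid_blocks all_cat => /andP[].
  + by rewrite block_front_cat PE' fb cat_take_drop.
  + by rewrite block_back_cat -tE' bE' bE.
transitivity (\sum_(i < (size bl).+1) if size (block_front (take i bl)) <= L m.+1 then walks i (row_word L m) else 0).
  apply: eq_bigr => i _; apply: completions_prefix => //; first by rewrite -ltnS.
  by move=> P' z' Q' v' b'; apply: IH.
rewrite /= walks_nseq /=.
have LL := LS (isT : 0 < m.+1).
have sQ : size Q = n - m.+1 - L m.+2 - 1.
  rewrite QE size_map size_drop; case: (ltnP m.+2 n.+1) => [lt|ge].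
    by rewrite size_xs; lia.
  by case/andP: mn => _; lia.
have sbl : size bl = size P + (size Q).+1 by rewrite /bl size_cat.
have Lm := L_le (_ : m.+1 <= n); have Lm' := L_le (_ : m.+2 <= n).
have le : size P + (L m.+1 - L m.+2) <= size bl.
  case/andP: mn => _ mn; have := Lm (ltnW mn); have := Lm' mn; lia.
rewrite -big_mkcond /= -(big_mkord (fun i => size (block_front (take i bl)) <= L m.+1) (fun i => walks i (row_word L m))).
rewrite -(big_mkord xpredT (fun i => walks i (row_word L m))).
rewrite [RHS](big_nat_widen _ _ (size bl).+1) //.
rewrite big_seq_cond [RHS]big_seq_cond; apply: eq_bigl => i.
rewrite mem_index_iota leq0n ltnS /=; case: (leqP i (size bl)) => //= ibl.
(* The blocks through that of [m.+2] hold [L m.+2 + 1] strands and each later block adds one. The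
   bound [L m.+1] on crossed strands thus allows exactly [i <= size P + (L m.+1 - L m.+2)]: the
   climb at the sources, then the drop at the sink. *)
rewrite ltnS /bl take_cat; case: ltnP => [iP|Pi].
  rewrite (leq_trans (ltnW iP) (leq_addr _ _)).
  have : size (block_front (take i P)) <= size (block_front P).
    by rewrite -{2}(cat_take_drop i P) block_front_cat size_cat leq_addr.
  by lia.
rewrite block_front_cat size_cat; case E : (i - size P) => [|t] /=.
  by rewrite /block_front /= -/(block_front P); apply/idP/idP; lia.
rewrite -/(block_front (take t Q)) size_cat QE -map_take block_front_singles.
have -> : size (take t (drop (L m.+2) (xs m.+3))) = t.
  by rewrite size_takel // -(size_map (fun b => (b, [::] : seq nat))) -QE; lia.
by apply/idP/idP; lia.
Qed.

Lemma completions_nil : completions (one_line w) n.+1 [::] = walks 0 (row_word L n.-1).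
Proof.
have [n0|n0] := posnP n.
  have -> : one_line w = [:: 0].
    by rewrite (one_lineE wdom) -[1]/(0.+1) -[in RHS]n0 -[in LHS]n0 values_from_out n0.
  have H k : k = 0 -> completions [:: 0] k.+1 [::] = walks 0 (row_word L k.-1) by move=> ->.
  exact: H.
have nn : 0 < n <= n by rewrite n0 leqnn.
have E : block_back [:: (n, [::])] = xs n by rewrite xsE // values_from_out.
exact: (@completions_state n [::] [::] [::] nn isT E).
Qed.

End Completions.

(* One row of tiles: [a] is the strand on the left edge of the first tile, [s]
   lists the strands on the bottom edges and [bits] tells the crosses; the
   result lists the strands on the top edges and the one leaving on the right. *)
Fixpoint run_row (a : nat) (s : seq nat) (bits : seq bool) : seq nat :=
  match s, bits with
  | b :: s', true :: bits' =>
      if a < b then b :: run_row a s' bits' else a :: run_row b s' bits'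
  | b :: s', _ :: bits' => a :: run_row b s' bits'
  | _, _ => a :: s
  end.

(** The travelling strand [a] stands just left of [b] in the order, so [b < a] means that the two
    have crossed already. *)
Fixpoint row_reduced (a : nat) (s : seq nat) (bits : seq bool) : bool :=
  match s, bits with
  | b :: s', true :: bits' => (a < b) && row_reduced a s' bits'
  | b :: s', _ :: bits' => row_reduced b s' bits'
  | _, _ => true
  end.

Lemma foldl_enum (T : Type) n (P : nat -> T -> Prop) (f : T -> 'I_n -> T) x0 :
  P 0 x0 -> (forall (j : 'I_n) x, P j x -> P j.+1 (f x j)) ->
  P n (foldl f x0 (enum 'I_n)).
Proof.
move=> P0 PS; suff H k : k <= n -> P k (foldl f x0 (take k (enum 'I_n))).
  by have := H n (leqnn n); rewrite take_oversize // size_enum_ord.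
elim: k => [|k IH] kn; first by rewrite take0.
rewrite (take_nth (Ordinal kn)) ?size_enum_ord // -cats1 foldl_cat /=.
rewrite (nth_ord_enum (Ordinal kn) (Ordinal kn)).
apply: (PS (Ordinal kn)); apply: IH; exact: ltnW.
Qed.

Lemma foldl_rev_enum (T : Type) n (P : nat -> T -> Prop) (f : T -> 'I_n -> T) x0 :
  P n x0 -> (forall (j : 'I_n) x, P j.+1 x -> P j (f x j)) ->
  P 0 (foldl f x0 (rev (enum 'I_n))).
Proof.
move=> Pn PS; suff H k : k <= n -> P (n - k) (foldl f x0 (rev (drop (n - k) (enum 'I_n)))).
  by have := H n (leqnn n); rewrite subnn drop0.
elim: k => [|k IH] kn; first by rewrite subn0 drop_oversize // size_enum_ord.
have kn' : n - k.+1 < n by lia.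
rewrite (drop_nth (Ordinal kn')) ?size_enum_ord // rev_cons -cats1 foldl_cat /=.
rewrite (nth_ord_enum (Ordinal kn') (Ordinal kn')).
apply: (PS (Ordinal kn')); rewrite /= subnSK //; apply: IH; exact: ltnW.
Qed.

(** * Tracing the strands tile by tile *)

Section Trace.
Variables (n : nat) (C : {set box n}).
Implicit Types (cs : seq {set option 'I_n.+1}) (s : seq nat) (st : strands n).

(** Since repeated crossings leave the order alone, the pairs that have crossed are the inversions
    of the current order, for nonreduced tilings too. This turns the test on [crossings] into a
    comparison of labels. *)
Definition crossings_inverted cs s :=
  (forall a b : 'I_n.+1, a < b -> ([set Some a; Some b] \in cs) =
     [&& (a : nat) \in s, (b : nat) \in s & index (b : nat) s < index (a : nat) s]) /\
  (forall X, X \in cs -> exists a b : 'I_n.+1, a < b /\ X = [set Some a; Some b]).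

Lemma set_some_inj (a b x y : 'I_n.+1) : a < b -> x < y ->
  ([set Some x; Some y] == [set Some a; Some b]) = (x == a) && (y == b).
Proof.
move=> ab xy; apply/eqP/andP => [E|[/eqP -> /eqP ->] //].
have : Some x \in [set Some a; Some b] by rewrite -E !inE eqxx.
have : Some y \in [set Some a; Some b] by rewrite -E !inE eqxx orbT.
have : Some a \in [set Some x; Some y] by rewrite E !inE eqxx.
rewrite !inE !(inj_eq Some_inj) -!val_eqE /=; lia.
Qed.

Lemma uniq_adjacent (T : eqType) (p t : seq T) a b : uniq (p ++ a :: b :: t) ->
  [/\ a \notin p, b \notin p, a != b, a \notin t & b \notin t].
Proof.
rewrite uniq_catC /= !inE !mem_cat !negb_or.
by move=> /andP[/and3P[-> -> ->] /andP[/andP[-> ->] _]].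
Qed.

Lemma index_swap (T : eqType) (p t : seq T) a b v : a \notin p -> b \notin p ->
  v != a -> v != b ->
  index v (p ++ b :: a :: t) = index v (p ++ a :: b :: t) /\
  (index v (p ++ a :: b :: t) < size p \/ (size p).+1 < index v (p ++ a :: b :: t)).
Proof.
move=> ap bp va vb; rewrite !index_cat /= ![_ == v]eq_sym (negbTE va) (negbTE vb).
case: ifP => vp; split=> //; first by left; rewrite index_mem.
by right; clear; lia.
Qed.

Lemma crossings_adjacent cs p (a b : 'I_n.+1) t :
  crossings_inverted cs (p ++ (a : nat) :: (b : nat) :: t) -> uniq (p ++ (a : nat) :: (b : nat) :: t) ->
  ([set Some a; Some b] \in cs) = (b < a).
Proof.
move=> [H _] /uniq_adjacent[ap bp ab _ _].
have [lt|gt|E] := ltngtP a b.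
- rewrite H // !mem_cat !inE !eqxx !orbT /= !index_cat (negbTE ap) (negbTE bp) /= eqxx (negbTE ab) eqxx.
  by apply/negbTE; rewrite -leqNgt; lia.
- rewrite finset.setUC H // !mem_cat !inE !eqxx !orbT /= !index_cat (negbTE ap) (negbTE bp) /= eqxx (negbTE ab) eqxx.
  by lia.
- by rewrite E eqxx in ab.
Qed.

Lemma crossings_swap cs p (a b : 'I_n.+1) t : a < b ->
  crossings_inverted cs (p ++ (a : nat) :: (b : nat) :: t) -> uniq (p ++ (a : nat) :: (b : nat) :: t) ->
  crossings_inverted ([set Some a; Some b] :: cs) (p ++ (b : nat) :: (a : nat) :: t).
Proof.
move=> ab [H1 H2] /uniq_adjacent[ap bp nab at_ bt]; split; last first.
  by move=> X; rewrite inE => /orP[/eqP ->|/H2 //]; exists a, b.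
move=> x y xy; rewrite inE set_some_inj // H1 // !mem_cat !inE -!val_eqE /=.
have ia : index (a : nat) (p ++ (a : nat) :: (b : nat) :: t) = size p.
  by rewrite index_cat (negbTE ap) /= eqxx addn0.
have ib : index (b : nat) (p ++ (a : nat) :: (b : nat) :: t) = (size p).+1.
  by rewrite index_cat (negbTE bp) /= (negbTE nab) eqxx addn1.
have ia' : index (a : nat) (p ++ (b : nat) :: (a : nat) :: t) = (size p).+1.
  by rewrite index_cat (negbTE ap) /= eq_sym (negbTE nab) eqxx addn1.
have ib' : index (b : nat) (p ++ (b : nat) :: (a : nat) :: t) = size p.
  by rewrite index_cat (negbTE bp) /= eqxx addn0.
have [/val_inj xa|xa] := eqVneq (x : nat) a; have [/val_inj ya|ya] := eqVneq (y : nat) b.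
- by rewrite xa ya ia' ib' ?eqxx ?orbT ltnSn.
- have yNa : (y : nat) != a by rewrite -xa; move: xy; clear; lia.
  have [-> ky] := index_swap t ap bp yNa ya.
  rewrite xa ia ia' ?eqxx (negbTE yNa) ?orbT /=; congr (_ && _).
  by move: ky; move: (index _ _) (size p) => u v; clear; lia.
- have xNb : (x : nat) != b by rewrite -ya; move: xy; clear; lia.
  have [-> kx] := index_swap t ap bp xa xNb.
  rewrite ya ib ib' ?eqxx (negbTE xNb) ?orbT /=; congr (_ && _).
  by move: kx; move: (index _ _) (size p) => u v; clear; lia.
- rewrite /=; have [/val_inj xb|xNb] := eqVneq (x : nat) b.
    have yNa : (y : nat) != a by move: xy; rewrite xb; move: ab; clear; lia.
    have [-> ky] := index_swap t ap bp yNa ya.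
    rewrite xb ib ib' ?eqxx (negbTE yNa) ?orbT /=; congr (_ && _).
    by move: ky; move: (index _ _) (size p) => u v; clear; lia.
  have [-> kx] := index_swap t ap bp xa xNb.
  have [/val_inj ya'|yNa] := eqVneq (y : nat) a.
    rewrite ya' ia ia' ?eqxx ?orbT /=; congr (_ && _); by move: kx; move: (index _ _) (size p) => u v; clear; lia.
  by have [-> ky] := index_swap t ap bp yNa ya.
Qed.

End Trace.

Section TraceRow.
Variables (n : nat) (C : {set box n}) (i : 'I_n.+1) (s : seq nat).
Hypothesis C_triangle : C \subset triangle n.
Hypothesis size_s : size s = n - i.
Hypothesis s_gt : all (ltn i) s.

Definition row_bits : seq bool := [seq (i, j) \in C | j <- take (n - i) (enum 'I_n.+1)].

Variable cs0 : seq {set option 'I_n.+1}.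

Let result := run_row i s row_bits.

Definition up_is (st : strands n) (t : seq nat) := forall k : 'I_n.+1, omap val (up st k) = onth t k.

(** [d] lists the strands already sent up, [a] is the one travelling to the right, and [r] lists
    those still to be met; the top edges read [d ++ r], but the order of the strands is
    [d ++ a :: r]. *)
Definition row_state (j : nat) (st : strands n) :=
  exists (d r : seq nat) (a : 'I_n.+1),
    [/\ size d = j, size r = n - i - j, right st = Some a, up_is st (d ++ r) &
    [/\ crossings_inverted (crossings st) (d ++ (a : nat) :: r), uniq (d ++ (a : nat) :: r),
      d ++ run_row a r (drop j row_bits) = result,
      uniq (crossings st) && row_reduced a r (drop j row_bits) = uniq cs0 && row_reduced i s row_bits &
      size (crossings st) + count id (drop j row_bits) = size cs0 + count id row_bits]].

Definition row_done (st : strands n) :=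
  [/\ up_is st result, crossings_inverted (crossings st) result, uniq result,
      uniq (crossings st) = uniq cs0 && row_reduced i s row_bits &
      size (crossings st) = size cs0 + count id row_bits].

Lemma size_run_row a t bits : size (run_row a t bits) = (size t).+1.
Proof.
elim: t a bits => [|b t IH] a [|[] bits] //=; last by rewrite IH.
by case: ifP => _; rewrite /= IH.
Qed.

Lemma size_row_bits : size row_bits = n - i.
Proof. by rewrite size_map size_takel // size_enum_ord; clear; lia. Qed.

Lemma drop_row_bits (j : 'I_n.+1) : j < n - i ->
  drop j row_bits = ((i, j) \in C) :: drop j.+1 row_bits.
Proof.
move=> ji; rewrite (drop_nth false) ?size_row_bits //; congr (_ :: _).
rewrite (nth_map j) ?size_takel ?size_enum_ord //; last by clear; lia.
by rewrite nth_take // nth_ord_enum.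
Qed.

Lemma up_turn st (a : 'I_n.+1) j d b r : size d = j :> nat -> up_is st (d ++ b :: r) ->
  forall k : 'I_n.+1, omap val (if k == j :> nat then Some a else up st k) =
    onth (rcons d (a : nat) ++ r) k.
Proof.
move=> dj H k; rewrite cat_rcons onth_cat dj; case: eqP => [->|kj].
  by rewrite ltnn subnn.
rewrite H onth_cat dj; case: ltnP => // jk.
by have -> : k - j = (k - j.+1).+1 by move: jk => /=; lia.
Qed.

Lemma row_state_step (j : 'I_n.+1) st : j < n - i -> row_state j st ->
  row_state j.+1 (visit_tile C i st j).
Proof.
move=> ji [d [r [a [dj rj ra upst [cr un ru re sz]]]]].
case: r rj upst cr un ru re sz => [|b r] rj upst cr un ru re sz.
  by move: rj => /=; lia.
have := upst j; rewrite onth_cat dj ltnn subnn /=.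
case upj : (up st j) => [b0|//] [bE]; move: upst cr un ru re sz; rewrite -{}bE => upst cr un ru re sz.
rewrite (drop_row_bits ji) in ru re sz.
have rj' : size r = n - i - j.+1 by move: rj => /=; lia.
have upturn := up_turn a dj upst.
rewrite /visit_tile ra upj; case: ifP ru re sz => ijC /= ru re sz; last first.
  exists (rcons d (a : nat)), r, b0; split; rewrite ?size_rcons ?dj //.
  by rewrite cat_rcons; split=> //; rewrite -ru cat_rcons.
rewrite (crossings_adjacent cr un); case: ifP => ab.
  have nab : (a < b0) = false by apply/negbTE; rewrite -leqNgt ltnW.
  rewrite nab in ru re.
  exists (rcons d (a : nat)), r, b0; split; rewrite ?size_rcons ?dj //.
  rewrite cat_rcons; split=> //.
  - have [H1 H2] := cr; split=> [x y xy|X]; rewrite inE.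
      rewrite -H1 // orb_idl // => /eqP ->.
      by rewrite (crossings_adjacent cr un).
    move=> /orP[/eqP ->|/H2 //]; exists b0, a; split=> //; exact: finset.setUC.
  - by rewrite -ru cat_rcons.
  - by rewrite -re /= (crossings_adjacent cr un) ab andbF.
  - by rewrite -sz /= add1n addnS.
have [_ _ nab _ _] := uniq_adjacent un.
have ab' : a < b0 by rewrite ltn_neqAle nab leqNgt ab.
rewrite ab' in ru re.
exists (rcons d (b0 : nat)), r, a; split; rewrite ?size_rcons ?dj // ?cat_rcons //.
split.
- exact: crossings_swap.
- move: un; rewrite !(uniq_catC d) /= !inE !mem_cat !negb_or eq_sym.
  by move=> /andP[/and3P[-> -> ->] /andP[/andP[-> ->] ->]].
- by rewrite -ru ?cat_rcons.
- by rewrite -re /= (crossings_adjacent cr un) ab.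
- by rewrite -sz /= add1n addnS.
Qed.

Lemma row_invariant st : up_is st s -> crossings st = cs0 -> crossings_inverted cs0 s ->
  uniq ((i : nat) :: s) -> row_done (visit_row C st i).
Proof.
move=> ups crs inv un.
(* Tile [n - i] is an elbow with no labelled strand below it: the travelling strand turns up there,
   and no label moves on along the row. *)
pose P j st' := if j <= n - i then row_state j st' else row_done st' /\ right st' = None.
suff : P n.+1 (visit_row C st i).
  by rewrite /P ifF; [case | apply/negbTE; rewrite -ltnNge; lia].
apply: foldl_enum.
  rewrite /P leq0n; exists [::], s, i; split=> //; first by rewrite subn0.
  rewrite drop0 crs; split=> //; split; last by case: inv.
  (* Putting the strand [i], smaller than all of [s], in front creates no inversion. *)
  move=> a b ab; case: inv => [-> //] _; rewrite !inE /=.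
  have gt x : x \in s -> i < x by move/(allP s_gt).
  have [ai|ai] := eqVneq (i : nat) a.
    by rewrite /= ltn0 andbF; apply/negbTE; apply: contraTN un => /and3P[aS _ _]; rewrite /= ai aS.
  have [bi|bi] := eqVneq (i : nat) b; rewrite /= ?ltnS //.
  rewrite (_ : ((a : nat) \in s) = false) //; apply/negbTE/negP => /gt.
  by rewrite bi; move: ab; clear; lia.
move=> j st' Pj; rewrite /P.
have [ji|ij] := ltnP j (n - i); first by apply: row_state_step => //; move: Pj; rewrite /P (ltnW ji).
have ijC : ((i, j) \in C) = false.
  apply/negbTE; apply: contraTN ij => /(fintype.subsetP C_triangle); rewrite inE /= -ltnNge.
  by clear; lia.
move: Pj; rewrite /P; case: leqP => [ji|ij' [[u c un' re sz] rt]]; last first.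
  have upj : up st' j = None.
    have := u j; rewrite onth_default ?size_run_row ?size_s //; first by case: (up st' j).
  split; last by rewrite /visit_tile ijC.
  rewrite /visit_tile ijC rt; split=> // k /=; case: eqP => [->|_]; last exact: u.
  by rewrite -u upj.
have jE : j = n - i :> nat by move: ij ji; clear; lia.
move=> [d [r [a [dj rj ra upst [cr un' ru re sz]]]]].
have r0 : r = [::] by apply/size0nil; rewrite rj jE subnn.
rewrite {}r0 {rj} /= in upst cr un' ru re sz.
have dropj : drop j row_bits = [::] by rewrite drop_oversize // size_row_bits jE.
rewrite {}dropj /= andbT addn0 in ru re sz.
have upj : up st' j = None.
  by have := upst j; rewrite cats0 onth_default ?dj //; case: (up st' j).
rewrite /visit_tile ijC ra upj; split=> //; split=> //=; rewrite -?ru // => k /=.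
rewrite -val_eqE /=; case: eqP => [->|kj]; first by rewrite onth_cat dj ltnn subnn.
rewrite upst cats0 onth_cat dj; case: ltnP => // jk.
rewrite [LHS]onth_default ?dj // onth_default //=; move: jk kj; clear; lia.
Qed.

End TraceRow.

Lemma all_run_row (P : pred nat) a s bits : P a -> all P s -> all P (run_row a s bits).
Proof.
elim: s a bits => [|b s IH] a bits Pa; first by case: bits => [|[] ?] _ /=; rewrite Pa.
case: bits => [|[] bits] /= /andP[Pb Ps]; rewrite ?Pa ?Pb //=; last exact: IH.
by case: ifP => _ /=; rewrite ?Pa ?Pb IH.
Qed.

Lemma sum_bits k (G : seq bool -> nat) :
  \sum_(b : k.+1.-tuple bool) G b =
  \sum_(b : k.-tuple bool) G (false :: b) + \sum_(b : k.-tuple bool) G (true :: b).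
Proof.
rewrite (reindex (fun p : bool * k.-tuple bool => [tuple of p.1 :: p.2])) /=; last first.
  exists (fun t => (thead t, [tuple of behead t])) => [[b t] _|t _] /=.
    by rewrite theadE; congr (_, _); apply: val_inj.
  by rewrite -tuple_eta.
rewrite -(pair_bigA _ (fun b (t : k.-tuple bool) => G (b :: t))) //=.
by rewrite big_bool addnC.
Qed.

Lemma row_sumE a s F : row_sum a s F =
  \sum_(b : (size s).-tuple bool | row_reduced a s b) F (run_row a s b).
Proof.
rewrite big_mkcond; elim: s a F => [|c s IH] a F /=.
  by rewrite (big_pred1 [tuple]) // => b; rewrite [b]tuple0 [RHS]eqxx.
rewrite (sum_bits _ (fun b => if row_reduced a (c :: s) b then F (run_row a (c :: s) b) else 0)) /=.
congr (_ + _); first exact: (IH c (fun t => F (a :: t))).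
by case: ifP => ac /=; [exact: (IH a (fun t => F (c :: t))) | rewrite big1].
Qed.

Section Trace.
Variable n : nat.
Implicit Types (C : {set box n}) (s t : seq nat).

Fixpoint trace_matches t m s C : bool :=
  if m is m'.+1 then
    row_reduced m' s (row_bits C (inord m')) &&
    trace_matches t m' (run_row m' s (row_bits C (inord m'))) C
  else s == t.

Lemma nth_row_bits C (i : 'I_n.+1) j : j < n - i -> nth false (row_bits C i) j = ((i, inord j) \in C).
Proof.
move=> ji; have jn : j < n.+1 by lia.
rewrite (nth_map (inord j)) ?size_takel ?size_enum_ord //; last by lia.
rewrite nth_take // (_ : nth _ _ _ = inord j) //.
by apply: val_inj; rewrite /= inordK // nth_enum_ord.
Qed.

Lemma count_row_bits C (i : 'I_n.+1) : C \subset triangle n ->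
  count id (row_bits C i) = #|[set j | (i, j) \in C]|.
Proof.
move=> /fintype.subsetP Ct; rewrite count_map cardsE cardE size_filter.
rewrite -enumT -[in RHS](cat_take_drop (n - i) (enum 'I_n.+1)) count_cat.
rewrite [X in _ = _ + X](_ : _ = 0) ?addn0.
  by apply: eq_count => j /=; rewrite unfold_in.
apply/eqP; rewrite -leqn0 leqNgt -has_count; apply/negP => /hasP[j jin].
move=> ijC; have {ijC}/Ct : (i, j) \in C by exact: ijC.
rewrite inE /=.
suff : n - i <= j by lia.
rewrite leqNgt; apply/negP => jlt.
have jt : j \in take (n - i) (enum 'I_n.+1).
  by rewrite -[j in j \in _](nth_ord_enum j j) -(nth_take _ jlt) mem_nth // size_takel // size_enum_ord; lia.
have := enum_uniq 'I_n.+1; rewrite -(cat_take_drop (n - i) (enum 'I_n.+1)) cat_uniq.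
by case/and3P => _ /hasPn/(_ j jin); rewrite jt.
Qed.

Lemma card_rows C : #|C| = \sum_(i < n.+1) #|[set j | (i, j) \in C]|.
Proof.
rewrite -sum1_card big_mkcond (eq_bigr (fun p => if (p.1, p.2) \in C then 1 else 0)).
  rewrite -(pair_bigA _ (fun i j => if (i, j) \in C then 1 else 0)) /=.
  by apply: eq_bigr => i _; rewrite -big_mkcond sum1_card cardsE.
by case.
Qed.

(** Every cross tile records one pair, repeated or not, so the length of [crossings] is [#|C|] for
    nonreduced tilings as well; comparing it with the number of distinct pairs later detects
    reducedness. *)
Lemma traceP C t : C \subset triangle n -> exists s,
  [/\ up_is (trace_strands C) s, size s = n.+1, uniq s,
      crossings_inverted (crossings (trace_strands C)) s &
      uniq (crossings (trace_strands C)) && (s == t) = trace_matches t n.+1 [::] C /\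
      size (crossings (trace_strands C)) = #|C|].
Proof.
move=> Ct.
pose P m (st : strands n) := exists s,
  [/\ up_is st s, size s = n.+1 - m, uniq s, crossings_inverted (crossings st) s &
   [/\ all (leq m) s,
      uniq (crossings st) && trace_matches t m s C = trace_matches t n.+1 [::] C &
      size (crossings st) + \sum_(i < n.+1 | i < m) #|[set j | (i, j) \in C]| = #|C|]].
suff : P 0 (trace_strands C).
  move=> [s [H1 H2 H3 H4 [_ H5 H6]]]; exists s; rewrite subn0 in H2; split=> //; split=> //.
  by rewrite -H6 big_pred0 ?addn0.
apply: foldl_rev_enum.
  exists [::]; rewrite subnn; split=> //; first by move=> k; rewrite onth_default.
  split=> //=; rewrite add0n card_rows; apply: eq_bigl => i; exact: ltn_ord.
move=> i st [s [ups sz un cr [sm tm ct]]].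
have i_s : uniq ((i : nat) :: s).
  rewrite /= un andbT; apply/negP => /(allP sm); by rewrite ltnn.
have sz' : size s = n - i by rewrite sz.
have := row_invariant Ct sz' sm ups erefl cr i_s.
move=> [u c un' re sc].
exists (run_row i s (row_bits C i)); split=> //.
  by rewrite size_run_row sz; have := ltn_ord i; lia.
split.
- apply: all_run_row; first exact: leqnn.
  by apply: sub_all sm => x; exact: ltnW.
- by rewrite re -tm /= inord_val andbA.
- rewrite sc -ct count_row_bits // -addnA; congr (_ + _).
  rewrite [RHS](bigD1 i) //=; congr (_ + _); apply: eq_bigl => k.
  by rewrite -val_eqE /=; lia.
Qed.

End Trace.

(** * Counting reduced pipe dreams by their rows of crosses *)

Section CountPipes.
Variable n : nat.
Implicit Types (C : {set box n}) (s t : seq nat).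

Definition rows_below m : {set box n} := [set p in triangle n | p.1 < m].

Definition row_crosses m (b : seq bool) : {set box n} :=
  [set p in triangle n | (p.1 == m :> nat) && nth false b p.2].

Lemma mem_rows_below m p : (p \in rows_below m) = (p \in triangle n) && (p.1 < m).
Proof. by rewrite inE. Qed.

Lemma eq_row_bits C C' (i : 'I_n.+1) : (forall j, ((i, j) \in C) = ((i, j) \in C')) ->
  row_bits C i = row_bits C' i.
Proof. by move=> E; apply: eq_map => j; rewrite E. Qed.

Lemma eq_trace_matches t m s C C' : m <= n.+1 ->
  (forall p : box n, p.1 < m -> (p \in C) = (p \in C')) ->
  trace_matches t m s C = trace_matches t m s C'.
Proof.
elim: m s => [|m IH] s mn E //=.
have -> : row_bits C (inord m) = row_bits C' (inord m).
  by apply: eq_row_bits => j; rewrite E //= inordK.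
congr (_ && _); apply: IH; first exact: ltnW.
by move=> p pm; apply: E; rewrite ltnS ltnW.
Qed.

Lemma row_bits_crosses m (b : seq bool) C : m < n.+1 -> size b = n - m ->
  (forall p : box n, p.1 = m :> nat -> (p \in C) = (p \in row_crosses m b)) ->
  row_bits C (inord m) = b.
Proof.
move=> mn sb E; apply: (@eq_from_nth _ false); first by rewrite size_row_bits inordK // sb.
move=> j; rewrite size_row_bits inordK // => jm.
have jn : j < n.+1 by lia.
rewrite nth_row_bits ?inordK // E /= ?inordK // inE inE /= !inordK // eqxx /=.
by case: (nth _ _ _); rewrite ?andbF //; lia.
Qed.

(** A set of crosses is a bit pattern in its lowest row together with a set of crosses in the rows
    above; the bit patterns are those over which [row_sumE] sums. *)
Lemma count_matches t m s : m <= n.+1 -> size s = n.+1 - m ->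
  #|[set C : {set box n} | (C \subset rows_below m) && trace_matches t m s C]| = completions t m s.
Proof.
elim: m s => [|m IH] s mn sz.
  have -> : rows_below 0 = finset.set0 by apply/setP => p; rewrite !inE ltn0 andbF.
  rewrite /=; case: eqP => _.
    by apply/eqP/cards1P; exists finset.set0; apply/setP => C; rewrite !inE subset0 andbT.
  by apply: eq_card0 => C; rewrite !inE andbF.
have mn' : m < n.+1 by [].
rewrite /= row_sumE.
have szb : size s = n - m by rewrite sz; lia.
have sbC C : size (row_bits C (inord m)) == size s by rewrite size_row_bits inordK // szb.
rewrite -sum1_card (partition_big (fun C => Tuple (sbC C)) (fun b : (size s).-tuple bool => row_reduced m s b)) /=; last first.
  by move=> C; rewrite inE => /and3P[].
apply: eq_bigr => b rb; rewrite sum1_card -IH ?size_run_row ?szb; [|exact: ltnW|by clear -mn'; lia].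
have memC C : C \in [pred C : {set box n} | (C \in [set C : {set box n} |
      (C \subset rows_below m.+1) && (row_reduced m s (row_bits C (inord m)) &&
      trace_matches t m (run_row m s (row_bits C (inord m))) C)]) &&
      (Tuple (sbC C) == b)] =
    [&& C \subset rows_below m.+1, row_bits C (inord m) == b & trace_matches t m (run_row m s b) C].
  rewrite !inE -val_eqE /=; case: eqP => [->|]; last by rewrite !andbF.
  by rewrite rb /= andbT.
rewrite -(@card_in_imset _ _ (fun C => C :&: rows_below m)).
  apply: eq_card => A; rewrite inE; apply/imsetP/idP => [[C CC ->]|].
    move: CC; rewrite memC => /and3P[Ct bE ma].
    rewrite finset.subsetIr /= -(eq_trace_matches _ _ _ (C := C)) // => [|p pm]; first exact: ltnW.
    rewrite inE mem_rows_below pm andbT; case pC : (p \in C) => //=.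
    by have := fintype.subsetP Ct p pC; rewrite mem_rows_below => /andP[->].
  move=> /andP[At ma]; exists (A :|: row_crosses m b).
    rewrite memC; apply/and3P; split.
    - apply/fintype.subsetP => p; rewrite mem_rows_below in_setU => /orP[/(fintype.subsetP At)|].
        by rewrite mem_rows_below => /andP[-> pm]; rewrite ltnS ltnW.
      by rewrite inE => /and3P[-> /eqP -> _] /=.
    - apply/eqP/row_bits_crosses; rewrite ?size_tuple ?szb // => p pm; rewrite in_setU.
      case pA : (p \in A) => //; have := fintype.subsetP At p pA.
      by rewrite mem_rows_below pm ltnn andbF.
    - rewrite -(eq_trace_matches _ _ _ (C := A)) // => [|p pm]; first exact: ltnW.
      by rewrite in_setU [p \in row_crosses _ _]inE (ltn_eqF pm) andbF orbF.
  apply/setP => p; rewrite finset.in_setI in_setU mem_rows_below.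
  case pA : (p \in A) => /=; first by have := fintype.subsetP At p pA; rewrite mem_rows_below.
  by rewrite inE; case: eqP => [->|]; rewrite ?ltnn ?andbF.
move=> C C'; rewrite !memC => /and3P[Ct /eqP bE _] /and3P[Ct' /eqP bE' _] E.
apply/setP => p; have := congr1 (fun D : {set box n} => p \in D) E.
rewrite !finset.in_setI mem_rows_below; case: ltngtP => pm; rewrite ?andbF ?andbT.
- case pt : (p \in triangle n); rewrite ?andbT //= => _.
  have no (D : {set box n}) : D \subset rows_below m.+1 -> p \in D = false.
    move=> DS; apply/negbTE/negP => /(fintype.subsetP DS); by rewrite mem_rows_below pt.
  by rewrite !no.
- move=> _; have no (D : {set box n}) : D \subset rows_below m.+1 -> p \in D = false.
    move=> DS; apply/negbTE/negP => /(fintype.subsetP DS); rewrite mem_rows_below ltnS.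
    by rewrite (leqNgt p.1) pm andbF.
  by rewrite !no.
move=> _; case pt : (p \in triangle n); last first.
  have no (D : {set box n}) : D \subset rows_below m.+1 -> p \in D = false.
    move=> DS; apply/negbTE/negP => /(fintype.subsetP DS); by rewrite mem_rows_below pt.
  by rewrite !no.
have p1 : inord m = p.1 :> 'I_n.+1 by apply: val_inj; rewrite /= inordK.
have p2 : p.2 < n - (inord m : 'I_n.+1) by move: pt; rewrite p1 inE /=; lia.
have := congr1 (fun u => nth false u p.2) (etrans bE (esym bE')).
by rewrite /= !nth_row_bits // inord_val p1 -surjective_pairing.
Qed.

Lemma onth_one_line (w : 'S_n.+1) (j : 'I_n.+1) : onth (one_line w) j = Some (w j : nat).
Proof. by rewrite onth_map onthE (nth_map j) ?size_enum_ord // nth_ord_enum. Qed.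

Lemma card_reduced_pipes (w : 'S_n.+1) :
  #|reduced_pipes w| = completions (one_line w) n.+1 [::].
Proof.
rewrite -count_matches ?subnn //; apply: eq_card => C; rewrite !inE.
have -> : rows_below n.+1 = triangle n.
  by apply/setP => p; rewrite mem_rows_below ltn_ord andbT.
case Ct : (C \subset triangle n) => //; rewrite !andTb.
have [s [us sz un cr [<- _]]] := traceP (one_line w) Ct.
rewrite andbC; congr (_ && _); apply/forallP/eqP => [H|E j].
  apply: eq_from_onth_le; rewrite sz size_one_line maxnn => k kn.
  by rewrite -(us (Ordinal kn)) (eqP (H _)) (onth_one_line w (Ordinal kn)).
have := us j; rewrite E onth_one_line.
by case: (up _ j) => //= x [/val_inj ->].
Qed.

End CountPipes.

Lemma walks_gt0 b o : 0 < walks b o.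
Proof.
by elim: o b => [|[] o IH] b //=; rewrite big_ord_recl ltn_addr.
Qed.

(** * The Grothendieck polynomial at beta = 0 *)

Section Grothendieck.
Variables (n : nat) (w : 'S_n.+1).
Implicit Types C : {set box n}.

Lemma pipes_subset C : C \in pipes w -> C \subset triangle n.
Proof. by rewrite inE => /andP[]. Qed.

Lemma crossings_pipes C : C \in pipes w ->
  crossings_inverted (crossings (trace_strands C)) (one_line w) /\
  size (crossings (trace_strands C)) = #|C|.
Proof.
rewrite inE => /andP[Ct /forallP up_w].
have [s [us sz _ cr [_ szc]]] := traceP [::] Ct; split=> //.
suff <- : s = one_line w by [].
apply: eq_from_onth_le; rewrite sz size_one_line maxnn => k kn.
by rewrite -(us (Ordinal kn)) (eqP (up_w _)) (onth_one_line w (Ordinal kn)).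
Qed.

Lemma card_crossings C C' : C \in pipes w -> C' \in pipes w ->
  size (undup (crossings (trace_strands C))) = size (undup (crossings (trace_strands C'))).
Proof.
move=> /crossings_pipes[[H1 H2] _] /crossings_pipes[[H1' H2'] _].
apply/perm_size/uniq_perm; rewrite ?undup_uniq // => X; rewrite !mem_undup.
apply/idP/idP => XC; first by have [a [b [ab E]]] := H2 _ XC; rewrite E H1' // -H1 // -E.
by have [a [b [ab E]]] := H2' _ XC; rewrite E H1 // -H1' // -E.
Qed.

Lemma card_elbows C : C \subset triangle n -> #|elbows C| = #|triangle n| - #|C|.
Proof. by move=> Ct; rewrite cardsD (setIidPr Ct). Qed.

Lemma card_reduced_le C C' : C \in reduced_pipes w -> C' \in pipes w ->
  #|C| <= #|C'| ?= iff reduced C'.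
Proof.
rewrite inE => /andP[Cw rC] C'w.
have [_ <-] := crossings_pipes Cw; have [_ <-] := crossings_pipes C'w.
rewrite -(undup_id rC) (card_crossings Cw C'w); split; first exact: size_undup.
by rewrite /reduced -[uniq _]negbK -ltn_size_undup ltn_neqAle size_undup andbT negbK.
Qed.

(** Reduced pipe dreams have the least number of crosses, one for each inversion of [w], so all
    facets are as large as [elbows C0], and only reduced pipe dreams reach that size. *)
Lemma codim_elbows C0 C : C0 \in reduced_pipes w -> C \in pipes w ->
  (codim w (elbows C) == 0) = reduced C.
Proof.
move=> C0w Cw; have [C0t Ct] : C0 \subset triangle n /\ C \subset triangle n.
  by split; apply: pipes_subset => //; move: C0w; rewrite inE => /andP[].
rewrite /codim (_ : \max_(G in pd_complex w) #|G| = #|elbows C0|).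
  rewrite subn_eq0 !card_elbows //.
  have [leC <-] := card_reduced_le C0w Cw.
  have := subset_leq_card Ct; move: leC; clear; lia.
apply/eqP; rewrite eqn_leq; apply/andP; split.
  apply/bigmax_leqP => G; rewrite inE => /existsP[C' /andP[C'w GC']].
  apply: leq_trans (subset_leq_card GC') _.
  have C'p : C' \in pipes w by move: C'w; rewrite inE => /andP[].
  rewrite !card_elbows ?(pipes_subset C'p) //; have [leC _] := card_reduced_le C0w C'p.
  exact: leq_sub2l.
apply: (bigop.bigmax_sup (elbows C0)) => //; rewrite inE; apply/existsP; exists C0.
by rewrite C0w subxx.
Qed.

Lemma grothendieck0 (K : comNzRingType) : (exists C, C \in reduced_pipes w) ->
  (grothendieck w (0 : K) [tuple 1 | i < n] = #|reduced_pipes w|%:R)%R.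
Proof.
move=> [C0 C0w]; rewrite /grothendieck -sum1_card GRing.natr_sum big_mkcond [RHS]big_mkcond /=.
apply: eq_bigr => C _; rewrite [C \in reduced_pipes w]inE; case: ifP => //= Cw.
rewrite big1 ?GRing.mulr1 => [|p pC].
  rewrite GRing.expr0n (codim_elbows C0w Cw); by case: (reduced C).
(* Crosses avoid the last row, so the variable is a true entry of the tuple and not the default of
   [nth]. *)
have pn : p.1 < n by have := fintype.subsetP (pipes_subset Cw) p pC; rewrite inE; clear; lia.
by rewrite (nth_map (Ordinal pn)) // size_enum_ord.
Qed.

End Grothendieck.

Section Count.
Variables (n : nat) (w : 'S_n.+1).
Hypothesis wdom : one_dominant w.

Lemma card_reduced_pipes_walks :
  #|reduced_pipes w| = walks 0 (row_word (row_length w) n.-1).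
Proof. by rewrite card_reduced_pipes completions_nil. Qed.

Lemma reduced_pipes_exists : exists C, C \in reduced_pipes w.
Proof. by apply/card_gt0P; rewrite card_reduced_pipes_walks walks_gt0. Qed.

End Count.

(** * The tree of the permutation *)

Lemma hub_cat z o1 o2 : hub z (o1 ++ o2) = hub (hub z o2) o1.
Proof. by elim: o1 => [|[[] v] o1 IH] /=. Qed.

Lemma word_edges_cat z o1 o2 :
  word_edges z (o1 ++ o2) = word_edges (hub z o2) o1 ++ word_edges z o2.
Proof. by elim: o1 => [|[[] v] o1 IH] //=; rewrite IH hub_cat. Qed.

Lemma hub_sources z vs : hub z [seq (Source, v) | v <- vs] = z.
Proof. by elim: vs. Qed.

Lemma word_edges_sources z vs :
  word_edges z [seq (Source, v) | v <- vs] = [seq (v, z) | v <- vs].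
Proof. by elim: vs => //= v vs ->; rewrite hub_sources. Qed.

(* [L r] stands for the length of row [r] of the diagram, [H] for the number of
   nonempty rows, and vertex [v] for the label [v + 1]. *)
Section Model.
Variables (L : nat -> nat) (H : nat).
Hypothesis L0 : L 0 = 0.
Hypothesis L_anti : forall r, 0 < r -> L r.+1 <= L r.
Hypothesis L_gt0 : forall r, (0 < L r) = (0 < r <= H).

(** The bottom pipe dream covers the columns below [L r]; the top one covers the columns 1, ...,
    [L r.+1], being row [r.+1] of the diagram pushed up; the corner adds column 0 in row 0. *)
Definition region_row (r : nat) := if r <= H then maxn (L r) (L r.+1).+1 else 0.
Local Notation rho := region_row.

(* East steps of row [r] with a label of their own; the east step of column
   [L r.+1] has none. *)
Definition new_sources r := L r - (L r.+1).+1.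

Definition add_row (r : nat) (oz : seq (letter * nat) * nat) :=
  let k := (size oz.1).+1 in
  if L r <= L r.+1 then (rcons oz.1 (Sink, k), oz.2)
  else (oz.1 ++ (Hub, oz.2) :: [seq (Source, v) | v <- iota k (new_sources r)], k + new_sources r).

(* The word and the last hub of the part of the tree that is labelled in the rows
   [H - d], ..., [H]. *)
Fixpoint tree_word (d : nat) : seq (letter * nat) * nat :=
  if d is d'.+1 then add_row (H - d'.+1) (tree_word d')
  else ([seq (Source, v) | v <- iota 0 (L H)], L H).

Definition last_label d := (size (tree_word d).1).+1.

(** If [L r.+2 = L r.+1], the column [L r.+1] already belongs to row [r.+1] of the region and was
    labelled there or earlier. *)
Definition row_columns (r k : nat) : seq (nat * nat) :=
  (if L r.+2 < L r.+1 then [:: (L r.+1, k)] else [::]) ++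
  [seq ((L r.+1).+1 + t, k.+1 + t) | t <- iota 0 (new_sources r)].

(** The [minn] matters only for the identity, whose single column gets label 0. *)
Fixpoint column_labels (d : nat) : seq (nat * nat) :=
  if d is d'.+1 then column_labels d' ++ row_columns (H - d'.+1) (last_label d')
  else [seq (c, minn (L H) c.+1) | c <- iota 0 (rho H)].

Fixpoint row_labels (d : nat) : seq (nat * nat) :=
  if d is d'.+1 then rcons (row_labels d') (H - d'.+1, last_label d)
  else [:: (H, last_label 0)].

Lemma last_labelS d : last_label d.+1 = (last_label d + new_sources (H - d.+1)).+1.
Proof.
rewrite /last_label /= /add_row; case: ifP => Lr /=; rewrite ?size_rcons ?size_cat /=.
  by rewrite /new_sources; move: Lr; clear; lia.
by rewrite size_map size_iota; clear; lia.
Qed.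

Definition model_edges d i j := exists r c,
  [/\ H - d <= r, L r.+1 <= c < rho r, (c, i.+1) \in column_labels d & (r, j.+1) \in row_labels d].

Lemma new_sourcesE r : r <= H -> rho r = (L r.+1).+1 + new_sources r.
Proof. by rewrite /region_row /new_sources => ->; clear; lia. Qed.

Lemma region_row_anti r : rho r.+1 <= rho r.
Proof.
rewrite /region_row; case: (leqP r.+1 H) => // rH; rewrite (ltnW rH).
by have := L_anti (ltn0Sn r); clear; lia.
Qed.

Lemma region_row_leq r r' : r <= r' -> rho r' <= rho r.
Proof.
move=> /subnK <-; elim: (r' - r) => [|k IH] //; exact: leq_trans (region_row_anti _) IH.
Qed.

Lemma column_labels_lt d c l : d <= H -> (c, l) \in column_labels d -> c < rho (H - d).
Proof.
elim: d c l => [|d IH] c l dH /=.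
  by move=> /mapP[c']; rewrite mem_iota subn0 => ? [-> _].
have E : H - d = (H - d.+1).+1 by lia.
have mono : rho (H - d) <= rho (H - d.+1) by rewrite E region_row_anti.
rewrite mem_cat => /orP[/(IH _ _ (ltnW dH)) cr|]; first exact: leq_trans mono.
rewrite new_sourcesE ?leq_subr // /row_columns mem_cat => /orP[|/mapP[t]].
  by case: ifP => // _; rewrite inE => /eqP[-> _]; clear; lia.
by rewrite mem_iota => ? [-> _]; lia.
Qed.

Lemma row_labels_ge d r l : (r, l) \in row_labels d -> H - d <= r.
Proof.
elim: d => [|d IH] /=; first by rewrite inE subn0 => /eqP[->].
by rewrite mem_rcons inE => /orP[/eqP[->] //|/IH]; lia.
Qed.

(* The last hub is the label of the column [L r] for [r = H - d]; its east step may
   only come with the next row. *)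
Definition hub_label d :=
  let r := H - d in let z := (tree_word d).2 in
  if L r.+1 < L r then z.+1 = last_label d
  else 0 < r -> forall l, ((L r, l) \in column_labels d) = (l == z.+1).

Lemma next_columns d : d < H -> hub_label d ->
  let r := H - d.+1 in let k := last_label d in
  (forall l, ((L r.+1, l) \in column_labels d.+1) = (l == (tree_word d).2.+1)) /\
  (forall t l, ((L r.+1).+1 + t, l) \in column_labels d.+1 = (t < new_sources r) && (l == k.+1 + t)).
Proof.
move=> dH; have E : H - d = (H - d.+1).+1 by lia.
rewrite /hub_label /= E; have lt_c0 c l := @column_labels_lt d c l (ltnW dH); move: lt_c0; rewrite E new_sourcesE; last by lia.
set r := H - d.+1; set k := last_label d => lt_c hub_r; split=> [l|t l].
  rewrite mem_cat /row_columns mem_cat.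
  have -> : ((L r.+1, l) \in [seq ((L r.+1).+1 + t, k.+1 + t) | t <- iota 0 (new_sources r)]) = false.
    by apply/negbTE/mapP => -[t _ [+ _]]; clear; lia.
  rewrite orbF; move: hub_r; case: ifP => [Lr ->|Lr -> //]; last by rewrite in_nil orbF.
  rewrite inE xpair_eqE eqxx /= orb_idl // => /lt_c.
  by rewrite /new_sources; move: Lr; clear; lia.
rewrite mem_cat /row_columns mem_cat.
have -> : ((L r.+1).+1 + t, l) \in column_labels d = false.
  by apply/negbTE/negP => /lt_c; rewrite /new_sources; have := L_anti (ltn0Sn r); clear; lia.
have -> : ((L r.+1).+1 + t, l) \in (if L r.+2 < L r.+1 then [:: (L r.+1, k)] else [::]) = false.
  by case: ifP => // _; rewrite inE xpair_eqE; clear; lia.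
rewrite /=; apply/mapP/andP => [[t']|[ts /eqP ->]].
  by rewrite mem_iota => t's [E1 ->]; have -> : t = t' by lia.
by exists t => //; rewrite mem_iota.
Qed.

Lemma hub_labelP d : d <= H -> hub_label d.
Proof.
elim: d => [|d IH] dH.
  rewrite /hub_label subn0 /last_label /= size_map size_iota.
  case: ifP => // LH H0; have := L_gt0 H; rewrite H0 leqnn.
  by have := L_gt0 H.+1; rewrite ltnn; move: LH; clear; lia.
have [h1 h2] := next_columns dH (IH (ltnW dH)); rewrite /hub_label.
move: h1 h2; set r := H - d.+1 => h1 h2; case: ifP => Lr.
  by rewrite last_labelS -/r /= /add_row -/r leqNgt Lr /= /last_label.
move=> r0 l; have Lr' : L r = L r.+1 by have := L_anti r0; move: Lr; clear; lia.
by rewrite Lr' h1 /= /add_row -/r Lr' leqnn.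
Qed.

Lemma tree_word_edges d : d < H ->
  let k := last_label d in let s := new_sources (H - d.+1) in
  word_edges (tree_word d.+1).2 (tree_word d.+1).1 =
  word_edges (tree_word d).2 (tree_word d).1 ++
    ((tree_word d).2, k + s) :: [seq (v, k + s) | v <- iota k s].
Proof.
move=> dH /=; rewrite /add_row; case: ifP => Lr /=.
  rewrite -cats1 word_edges_cat /= (_ : new_sources _ = 0) ?addn0 //.
  by rewrite /new_sources; move: Lr; clear; lia.
by rewrite word_edges_cat /= hub_sources word_edges_sources.
Qed.

(** One more row adds exactly the dots in that row: one in the column of the last hub and one for
    each new source, all joined to the north step of the row. The columns first labelled in it lie
    to the right of all lower rows, whose edges do not change. *)
Lemma model_edgesP d i j : d <= H ->
  (i, j) \in word_edges (tree_word d).2 (tree_word d).1 <-> model_edges d i j.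
Proof.
elim: d i j => [|d IH] i j dH.
  have LH1 : L H.+1 = 0 by have := L_gt0 H.+1; rewrite ltnn; clear; lia.
  rewrite /model_edges subn0 /= word_edges_sources /region_row leqnn LH1; split.
    move=> /mapP[v]; rewrite mem_iota => /= vL [-> ->]; exists H, v; split=> //.
    - by move: vL; rewrite /= leqnn LH1 /=; clear; lia.
    - by apply/mapP; exists v; [rewrite mem_iota | congr (_, _)]; move: vL; clear; lia.
    - by rewrite /last_label /= size_map size_iota inE.
  move=> [r [c [Hr cr /mapP[c' _ [_ ic]]]]].
  rewrite inE /last_label /= size_map size_iota => /eqP[rH ->].
  apply/mapP; exists i; rewrite ?mem_iota //=; first by move: ic; clear; lia.
rewrite tree_word_edges // mem_cat inE.
set r := H - d.+1; set k := last_label d; set s := new_sources r; set z := (tree_word d).2.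
have [h1 h2] := next_columns dH (hub_labelP (ltnW dH)); rewrite -/r -/s -/k -/z in h1 h2.
have rowS : row_labels d.+1 = rcons (row_labels d) (r, (k + s).+1) by rewrite /= last_labelS.
have rho_r : rho r = (L r.+1).+1 + s by rewrite new_sourcesE // leq_subr.
have E : H - d = r.+1 by rewrite /r; lia.
have rowsP r' l : r < r' -> ((r', l) \in row_labels d.+1) = ((r', l) \in row_labels d).
  by move=> rr'; rewrite rowS mem_rcons inE xpair_eqE gtn_eqF.
have rowr l : ((r, l) \in row_labels d.+1) = (l == (k + s).+1).
  rewrite rowS mem_rcons inE xpair_eqE eqxx /= orb_idr // => /row_labels_ge.
  by rewrite E ltnn.
have colsP r' c l : r < r' -> L r'.+1 <= c < rho r' ->
    ((c, l) \in column_labels d.+1) = ((c, l) \in column_labels d).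
  move=> rr' /andP[_ cr']; rewrite /= mem_cat orb_idr // /row_columns mem_cat.
  have : c < rho r.+1 := leq_trans cr' (region_row_leq rr').
  rewrite /region_row -E leq_subr E -/r => cr /orP[|/mapP[t _ [ct _]]]; last first.
    by move: cr ct; have := L_anti (ltn0Sn r); clear; lia.
  by case: ifP => // Lr; rewrite inE => /eqP[cL _]; move: cr; rewrite cL; move: Lr; clear; lia.
split.
  move=> /orP[/IH|/orP[/eqP[-> ->]|/mapP[v]]].
  - move=> [] //; first exact: ltnW.
    move=> r' [c [r'd c_r' cC rR]]; have rr' : r < r' by move: r'd; rewrite E.
    by exists r', c; rewrite -/r (ltnW rr') rowsP // (colsP r').
  - exists r, (L r.+1); rewrite -/r leqnn h1 rowr !eqxx rho_r; split=> //; clear; lia.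
  - rewrite mem_iota => vks [-> ->]; exists r, ((L r.+1).+1 + (v - k)).
    rewrite -/r leqnn h2 rowr eqxx rho_r; split=> //; move: vks; clear; lia.
move=> [r' [c]]; rewrite -/r leq_eqVlt => -[/orP[/eqP<-|rr'] c_r' cC rR].
  move: c_r' cC rR; rewrite rowr rho_r eqSS => /andP[Lc cr] + /eqP ->.
  have [->|nLc] := eqVneq c (L r.+1); first by rewrite h1 eqSS => /eqP ->; rewrite eqxx orbT.
  have -> : c = (L r.+1).+1 + (c - (L r.+1).+1) by move: Lc nLc; clear; lia.
  rewrite h2 => /andP[cs /eqP ik]; apply/orP; right; apply/orP; right.
  apply/mapP; exists i => //; rewrite mem_iota; move: cs ik; clear; lia.
apply/orP; left; apply/IH; first exact: ltnW.
by exists r', c; rewrite E -(colsP r') // -rowsP.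
Qed.

Lemma iota_rcons m k : iota m k.+1 = rcons (iota m k) (m + k).
Proof. by rewrite -cats1 -addn1 iotaD. Qed.

(** The word is not sorted by labels: a hub is written after the sinks that hang on it, although
    their labels are larger. *)
Lemma perm_tree_word d : perm_eq (word_vertices (tree_word d).2 (tree_word d).1) (iota 0 (last_label d)).
Proof.
elim: d => [|d IH].
  by rewrite /word_vertices /last_label iota_rcons /= size_map size_iota -map_comp map_id.
rewrite last_labelS iota_rcons; have [k kE] : {k | k = last_label d} by exists (last_label d).
move: IH; rewrite -kE /word_vertices /= /add_row -/(last_label d) -kE => IH; case: ifP => Lr /=.
  rewrite (_ : new_sources _ = 0); last by rewrite /new_sources; move: Lr; clear; lia.
  rewrite map_rcons addn0 add0n; set M := map _ _ in IH *; set z := _.2 in IH *.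
  apply: (@perm_trans _ (rcons (rcons M z) k)); last by rewrite -!(cats1 _ k) perm_cat2r.
  by rewrite -!cats1 -!catA perm_cat2l (perm_catC [:: k] [:: z]).
rewrite map_cat /= -map_comp map_id iotaD !add0n -cat_rcons -!cats1.
by rewrite perm_cat2r cats1 perm_cat2r.
Qed.

Lemma tree_word_edges_lt d : d <= H -> all (fun e => e.1 < e.2) (word_edges (tree_word d).2 (tree_word d).1).
Proof.
elim: d => [_|d IH dH].
  by rewrite /= word_edges_sources all_map; apply/allP => v; rewrite mem_iota.
rewrite tree_word_edges // all_cat /= IH ?(ltnW dH) //=; apply/andP; split.
  have zo : (tree_word d).2 \in word_vertices (tree_word d).2 (tree_word d).1.
    by rewrite /word_vertices mem_rcons mem_head.
  by move: zo; rewrite (perm_mem (perm_tree_word d)) mem_iota => /andP[_]; apply: ltn_addr.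
by rewrite all_map; apply/allP => v; rewrite mem_iota => /andP[].
Qed.

Lemma good_word_cat a b : good_word (a ++ Hub :: b) = good_word a && good_word b.
Proof.
elim: a => [|[] a IH] //=; rewrite IH andbA; congr (_ && _ && _).
by case: a {IH}.
Qed.

Lemma good_tree_word d : good_word (letters (tree_word d).1).
Proof.
have gs vs : good_word (letters [seq (Source, v) | v <- vs]) by elim: vs.
elim: d => [|d IH] //=; rewrite /add_row; case: ifP => _ /=.
  rewrite /letters map_rcons -cats1; move: IH; rewrite /letters; move: (map _ _).
  by elim=> [|[] o IHo] //=; case: o IHo => [|[]] //=.
by rewrite /letters map_cat /= good_word_cat IH gs.
Qed.

Definition row_chunk r :=
  if L r <= L r.+1 then [:: Sink] else Hub :: nseq (new_sources r) Source.

Fixpoint chunks r := if r is r'.+1 then row_chunk r' ++ chunks r' else [::].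

Lemma letters_tree_word d : d <= H ->
  letters (tree_word d).1 ++ chunks (H - d) = nseq (L H) Source ++ chunks H.
Proof.
have lS k s : letters [seq (Source, v) | v <- iota k s] = nseq s Source.
  by elim: s k => //= s IH k; congr (_ :: _); exact: IH.
elim: d => [|d IH] dH; first by rewrite subn0 /= lS.
rewrite -IH ?(ltnW dH) //= /add_row (_ : H - d = (H - d.+1).+1) /=; last by lia.
rewrite catA; congr (_ ++ _); rewrite /row_chunk /letters; case: ifP => _ /=.
  by rewrite map_rcons cats1.
by rewrite map_cat /=; congr (_ ++ _ :: _); exact: lS.
Qed.

Lemma eq_walks_cat p o o' : (forall b, walks b o = walks b o') ->
  forall b, walks b (p ++ o) = walks b (p ++ o').
Proof.
by move=> E; elim: p => [|[] p IH] b //=; apply: eq_bigr => i _.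
Qed.

(** For walks a hub is a sink followed by a source. The lost source is thus restored:
    [new_sources r] plus one is [L r - L r.+1] in a row that ends in a hub. *)
Lemma walks_chunks r b : walks b (chunks r.+1) = walks b (Sink :: row_word L r).
Proof.
elim: r b => [|r IH] b.
  by rewrite [chunks 1]/= cats0 /row_chunk L0.
transitivity (walks b (Sink :: nseq (L r.+1 - L r.+2) Source ++ chunks r.+1)).
  rewrite [chunks _]/= -/(chunks r.+1) /row_chunk; case: ifP => Lr.
    by rewrite (_ : _ - _ = 0) //; move: Lr; clear; lia.
  by rewrite (_ : L r.+1 - L r.+2 = (new_sources r.+1).+1) // /new_sources; move: Lr; clear; lia.
by apply: (@eq_walks_cat (Sink :: nseq _ _)) => b'; rewrite IH.
Qed.

Lemma walks_tree_word N : H <= N -> walks 0 (letters (tree_word H).1) = walks 0 (row_word L N).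
Proof.
have LH r : H < r -> L r = 0 by move=> Hr; have := L_gt0 r; move: Hr; clear; lia.
(* The empty rows below row [H] put sinks at the start of the word, where level 0 leaves no
   choice. *)
move=> /subnK <-; elim: (N - H) => [|k ->]; last first.
  by rewrite addSn /= !LH ?ltnS ?leqW ?leq_addl //= big_ord1.
rewrite add0n; have := letters_tree_word (leqnn H); rewrite subnn cats0 => ->.
case HE : H => [|h]; first by rewrite L0.
rewrite (eq_walks_cat _ (walks_chunks h)) /= [L h.+2]LH ?HE // subn0.
by [].
Qed.

End Model.

(** * Labels along the boundary, in natural-number coordinates *)

Section Labels.
Variables (L : nat -> nat) (H n : nat).
Hypothesis L0 : L 0 = 0.
Hypothesis L_anti : forall r, 0 < r -> L r.+1 <= L r.
Hypothesis L_gt0 : forall r, (0 < L r) = (0 < r <= H).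
Hypothesis Hn : H <= n.
Local Notation rho := (region_row L H).

Implicit Types (prev : option (bool * (nat * nat))) (e : bool * (nat * nat)).

Definition fresh prev :=
  if prev is Some (false, q) then L q.1 <= q.2 else true.

Definition nat_own_label prev e :=
  match e with
  | (false, _) => true
  | (true, p) => (p.2 < L p.1) && fresh prev
  end.

Fixpoint nat_label_steps prev (k : nat) (s : seq (bool * (nat * nat))) :=
  if s is e :: s' then
    let k' := if nat_own_label prev e then k.+1 else k in
    (e, k') :: nat_label_steps (Some e) k' s'
  else [::].

Definition nat_boundary_row (r : nat) : seq (bool * (nat * nat)) :=
  [seq (true, (r, c)) | c <- iota (rho r.+1) (rho r - rho r.+1)] ++
  (if r <= H then [:: (false, (r, (rho r).-1))] else [::]).

Definition nat_boundary (r : nat) :=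
  flatten [seq nat_boundary_row r' | r' <- rev (iota r (n.+1 - r))].

Lemma label_run prev k r a s q rest : (0 < s -> a + s <= L r /\ fresh prev) ->
  nat_label_steps prev k ([seq (true, (r, c)) | c <- iota a s] ++ (false, q) :: rest) =
  [seq ((true, (r, a + t)), k.+1 + t) | t <- iota 0 s] ++
  ((false, q), (k + s).+1) :: nat_label_steps (Some (false, q)) (k + s).+1 rest.
Proof.
elim: s prev k a => [|s IH] prev k a own; first by rewrite addn0.
have [//|as_ fr] := own; rewrite /= fr andbT ifT; last by move: as_; clear; lia.
rewrite IH; last by split=> //; move: as_; clear; lia.
rewrite !addn0 addSnnS; congr (_ :: _ ++ _).
rewrite -[1]addn0 iotaDl -map_comp; apply: eq_map => t /=.
by congr (_, (_, _), _); clear; lia.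
Qed.

(** The last box of row [r.+1] is a cross exactly if [L r.+2 < L r.+1]. In that case the first east
    step of row [r] takes over the label of the north step before it; otherwise all its east steps
    are new. *)
Lemma label_row r k rest : r < H ->
  nat_label_steps (Some (false, (r.+1, (rho r.+1).-1))) k (nat_boundary_row r ++ rest) =
  [seq ((true, (r, p.1)), p.2) | p <- row_columns L r k] ++
  ((false, (r, (rho r).-1)), (k + new_sources L r).+1) ::
  nat_label_steps (Some (false, (r, (rho r).-1))) (k + new_sources L r).+1 rest.
Proof.
move=> rH; have rho_r := new_sourcesE L (ltnW rH).
rewrite /nat_boundary_row (ltnW rH) -catA cat1s /row_columns map_cat -map_comp.
have L1 : 0 < L r.+1 by rewrite L_gt0.
have L2 := L_anti (ltn0Sn r).
have rho_r1 : rho r.+1 = if L r.+2 < L r.+1 then L r.+1 else (L r.+1).+1.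
  by rewrite /region_row rH; case: ltnP; move: L2; clear; lia.
rewrite rho_r; case: ifP rho_r1 => Lr ->.
  rewrite (_ : _ - _ = (new_sources L r).+1) /=; last by clear; lia.
  rewrite [L r.+1 <= _]leqNgt prednK // leqnn andbF label_run; last first.
    by split=> //; move: H0; rewrite /new_sources; clear; lia.
  done.
rewrite (_ : _ - _ = new_sources L r) /=; last by clear; lia.
rewrite label_run /=; last by split=> //; move: H0; rewrite /new_sources; clear; lia.
done.
Qed.

Lemma nat_boundary_last : nat_boundary H = nat_boundary_row H.
Proof.
rewrite /nat_boundary subSn //= rev_cons map_rcons flatten_rcons.
have row_out r : H < r -> nat_boundary_row r = [::].
  by rewrite /nat_boundary_row /region_row; case: leqP.
have : {in rev (iota H.+1 (n - H)), forall r, H < r}.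
  by move=> r; rewrite mem_rev mem_iota => /andP[].
elim: (rev _) => //= r s IHs Hs; rewrite row_out ?Hs ?mem_head //= IHs // => r' r's.
by apply: Hs; rewrite inE r's orbT.
Qed.

Lemma label_boundary d rest : d <= H -> exists M,
  [/\ nat_label_steps None 0 (nat_boundary (H - d) ++ rest) =
      M ++ nat_label_steps (Some (false, (H - d, (rho (H - d)).-1))) (last_label L H d) rest,
    [seq (x.1.2.2, x.2) | x <- M & x.1.1] = column_labels L H d,
    [seq (x.1.2.1, x.2) | x <- M & ~~ x.1.1] = row_labels L H d &
    last 0 [seq x.2 | x <- M] = last_label L H d].
Proof.
elim: d rest => [|d IH] rest dH.
  exists ([seq ((true, (H, c)), minn (L H) c.+1) | c <- iota 0 (rho H)] ++
    [:: ((false, (H, (rho H).-1)), last_label L H 0)]).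
  have L1 : L H.+1 = 0 by have := L_gt0 H.+1; rewrite ltnn; clear; lia.
  have lastE : last_label L H 0 = (L H).+1 by rewrite /last_label /= size_map size_iota.
  rewrite subn0; split.
  - rewrite nat_boundary_last /nat_boundary_row leqnn -catA cat1s.
    rewrite [rho H.+1]/region_row ltnn subn0 lastE -catA cat1s.
    (* [H = 0] is the identity: the single box is no cross, so its east step keeps label 0. *)
    case H0 : H => [|h].
      have L1' : L 1 = 0 by have := L1; rewrite H0.
      by rewrite /region_row leq0n L1' L0 /= L0.
    have rhoE : rho H = L H by rewrite /region_row leqnn L1; have := L_gt0 H; rewrite {2}H0 leqnn; clear; lia.
    rewrite -H0 rhoE label_run // add0n; congr (_ ++ _); apply/eq_in_map => t.
    by rewrite mem_iota => tL; congr (_, _); move: tL; clear; lia.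
  - rewrite filter_cat map_cat filter_map /= -map_comp cats0.
    by rewrite (eq_filter (a2 := predT)) ?filter_predT.
  - rewrite filter_cat map_cat filter_map /=.
    by rewrite (eq_filter (a2 := pred0)) ?filter_pred0.
  - by rewrite map_cat last_cat.
have E : H - d = (H - d.+1).+1 by lia.
have [M [eM cM rM lM]] := IH (nat_boundary_row (H - d.+1) ++ rest) (ltnW dH).
exists (M ++ [seq ((true, (H - d.+1, p.1)), p.2) | p <- row_columns L (H - d.+1) (last_label L H d)] ++
  [:: ((false, (H - d.+1, (rho (H - d.+1)).-1)), last_label L H d.+1)]).
split.
- rewrite {1}/nat_boundary (_ : n.+1 - (H - d.+1) = (n.+1 - (H - d)).+1); last by lia.
  rewrite /= -E rev_cons map_rcons flatten_rcons -catA -/(nat_boundary (H - d)) eM.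
  by rewrite E label_row ?last_labelS -?catA //; lia.
- rewrite !filter_cat filter_map /= cats0 map_cat cM -map_comp.
  rewrite (eq_filter (a2 := predT)) // filter_predT; congr (_ ++ _).
  by rewrite -[RHS]map_id; apply: eq_map => -[].
- rewrite !filter_cat filter_map /= map_cat rM (eq_filter (a2 := pred0)) // filter_pred0.
  by rewrite -cats1.
- by rewrite !map_cat !last_cat.
Qed.

End Labels.

Lemma enum_interval N a b : b <= N ->
  [seq val c | c : 'I_N <- enum 'I_N & a <= c < b] = iota a (b - a).
Proof.
move=> bN; apply: (irr_sorted_eq ltn_trans ltnn).
- rewrite -(filter_map val (fun c => a <= c < b)) val_enum_ord.
  by apply: (sorted_filter ltn_trans); exact: iota_ltn_sorted.
- exact: iota_ltn_sorted.
move=> k; rewrite -(filter_map val (fun c => a <= c < b)) val_enum_ord mem_filter !mem_iota.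
by move: bN; clear; lia.
Qed.

Lemma card_column n (c : 'I_n.+1) (P : pred 'I_n.+1) (A : {set box n}) :
  (forall r, ((r, c) \in A) = P r) ->
  #|[set q in A | q.2 == c]| = #|[set r | P r]|.
Proof.
move=> AP; have inj : injective (fun r : 'I_n.+1 => (r, c)) by move=> r r' [].
rewrite -(card_imset _ inj); apply: eq_card => -[r d]; rewrite inE /=.
apply/andP/imsetP => [[rd /eqP dc]|[r' + [-> ->]]].
  by exists r; rewrite ?inE -?AP -dc.
by rewrite inE -AP.
Qed.

(** * The tree of the permutation as the tree of a word *)

Section Tree.
Variables (n : nat) (w : 'S_n.+1).
Hypothesis wdom : one_dominant w.
Local Notation L := (row_length w).

Lemma nonzero_rows : exists H, (forall r, (0 < L r) = (0 < r <= H)) /\ H <= n.-1.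
Proof.
have ex : exists h, L h.+1 == 0 by exists n; rewrite row_length_out.
case: (ex_minnP ex) => h /eqP Lh h_min; exists h; split.
  move=> [|r]; first by rewrite row_length0.
  have [hr|rh] := ltnP h r.+1; rewrite lt0n.
    have : L r.+1 <= L h.+1.
      rewrite -(subnK hr); elim: (r.+1 - h.+1) => // k IH; rewrite addSn addnS.
      by apply: leq_trans (row_lengthS wdom _) _ => //; rewrite -addnS.
    by rewrite Lh leqn0 => /eqP ->.
  by apply/eqP => /eqP /h_min; rewrite leqNgt rh.
apply: h_min; case: n w => [|m] v; first by rewrite row_length_out.
by have := row_length_leq v (leqnn m.+1) => /=; clear; lia.
Qed.

Variable H : nat.
Hypothesis L_gt0 : forall r, (0 < L r) = (0 < r <= H).
Hypothesis Hn : H <= n.-1.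
Local Notation rho := (region_row L H).

Let L0 : L 0 = 0 := row_length0 wdom.
Let L_anti : forall r, 0 < r -> L r.+1 <= L r := row_lengthS wdom.

Lemma mem_bottom_pd (r c : 'I_n.+1) : ((r, c) \in bottom_pd w) = (c < L r).
Proof. by rewrite inE /=; congr (_ < _); apply: eq_card => q; rewrite !inE. Qed.

Lemma mem_region (r c : 'I_n.+1) : ((r, c) \in region w) = (c < rho r).
Proof.
rewrite !in_setU in_set1 mem_bottom_pd [_ \in top_pd w]inE /= column_diagramE // xpair_eqE -!val_eqE /=.
rewrite /region_row; have := L_gt0 r; have := L_gt0 r.+1.
have := L_anti (r := r); case: (r : nat) => [|k].
  by move=> _ _ _; rewrite L0 max0n ltnS; case: (c : nat).
move=> /(_ isT); case: (leqP k.+1 H) => kH; rewrite /=.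
  by move=> _ _ L1; rewrite leq_max; case: (c : nat) => [|c'] //=; rewrite L1.
move=> + _ /negbT; rewrite -leqNgt leqn0 => + /eqP L1; rewrite L1 leqn0 => /eqP ->.
by case: (c : nat).
Qed.

Lemma region_row_le r : rho r <= n.+1.
Proof.
rewrite /region_row; case: (leqP r H) => // rH; have rn : r <= n by move: rH Hn; clear; lia.
have := row_length_leq w rn.
have [r1|] := ltnP r n; first by have := row_length_leq w r1; clear; lia.
by move=> nr; rewrite (@row_length_out _ _ r.+1) //; clear; lia.
Qed.

Lemma row_length_le r : L r <= n.
Proof.
have [rn|nr] := leqP r n; last by rewrite row_length_out.
by apply: leq_trans (row_length_leq w rn); rewrite leq_addr.
Qed.

(** Rows of the diagram start in column 1, so column [c] of the bottom pipe dream is column [c.+1]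
    of the diagram; both are empty for [c = n]. *)
Lemma card_bottom_column (r c : 'I_n.+1) : (r < #|[set r' : 'I_n.+1 | c < L r']|) = (c < L r.+1).
Proof.
have [cn|nc] := ltnP c n.
  have := column_diagramE wdom r (Ordinal (cn : c.+1 < n.+1)).
  by rewrite (@card_column _ _ (fun r' => c < L r')) // => r'; rewrite diagramE.
have out r' : (c < L r') = false by apply/negbTE; rewrite -leqNgt (leq_trans (row_length_le r')).
by rewrite out (_ : [set r' : 'I_n.+1 | _] = finset.set0) ?cards0 //; apply/setP => r'; rewrite !inE out.
Qed.

(* With all rows counted inside the column [c] of the region, both the boxes
   below row [r] and the elbows are complements: of the [r + 1] first rows and
   of the crosses of the bottom pipe dream. *)
Lemma mem_dots (r c : 'I_n.+1) : ((r, c) \in dots w) = (L r.+1 <= c < rho r).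
Proof.
rewrite inE /= mem_region andbC; have [cr|_] := ltnP c (rho r); last by rewrite !andbF.
rewrite !andbT.
pose col := [set r' : 'I_n.+1 | c < rho r'].
have -> : [set q in region w | (q.2 == c) && (r < q.1)] = [set q in [set q in region w | r < q.1] | q.2 == c].
  by apply/setP => q; rewrite !inE; case: (q.2 == c); rewrite ?andbT ?andbF.
rewrite (@card_column _ _ (fun r' => (c < rho r') && (r < r'))); last by move=> r'; rewrite inE mem_region.
rewrite (@card_column _ _ (fun r' => ~~ (c < L r') && (c < rho r'))); last first.
  by move=> r'; rewrite in_setD mem_bottom_pd mem_region.
have below : #|[set r' : 'I_n.+1 | (c < rho r') && (r < r')]| + r.+1 = #|col|.
  rewrite -(cardsID [set r' : 'I_n.+1 | r < r'] col); congr (#|pred_of_set _| + _).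
    by apply/setP => r'; rewrite !inE.
  have -> : col :\: [set r' : 'I_n.+1 | r < r'] = [set r' : 'I_n.+1 | r' < r.+1].
    apply/setP => r'; rewrite !inE ltnS -leqNgt andb_idr // => r'r.
    by apply: leq_trans cr _; exact: region_row_leq.
  rewrite -sum1_card (eq_bigl (fun r' : 'I_n.+1 => r' < r.+1)) => [|r']; last by rewrite inE.
  by rewrite -(big_ord_widen n.+1 (fun=> 1)) // sum_nat_const card_ord muln1.
have elbs : #|[set r' : 'I_n.+1 | ~~ (c < L r') && (c < rho r')]| + #|[set r' : 'I_n.+1 | c < L r']| = #|col|.
  rewrite addnC -(cardsID [set r' : 'I_n.+1 | c < L r'] col); congr (_ + _); apply: eq_card => r'; rewrite !inE ?andbT //.
    rewrite andb_idl // => cL; apply: leq_trans cL _.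
    have := L_gt0 r'; rewrite /region_row; case: (leqP r' H) => // _; first by rewrite leq_max leqnn.
    by rewrite andbF lt0n => /negbFE/eqP ->.
rewrite (leqNgt (L r.+1)) -card_bottom_column; move: below elbs => /=; move: #|_| #|_| #|_| #|_|; clear; lia.
Qed.

Definition nat_step (e : step n) : bool * (nat * nat) := (e.1, (e.2.1 : nat, e.2.2 : nat)).

Lemma nat_boundary_rowE (r : 'I_n.+1) :
  map nat_step (boundary_row (region w) r) = nat_boundary_row L H r.
Proof.
have lowE (c : 'I_n.+1) : lowest_in_column (region w) (r, c) = (rho r.+1 <= c < rho r).
  rewrite /lowest_in_column mem_region andbC; congr (_ && _).
  apply/forallP/idP => [low|low r'].
    rewrite leqNgt; apply/negP => cr; have [rn|nr] := ltnP r n.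
      by have := low (Ordinal (rn : r.+1 < n.+1)); rewrite /= ltnSn mem_region cr.
    by move: cr; rewrite /region_row (leqNgt r.+1) (leq_ltn_trans (leq_trans Hn (leq_pred n))).
  apply/implyP => /= rr'; rewrite mem_region -leqNgt; apply: leq_trans low.
  exact: region_row_leq.
have lastE (c : 'I_n.+1) : last_in_row (region w) (r, c) = ((rho r).-1 <= c < rho r).
  rewrite /last_in_row mem_region andbC; congr (_ && _).
  apply/forallP/idP => [low|low c'].
    rewrite leqNgt; apply/negP => cr; have cn : c.+1 < n.+1.
      by have := region_row_le r; move: cr; clear; lia.
    by have := low (Ordinal cn); rewrite /= ltnSn mem_region /= -ltnS; move: cr; clear; lia.
  by apply/implyP => /=; rewrite mem_region; move: low; clear; lia.
rewrite /boundary_row /nat_boundary_row map_cat -!map_comp; congr (_ ++ _).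
  rewrite -(@enum_interval n.+1) ?region_row_le // -map_comp; congr map.
  exact: eq_filter.
transitivity [seq (false, (r : nat, c)) | c <- iota (rho r).-1 (rho r - (rho r).-1)].
  by rewrite -(@enum_interval n.+1) ?region_row_le // -map_comp; congr map; apply: eq_filter.
case: (leqP r H) => rH; last by rewrite /region_row (leqNgt r H) rH.
by rewrite (_ : _ - _ = 1) // /region_row rH; clear; lia.
Qed.

Lemma map_label_steps prev k s :
  [seq (nat_step e.1, e.2) | e <- label_steps (bottom_pd w) prev k s] =
  nat_label_steps L (omap nat_step prev) k (map nat_step s).
Proof.
have ownE e p : own_label (bottom_pd w) p e = nat_own_label L (omap nat_step p) (nat_step e).
  case: e => -[] [r c] //=; rewrite mem_bottom_pd /=; congr (_ && _).
  by case: p => // -[[] [r' c']] //=; rewrite mem_bottom_pd (leqNgt (L r')).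
by elim: s prev k => //= e s IH prev k; rewrite IH ownE.
Qed.

Lemma labelled_boundaryE :
  [/\ nb_labels w = last_label L H H,
    forall (c : 'I_n.+1) l, [exists r, (East (r, c), l) \in labelled_boundary w] =
      ((c : nat, l) \in column_labels L H H) &
    forall (r : 'I_n.+1) l, [exists c, (North (r, c), l) \in labelled_boundary w] =
      ((r : nat, l) \in row_labels L H H)].
Proof.
have bE : map nat_step (boundary (region w)) = nat_boundary L H n 0.
  rewrite /boundary /nat_boundary map_flatten -map_comp subn0 -val_enum_ord -map_rev -map_comp.
  by congr flatten; apply: eq_map => r /=; rewrite nat_boundary_rowE.
have Hn' : H <= n := leq_trans Hn (leq_pred n).
have [M [+ cM rM lM]] := label_boundary L0 L_anti L_gt0 Hn' [::] (leqnn H).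
rewrite subnn /= !cats0 -bE -[None]/(omap nat_step None) -map_label_steps => ME.
rewrite -/(labelled_boundary w) in ME; split.
- by rewrite -lM -ME -map_comp.
- move=> c l; rewrite -cM -ME; apply/existsP/mapP => [[r rc]|[x]].
    exists (nat_step (East (r, c)), l) => //; rewrite mem_filter /=.
    by apply/mapP; exists (East (r, c), l).
  rewrite mem_filter => /andP[+ /mapP[[[b [r c']] l'] yB xE]]; rewrite {x}xE /=.
  by move=> bT [/val_inj -> ->]; exists r; move: yB; rewrite bT.
- move=> r l; rewrite -rM -ME; apply/existsP/mapP => [[c rc]|[x]].
    exists (nat_step (North (r, c)), l) => //; rewrite mem_filter /=.
    by apply/mapP; exists (North (r, c), l).
  rewrite mem_filter => /andP[+ /mapP[[[b [r' c]] l'] yB xE]]; rewrite {x}xE /=.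
  by move=> /negbTE bF [/val_inj -> ->]; exists c; move: yB; rewrite bF.
Qed.

Lemma tree_edgeE (i j : 'I_(nb_labels w)) : (i < j) && tree_edge w i j =
  ((i : nat, j : nat) \in word_edges (tree_word L H H).2 (tree_word L H H).1).
Proof.
have [_ colE rowE] := labelled_boundaryE.
have P := model_edgesP L0 L_anti L_gt0 i j (leqnn H).
apply/idP/idP => [/andP[_ /andP[_ /existsP[[r c] /andP[rc /andP[]]]]]|ij].
  rewrite colE rowE mem_dots in rc * => ci rj; apply/P; exists r, c.
  by rewrite subnn.
have lt_ij : i < j by have /allP/(_ _ ij) := tree_word_edges_lt L (leqnn H).
move/P: ij => [r [c [_ rc ci rj]]]; rewrite /tree_edge lt_ij /=.
have cn : c < n.+1 by have := region_row_le r; move: rc; clear; lia.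
have rn : r < n.+1.
  by move: rc; rewrite /region_row; case: (leqP r H); move: Hn; clear; lia.
apply/existsP; exists (Ordinal rn, Ordinal cn); rewrite mem_dots rc /=.
by rewrite colE rowE /= ci.
Qed.

End Tree.

(** * Lebesgue measure and unimodular changes of coordinates *)

From mathcomp Require Import all_classical all_reals all_analysis.
From mathcomp Require Import measurable_realfun.

Import Order.TTheory GRing.Theory Num.Theory.
Import numFieldNormedType.Exports.
Local Open Scope classical_set_scope.
Local Open Scope ring_scope.

Section Line.
Variable R : realType.
Local Notation mu := (@lebesgue_measure R).

Lemma measurable_affine (a b : R) : measurable_fun setT (fun x : R => x * a + b).
Proof.
by apply: measurable_funD => //; apply: measurable_realfun.measurable_funM.
Qed.

Lemma lebesgue_measure_affine (a b : R) (A : set R) : a != 0 -> measurable A ->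
  (`|a|%:E * mu [set x | A (x * a + b)%R] = mu A)%E.
Proof.
move=> a0 mA.
pose phi : measurableTypeR R -> measurableTypeR R := fun x => x * a + b.
have mphi : measurable_fun setT phi by exact: measurable_affine.
pose k : {nonneg R} := NngNum (normr_ge0 a).
pose pf0 : {measure set (measurableTypeR R) -> \bar R} := pushforward mu phi.
pose pf := pf0 mphi.
pose nu : {measure set (measurableTypeR R) -> \bar R} := mscale k pf.
have -> // : mu A = nu A.
apply: lebesgue_measure_unique mA => _ [[x y]] _ <-.
rewrite /nu /= /mscale /= /pushforward /= /phi.
have [a_gt0|a_le0] := ltP 0 a.
  have -> : (fun x0 => x0 * a + b) @^-1` `]x, y] = `](x - b) / a, (y - b) / a]%classic.
    apply/seteqP; split => t /=; rewrite !in_itv /= ler_pdivlMr // ltr_pdivrMr // => /andP[h1 h2]; apply/andP; split; lra.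
  rewrite !lebesgue_measure_itv /= !lte_fin ltr_pM2r ?invr_gt0 // ltrD2r.
  case: ifP => _; last by rewrite mule0.
  by rewrite -!EFinB -EFinM gtr0_norm //; congr EFin; field.
have a_lt0 : a < 0 by rewrite lt_neqAle a0.
(* A negative slope moves the closed end of the interval to the other side, which does not affect
   its length. *)
have -> : (fun x0 => x0 * a + b) @^-1` `]x, y] = `[(y - b) / a, (x - b) / a[%classic.
  apply/seteqP; split => t /=; rewrite !in_itv /= ler_ndivrMr // ltr_ndivlMr // => /andP[h1 h2]; apply/andP; split; lra.
rewrite !lebesgue_measure_itv /= !lte_fin ltr_nM2r ?invr_lt0 // ltrD2r.
case: ifP => _; last by rewrite mule0.
by rewrite -!EFinB -EFinM ltr0_norm //; congr EFin; field.
Qed.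

Lemma ge0_integral_affine (a b : R) (f : R -> \bar R) : a != 0 ->
  measurable_fun setT f -> (forall x, 0 <= f x)%E ->
  (`|a|%:E * \int[mu]_x f (x * a + b)%R = \int[mu]_x f x)%E.
Proof.
move=> a0 mf f0.
pose phi : measurableTypeR R -> measurableTypeR R := fun x => x * a + b.
have mphi : measurable_fun setT phi by exact: measurable_affine.
pose k : {nonneg R} := NngNum (normr_ge0 a).
pose pf0 : {measure set (measurableTypeR R) -> \bar R} := pushforward mu phi.
pose pf := pf0 mphi.
have -> : (\int[mu]_x f (x * a + b)%R = \int[pf]_x f x)%E.
  by rewrite ge0_integral_pushforward.
rewrite -(@ge0_integral_mscale _ _ _ pf setT measurableT k f) //.
apply: eq_measure_integral => A mA _; exact: lebesgue_measure_affine.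
Qed.

End Line.

Section TupleMeasure.
Variable R : realType.
Local Notation mu := (@lebesgue_measure R).
Local Open Scope ereal_scope.

Lemma lebesgue_tupleS d (A : set (d.+1.-tuple R)) :
  lebesgue_tuple A = \int[mu]_x lebesgue_tuple [set t : d.-tuple R | A [tuple of x :: t]].
Proof.
rewrite /= /product_measure1; apply: eq_integral => x _ /=; congr lebesgue_tuple.
by apply/seteqP; split => t; rewrite /xsection /= inE.
Qed.

Definition consp d (p : (measurableTypeR R * d.-tuple R)%type) : d.+1.-tuple R :=
  [tuple of p.1 :: p.2].

Lemma measurable_consp d : measurable_fun setT (@consp d).
Proof. exact: measurable_cons. Qed.

Lemma sigma_finite_pushforward_consp d
    (m : {sigma_finite_measure set (d.-tuple R) -> \bar R}) :
  sigma_finite setT (pushforward (mu \x m) (@consp d)).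
Proof.
have /sigma_finiteP[F [TF ndF Foo]] := sigma_finiteT mu.
have /sigma_finiteP[G [TG ndG Goo]] := sigma_finiteT m.
exists (fun n => [set t : d.+1.-tuple R | F n (thead t) /\ G n [tuple of behead t]]).
  apply/seteqP; split => // t _.
  have [i _ Fi] : (\bigcup_k F k) (thead t) by rewrite -TF.
  have [j _ Gj] : (\bigcup_k G k) [tuple of behead t] by rewrite -TG.
  exists (maxn i j) => //=; split.
    by move: (thead t) Fi; exact/subsetPset/ndF/leq_maxl.
  by move: [tuple of behead t] Gj; exact/subsetPset/ndG/leq_maxr.
move=> k; have [mF Fk] := Foo k; have [mG Gk] := Goo k; split.
  apply: measurableI.
    by rewrite -[X in measurable X]setTI; exact: measurable_tnth.
  by rewrite -[X in measurable X]setTI; exact: measurable_behead.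
rewrite /pushforward (_ : _ @^-1` _ = F k `*` G k); last first.
  apply/seteqP; split => -[x t]; rewrite /consp /= theadE.
    by case=> ? h; split => //=; move: h; congr (G k _); apply/val_inj.
  by case=> ? h; split => //=; move: h; congr (G k _); apply/val_inj.
by rewrite product_measure1E// lte_mul_pinfty// ge0_fin_numE.
Qed.

(** The recursion defines a bare set function. Nonnegativity and Tonelli need a sigma-finite
    measure, obtained as the image of the product measure under consing. *)
Lemma lebesgue_tuple_measure d :
  {m : {sigma_finite_measure set (d.-tuple R) -> \bar R} | (m : set _ -> _) = @lebesgue_tuple R d}.
Proof.
elim: d => [|d [m mE]].
  by exists (@dirac _ _ ([tuple] : 0.-tuple R) R).
pose pr := (product_measure1 mu m : {measure set _ -> \bar R}).
pose pf0 : {measure set (d.+1.-tuple R) -> \bar R} := pushforward pr (@consp d).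
pose pf := pf0 (@measurable_consp d).
pose sm : {sigma_finite_measure set (d.+1.-tuple R) -> \bar R} :=
  HB.pack (pf : set _ -> _) (Measure.class pf) (@Measure_isSigmaFinite.Build _ _ _ (pf : set _ -> _) (sigma_finite_pushforward_consp m)).
exists sm; rewrite /= /pf /pf0 /= /pushforward /pr /=.
by apply/funext => A; rewrite mE.
Qed.

End TupleMeasure.

(** * Change of variables for affine maps *)

Section TupleAffine.
Variable R : realType.
Local Notation mu := (@lebesgue_measure R).

Definition tuple_row d (t : d.-tuple R) : 'rV[R]_d := \row_i tnth t i.

Definition affine_tuple d (M : 'M[R]_d) (y : 'rV[R]_d) (t : d.-tuple R) : d.-tuple R :=
  [tuple (tuple_row t *m M + y) 0 i | i < d].

Lemma tuple_row_affine d (M : 'M[R]_d) y t :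
  tuple_row (affine_tuple M y t) = tuple_row t *m M + y.
Proof. by apply/rowP => i; rewrite mxE tnth_mktuple. Qed.

Lemma tuple_row_inj d : injective (@tuple_row d).
Proof.
by move=> s t st; apply: eq_from_tnth => i; move/rowP: st => /(_ i); rewrite !mxE.
Qed.

Lemma affine_tupleM d (M N : 'M[R]_d) y z t :
  affine_tuple M y (affine_tuple N z t) = affine_tuple (N *m M) (z *m M + y) t.
Proof. by apply: tuple_row_inj; rewrite !tuple_row_affine mulmxDl mulmxA addrA. Qed.

Lemma measurable_affine_tuple d (M : 'M[R]_d) (y : 'rV[R]_d) :
  measurable_fun setT (affine_tuple M y).
Proof.
apply/measurable_fun_tnthP => i.
rewrite (_ : _ \o _ = fun t => (\sum_j tnth t j * M j i) + y 0 i); last first.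
  apply/funext => t /=; rewrite tnth_mktuple mxE mxE; congr (_ + _).
  by apply: eq_bigr => j _; rewrite mxE.
apply: measurable_funD => //; apply: measurable_sum => j.
by apply: measurable_funM => //; exact: measurable_tnth.
Qed.

Lemma measurable_cons_section d (A : set (d.+1.-tuple R)) x : measurable A ->
  measurable [set t : d.-tuple R | A [tuple of x :: t]].
Proof.
move=> mA; rewrite -[X in measurable X]setTI.
exact: (@measurable_cons _ _ _ R (fun=> x) d id).
Qed.

Lemma measurable_lebesgue_tuple_section d (A : set (d.+1.-tuple R)) : measurable A ->
  measurable_fun setT (fun x : R => lebesgue_tuple [set t : d.-tuple R | A [tuple of x :: t]]).
Proof.
move=> mA; have [m mE] := lebesgue_tuple_measure R d.
have mB : measurable [set p : measurableTypeR R * d.-tuple R | A (consp p)].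
  by rewrite -[X in measurable X]setTI; exact: measurable_consp.
have := measurable_fun_xsection m mB.
apply: eq_measurable_fun => x _ /=; rewrite mE; congr lebesgue_tuple.
by apply/seteqP; split => t; rewrite /xsection /= inE.
Qed.

(** Tonelli. A shear moves the first coordinate by an amount that depends on the others, so that
    coordinate has to be integrated first. *)
Lemma lebesgue_tupleS_swap d (m : {sigma_finite_measure set (d.-tuple R) -> \bar R})
    (A : set (d.+1.-tuple R)) : (m : set _ -> _) = @lebesgue_tuple R d ->
  measurable A ->
  lebesgue_tuple A = (\int[m]_t mu [set x | A [tuple of x :: t]])%E.
Proof.
move=> mE mA.
have mB : measurable [set p : measurableTypeR R * d.-tuple R | A (consp p)].
  by rewrite -[X in measurable X]setTI; exact: measurable_consp.
have := indic_fubini_tonelli mu m mB.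
rewrite indic_fubini_tonelli_FE // indic_fubini_tonelli_GE // => H.
rewrite lebesgue_tupleS; transitivity (\int[mu]_x (m \o xsection [set p | A (consp p)]) x)%E.
  apply: eq_integral => x _ /=; rewrite mE; congr lebesgue_tuple.
  by apply/seteqP; split => t; rewrite /xsection /= inE.
rewrite H; apply: eq_integral => t _ /=; congr (mu _).
by apply/seteqP; split => x; rewrite /ysection /= inE.
Qed.

(** The translation is included for the induction on dimension: on the slice at [x], the
    off-diagonal row [u] of a block matrix acts as the translation [x *: u]. *)
Definition volume_scaling d (M : 'M[R]_d) := forall y (A : set (d.-tuple R)), measurable A ->
  (`|\det M|%:E * lebesgue_tuple [set t | A (affine_tuple M y t)] = lebesgue_tuple A)%E.

Lemma volume_scalingM d (M N : 'M[R]_d) : volume_scaling M -> volume_scaling N ->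
  volume_scaling (N *m M).
Proof.
move=> hM hN y A mA.
rewrite det_mulmx normrM mulrC EFinM -muleA.
have -> : [set t | A (affine_tuple (N *m M) y t)] =
    [set t | [set s | A (affine_tuple M y s)] (affine_tuple N 0 t)].
  by apply/seteqP; split => t /=; rewrite affine_tupleM mul0mx add0r.
rewrite hN ?hM //.
by rewrite -[X in measurable X]setTI; exact: measurable_affine_tuple.
Qed.

Lemma tuple_row_cons d (x : R) (t : d.-tuple R) :
  tuple_row [tuple of x :: t] = row_mx (x%:M : 'rV[R]_1) (tuple_row t) :> 'rV[R]_(1 + d).
Proof.
apply/rowP => i; rewrite !mxE; case: splitP => j ij.
  by rewrite ord1 !mxE (_ : i = ord0) ?tnth0 //; apply/val_inj; rewrite /= ij ord1.
by rewrite mxE (_ : i = lift ord0 j) ?tnthS //; apply/val_inj; rewrite /= ij.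
Qed.

Lemma affine_tuple_cons d (a : R) (u : 'rV[R]_d) (v : 'cV[R]_d) (M : 'M[R]_d) (b : R) (y : 'rV[R]_d)
    (x : R) (t : d.-tuple R) :
  affine_tuple (block_mx (a%:M : 'M[R]_1) u v M : 'M[R]_(1 + d)) (row_mx (b%:M : 'M[R]_1) y)
    [tuple of x :: t] =
  [tuple of (x * a + (tuple_row t *m v) 0 0 + b) :: affine_tuple M (x *: u + y) t].
Proof.
apply: tuple_row_inj; rewrite tuple_row_affine !tuple_row_cons tuple_row_affine.
rewrite mul_row_block add_row_mx; congr row_mx.
  rewrite -scalar_mxM; apply/matrixP => i j; rewrite !ord1 !mxE /= mulr1n.
  by rewrite mulr1n.
by rewrite mul_scalar_mx addrA; congr (_ + _); rewrite addrC.
Qed.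

Lemma row_mx_split d (y : 'rV[R]_(1 + d)) : y = row_mx ((lsubmx y 0 0)%:M : 'M[R]_1) (rsubmx y).
Proof. by rewrite -mx11_scalar hsubmxK. Qed.

Lemma volume_scaling_upper d (a : R) (u : 'rV[R]_d) (M : 'M[R]_d) : a != 0 ->
  volume_scaling M -> volume_scaling (block_mx (a%:M : 'M[R]_1) u 0 M : 'M[R]_(1 + d)).
Proof.
move=> a0 hM y A mA; rewrite (row_mx_split y); move: (lsubmx y 0 0) (rsubmx y) => b {}y.
rewrite det_ublock det_scalar1 normrM EFinM -muleA !lebesgue_tupleS.
pose f x := lebesgue_tuple [set t : d.-tuple R | A [tuple of x :: t]].
have f0 x : (0 <= f x)%E.
  by rewrite /f; have [m <-] := lebesgue_tuple_measure R d; exact: measure_ge0.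
have mf : measurable_fun setT f by exact: measurable_lebesgue_tuple_section.
rewrite -[RHS](ge0_integral_affine b a0 mf f0); congr (_ * _)%E.
rewrite -ge0_integralZl //.
- apply: eq_integral => x _.
  rewrite /f -(hM (x *: u + y) _ (measurable_cons_section (x * a + b) mA)).
  by congr (_ * lebesgue_tuple _)%E; apply/seteqP; split => t;
    rewrite /mkset affine_tuple_cons mulmx0 mxE addr0.
- apply: measurable_lebesgue_tuple_section.
  by rewrite -[X in measurable X]setTI; exact: measurable_affine_tuple.
- by move=> x _; have [m <-] := lebesgue_tuple_measure R d; exact: measure_ge0.
Qed.

Lemma volume_scaling1 d : volume_scaling (1%:M : 'M[R]_d).
Proof.
elim: d => [|d IH].
  move=> y A mA; rewrite det1 normr1 mul1e; congr lebesgue_tuple.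
  by apply/seteqP; split => t /=; rewrite (tuple0 (affine_tuple _ _ _)) (tuple0 t).
have := @volume_scaling_upper d 1 0 _ (oner_neq0 R) IH.
by rewrite -scalar_mx_block.
Qed.

Lemma volume_scaling_shear d (v : 'cV[R]_d) :
  volume_scaling (block_mx (1%:M : 'M[R]_1) 0 v 1%:M : 'M[R]_(1 + d)).
Proof.
suff H (A : set (d.+1.-tuple R)) : measurable A -> lebesgue_tuple
    [set t | A (affine_tuple (block_mx (1%:M : 'M[R]_1) 0 v 1%:M : 'M[R]_(1 + d)) 0 t)]
    = lebesgue_tuple A.
  move=> y A mA; rewrite det_lblock !det1 mulr1 normr1 mul1e.
  have mA' : measurable [set t : d.+1.-tuple R | A (affine_tuple 1%:M y t)].
    by rewrite -[X in measurable X]setTI; exact: measurable_affine_tuple.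
  rewrite -[RHS](volume_scaling1 y mA) det1 normr1 mul1e -(H _ mA').
  by congr lebesgue_tuple; apply/seteqP; split => t /=; rewrite affine_tupleM !mulmx1 add0r.
move=> mA; have [m mE] := lebesgue_tuple_measure R d.
rewrite !(lebesgue_tupleS_swap mE) //; last first.
  by rewrite -[X in measurable X]setTI; exact: measurable_affine_tuple.
apply: eq_integral => t _.
have -> : 0 = row_mx (0%:M : 'M[R]_1) 0 :> 'rV[R]_(1 + d) by rewrite raddf0 row_mx0.
transitivity (mu [set x | A [tuple of (x * 1 + (tuple_row t *m v) 0 0)%R :: t]]).
  congr (mu _); apply/seteqP; split => x /=; rewrite affine_tuple_cons addr0.
    by congr (A [tuple of _ :: _]); apply: tuple_row_inj; rewrite tuple_row_affine mulmx1 scaler0 !addr0.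
  by congr (A [tuple of _ :: _]); apply: tuple_row_inj; rewrite tuple_row_affine mulmx1 scaler0 !addr0.
rewrite -[RHS](@lebesgue_measure_affine R 1 ((tuple_row t *m v) 0 0)) ?normr1 ?mul1e ?oner_neq0 //.
rewrite -[X in measurable X]setTI.
exact: (@measurable_cons _ _ (measurableTypeR R) R id d (fun=> t)).
Qed.

(** Gaussian elimination: a matrix with nonzero corner is a shear times a block upper triangular
    matrix whose lower block is again invertible. *)
Lemma volume_scaling_unit d (M : 'M[R]_d) : M \in unitmx -> volume_scaling M.
Proof.
elim: d => [|d IH] in M *.
  by move=> _; rewrite (flatmx0 M) -(flatmx0 1%:M); exact: volume_scaling1.
move: M; rewrite -[d.+1]/(1 + d)%N => M.
have step (N : 'M[R]_(1 + d)) : N \in unitmx -> ulsubmx N 0 0 != 0 -> volume_scaling N.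
  move=> uN; rewrite -{2}(submxK N) (mx11_scalar (ulsubmx N)).
  set a := ulsubmx N 0 0; rewrite mxE eqxx mulr1n => a0.
  have E : block_mx (a%:M : 'M[R]_1) (ursubmx N) (dlsubmx N) (drsubmx N) =
    block_mx (1%:M : 'M[R]_1) 0 (a^-1 *: dlsubmx N) 1%:M *m
    block_mx (a%:M : 'M[R]_1) (ursubmx N) 0 (drsubmx N - (a^-1 *: dlsubmx N) *m ursubmx N).
    rewrite mulmx_block !mul1mx !mul0mx !addr0; congr block_mx.
      by rewrite -scalemxAl mul_mx_scalar scalerA mulVf // scale1r.
    by rewrite addrC subrK.
  rewrite E; apply: volume_scalingM; last exact: volume_scaling_shear.
  apply: volume_scaling_upper => //; apply: IH.
  have dN : \det N = \det (a%:M : 'M[R]_1) * \det (drsubmx N - (a^-1 *: dlsubmx N) *m ursubmx N).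
    rewrite -{1}(submxK N) (mx11_scalar (ulsubmx N)) -/a E.
    by rewrite det_mulmx det_lblock det_ublock !det1 !mul1r.
  by move: uN; rewrite !unitmxE dN unitrM => /andP[].
(* A zero corner is repaired by adding to the first row a row with nonzero first entry; one exists,
   for otherwise the determinant would vanish. *)
move=> uM; have [a0|a0] := eqVneq (ulsubmx M 0 0) 0; last exact: step.
have [i vi] : exists i, dlsubmx M i 0 != 0.
  apply: contrapT => /forallNP H.
  have : \det M = 0.
    rewrite -(submxK M) (mx11_scalar (ulsubmx _)) a0.
    have -> : dlsubmx M = 0.
      by apply/matrixP => i j; rewrite [RHS]mxE ord1; apply/eqP; rewrite -[_ == _]negbK; apply/negP/H.
    by rewrite (@det_ublock R 1 d) det_scalar1 mul0r.
  by move: uM; rewrite unitmxE => /[swap] ->; rewrite unitr0.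
have -> : M = block_mx (1%:M : 'M[R]_1) (- delta_mx 0 i) 0 1%:M *m
   (block_mx (1%:M : 'M[R]_1) (delta_mx 0 i) 0 1%:M *m M).
  rewrite mulmxA mulmx_block !mul1mx !mulmx1 !mul0mx !mulmx0 !addr0 add0r addrN.
  by rewrite -scalar_mx_block mul1mx.
apply: volume_scalingM; last first.
  by apply: volume_scaling_upper (oner_neq0 R) (@volume_scaling1 _).
apply: step.
  by rewrite unitmx_mul uM andbT unitmxE det_ublock !det1 mulr1 unitr1.
rewrite -(submxK M) mulmx_block block_mxKul mul1mx mxE a0 add0r.
by rewrite -rowE mxE.
Qed.

End TupleAffine.

(** * Volume of the root polytope of a word *)

Section DividedPowers.
Variable R : realType.
Local Notation mu := (@lebesgue_measure R).

(** In divided powers the integrals below have integer coefficients, and the factorial of the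
    normalized volume cancels at the end. *)
Definition dpow k (x : R) : R := x ^+ k / k`!%:R.

Lemma dpow0 x : dpow 0 x = 1. Proof. by rewrite /dpow expr0 fact0 divr1. Qed.

Lemma dpowS0 k : dpow k.+1 0 = 0. Proof. by rewrite /dpow expr0n mul0r. Qed.

Lemma integral_poly (p : {poly R}) (a b : R) : a <= b ->
  (\int[mu]_(x in `[a, b]) (p^`().[x])%:E = (p.[b] - p.[a])%:E)%E.
Proof.
rewrite le_eqVlt => /predU1P[->|ab].
  by rewrite set_itv1 integral_set1 subrr.
rewrite (@continuous_FTC2 _ _ (horner p)) //.
- by apply/continuous_subspaceT => x; exact: continuous_horner.
- split=> [x _| |].
  + exact: derivable_horner.
  + by apply: cvg_at_right_filter; exact: continuous_horner.
  + by apply: cvg_at_left_filter; exact: continuous_horner.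
- by move=> x _; rewrite -derivE.
Qed.

Let dpowX k (p : {poly R}) : {poly R} := (k`!%:R)^-1 *: p ^+ k.

Let horner_dpowX k p x : (dpowX k p).[x] = dpow k p.[x].
Proof. by rewrite /dpowX /dpow hornerZ horner_exp mulrC. Qed.

Let deriv_dpowX k p : (dpowX k.+1 p)^`() = p^`() * dpowX k p.
Proof.
rewrite /dpowX derivZ deriv_exp /= -scalerAr -(scaler_nat k.+1 (p^`() * _)) scalerA.
by rewrite factS natrM invfM mulrAC mulVf ?mul1r // pnatr_eq0.
Qed.

Let dpowX0 p : dpowX 0 p = 1.
Proof. by rewrite /dpowX expr0 fact0 invr1 scale1r. Qed.

(* The derivative of the summand i is a telescoping difference. *)
Let antiderivative (A B : {poly R}) j k : A^`() = 1 -> B^`() = -1 ->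
  (- \sum_(i < j.+1) dpowX i A * dpowX (j + k - i).+1 B)^`() = dpowX j A * dpowX k B.
Proof.
move=> dA dB; elim: j k => [|j IH] k.
  by rewrite big_ord1 subn0 !dpowX0 !mul1r derivN deriv_dpowX dB mulN1r opprK.
rewrite big_ord_recr /= opprD derivD.
rewrite addSnnS IH -addSnnS addKn.
by rewrite derivN derivM !deriv_dpowX dA dB; ring.
Qed.

Lemma integral_dpow (b : nat -> R) (p k : nat -> nat) m u c r : 0 <= r ->
  (\int[mu]_(s in `[c, (c + r)%R])
    (\sum_(j < m) b j * (dpow (p j) (u + (s - c)) * dpow (k j) (r - (s - c))))%:E =
  (\sum_(j < m) b j * \sum_(i < (p j).+1) dpow i u * dpow (p j + k j - i).+1 r)%:E)%E.
Proof.
move=> r0.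
pose A : {poly R} := (u - c)%:P + 'X; pose B : {poly R} := (r + c)%:P - 'X.
have dA : A^`() = 1 by rewrite derivD derivC derivX add0r.
have dB : B^`() = -1 by rewrite derivB derivC derivX sub0r.
pose q := \sum_(j < m) b j *: (- \sum_(i < (p j).+1) dpowX i A * dpowX (p j + k j - i).+1 B).
transitivity (\int[mu]_(s in `[c, (c + r)%R]) (q^`().[s])%:E)%E.
  apply: eq_integral => s _; congr EFin; rewrite /q raddf_sum horner_sum.
  apply: eq_bigr => j _; rewrite /= derivZ antiderivative // hornerZ hornerM !horner_dpowX.
  by congr (_ * (dpow _ _ * dpow _ _)); rewrite ?/A ?/B !(hornerD, hornerN, hornerC, hornerX); ring.
rewrite integral_poly ?lerDl //; congr EFin; rewrite /q !horner_sum -sumrB.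
apply: eq_bigr => j _; rewrite !hornerZ -mulrBr; congr (_ * _).
rewrite !hornerN !horner_sum opprK addrC.
(* [B] vanishes at the upper end, and every summand contains a positive power of it. *)
rewrite [X in _ - X]big1 ?subr0 => [|i _]; last first.
  rewrite hornerM !horner_dpowX [B.[_]](_ : _ = 0) ?dpowS0 ?mulr0 //.
  by rewrite ?/A ?/B !(hornerD, hornerN, hornerC, hornerX); ring.
apply: eq_bigr => i _; rewrite hornerM !horner_dpowX; congr (dpow _ _ * dpow _ _).
  by rewrite ?/A ?/B !(hornerD, hornerN, hornerC, hornerX); ring.
by rewrite ?/A ?/B !(hornerD, hornerN, hornerC, hornerX); ring.
Qed.

Lemma integral_two_pieces (f g : R -> R) (x r : R) : 0 <= x -> 0 <= r ->
  measurable_fun setT f -> measurable_fun setT g ->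
  (\int[mu]_s (if 0 <= s <= x then f s else if x < s <= x + r then g s else 0)%:E =
   \int[mu]_(s in `[0%R, x]) (f s)%:E + \int[mu]_(s in `[x, (x + r)%R]) (g s)%:E)%E.
Proof.
move=> x0 r0 mf mg.
set h := fun s => if 0 <= s <= x then f s else if x < s <= x + r then g s else 0.
have mh : measurable_fun setT (EFin \o h).
  apply/measurable_EFinP; apply: measurable_fun_ifT.
  - apply: measurable_and; apply: measurable_fun_ler => //.
  - exact: mf.
  apply: measurable_fun_ifT => //.
  apply: measurable_and; first exact: measurable_fun_ltr.
  exact: measurable_fun_ler.
transitivity (\int[mu]_(s in `[0%R, x]%classic `|` `]x, (x + r)%R]%classic) (h s)%:E)%E.
  rewrite [RHS]integral_mkcond; apply: eq_integral => s _.
  rewrite patchE; case: (boolP (s \in _ `|` _)) => // /negP; rewrite inE /= !in_itv /= => H.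
  rewrite /h; case: ifP => [H1|_]; first by case: H; left.
  by case: ifP => [H1|//]; case: H; right.
rewrite integral_setU //; last 2 first.
- exact: measurable_funS mh.
- rewrite disj_set2E; apply/eqP/seteqP; split => // s [] /=; rewrite !in_itv /=.
  by move=> /andP[_ sx] /andP[]; rewrite ltNge sx.
congr (_ + _)%E.
  by apply: eq_integral => s; rewrite inE /= in_itv /= /h => ->.
rewrite -[RHS]integral_itv_obnd_cbnd; last first.
  by apply/measurable_EFinP; exact: measurable_funS mg.
apply: eq_integral => s; rewrite inE /= in_itv /= /h => /andP[xs ->].
by rewrite (leNgt s x) xs andbF.
Qed.

End DividedPowers.

(** * The volume of a word as an iterated integral *)

Section WordVolume.
Variable R : realType.
Local Notation mu := (@lebesgue_measure R).

(** The coefficients common to the volume, in the basis [dpow j x * dpow (size w - j) r], and to the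
    walks, in the basis [multichoose b j]. *)
Fixpoint coef (w : seq letter) (j : nat) : nat :=
  match w with
  | [::] => (j == 0)%N
  | Source :: w' => (\sum_(i < (size w').+1 | (j <= i)%N) coef w' i)%N
  | Sink :: w' => coef w' j.-1
  | Hub :: w' => (\sum_(i < (size w').+1 | (j.-1 <= i)%N) coef w' i)%N
  end.

(* The sum of the positive coordinates of a point with coefficients [c] on the
   edges of the word; [x] is what has already flowed into the next hub. *)
Fixpoint cost (w : seq letter) (x : R) (c : seq R) : R :=
  match w, c with
  | Source :: w', s :: c' => s + cost w' (x + s) c'
  | Sink :: w', s :: c' => cost w' (x - s) c'
  | Hub :: w', s :: c' => Num.max (s - x) 0 + cost w' s c'
  | _, _ => Num.max (- x) 0
  end.

Definition cost_region (w : seq letter) (x r : R) : set ((size w).-tuple R) :=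
  [set t : (size w).-tuple R | all (fun s => 0 <= s) t /\ cost w x t <= r].

Arguments cost_region w x r : clear implicits.

Definition volume_poly (w : seq letter) (x r : R) : R :=
  \sum_(j < (size w).+1) (coef w j)%:R * (dpow j x * dpow (size w - j) r).

(** A hub with negative inflow [x] is itself charged for [-x]. When no source can refill it, this is
    a fixed charge: the inflow counts as 0 and the budget shrinks to [r + x]. *)
Definition volume_fun (w : seq letter) (x r : R) : R :=
  if 0 <= r + Num.min x 0 then volume_poly w (Num.max x 0) (r + Num.min x 0) else 0.

Lemma volume_poly0 w r : volume_poly w 0 r = (coef w 0)%:R * dpow (size w) r.
Proof.
rewrite /volume_poly big_ord_recl /= dpow0 mul1r subn0 big1 => [|i _]; first by rewrite addr0.
by rewrite dpowS0 mul0r mulr0.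
Qed.

Lemma volume_fun_neg w (x r : R) : x <= 0 ->
  volume_fun w x r = if 0 <= r + x then volume_poly w 0 (r + x) else 0.
Proof. by move=> x0; rewrite /volume_fun min_l // max_r. Qed.

Lemma volume_fun_pos w (x r : R) : 0 <= x ->
  volume_fun w x r = if 0 <= r then volume_poly w x r else 0.
Proof. by move=> x0; rewrite /volume_fun min_r // max_l // addr0. Qed.

Definition next (l : letter) (x s : R) : R :=
  match l with Source => x + s | Sink => x - s | Hub => s end.
Definition step_cost (l : letter) (x s : R) : R :=
  match l with Source => s | Sink => 0 | Hub => Num.max (s - x) 0 end.

Lemma cost_cons l w x s c : cost (l :: w) x (s :: c) = step_cost l x s + cost w (next l x s) c.
Proof. by case: l => //=; rewrite add0r. Qed.

Lemma lebesgue_tuple0 d : lebesgue_tuple (@set0 (d.-tuple R)) = 0%E.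
Proof. by have [m <-] := lebesgue_tuple_measure R d; exact: measure0. Qed.

Lemma cost_region_cons l w x r :
  lebesgue_tuple (cost_region (l :: w) x r) =
  (\int[mu]_s if (0 <= s)%R then lebesgue_tuple (cost_region w (next l x s) (r - step_cost l x s)) else 0)%E.
Proof.
rewrite lebesgue_tupleS; apply: eq_integral => s _; case: ifPn => s0.
  congr lebesgue_tuple; apply/seteqP; split => t;
    by rewrite /cost_region /mkset /= -/(cost (l :: w) x (s :: t)) cost_cons s0 /= lerBrDl.
rewrite -[RHS](lebesgue_tuple0 (size w)); congr lebesgue_tuple.
apply/seteqP; split => t //; rewrite /cost_region /mkset /= (negbTE s0).
by case.
Qed.

Lemma measurable_dpow k : measurable_fun setT (@dpow R k).
Proof.
by apply: measurable_funM => //; exact: exprn_measurable.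
Qed.

Lemma measurable_volume_poly w (f g : R -> R) : measurable_fun setT f -> measurable_fun setT g ->
  measurable_fun setT (fun s => volume_poly w (f s) (g s)).
Proof.
move=> mf mg; apply: measurable_sum => j; apply: measurable_funM => //.
by apply: measurable_funM; apply: (measurableT_comp (@measurable_dpow _)).
Qed.

Lemma exchange_coef (a : nat -> nat) (F : nat -> R) m :
  \sum_(j < m) (a j)%:R * \sum_(i < j.+1) F i =
  \sum_(i < m) (\sum_(j < m | (i <= j)%N) a j)%:R * F i.
Proof.
transitivity (\sum_(j < m) \sum_(i < m | (i <= j)%N) (a j)%:R * F i).
  apply: eq_bigr => j _; rewrite mulr_sumr.
  rewrite (big_ord_widen m (fun i => (a j)%:R * F i)) //.
rewrite (exchange_big_dep xpredT) //=; apply: eq_bigr => i _.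
by rewrite natr_sum mulr_suml.
Qed.

(** The lower end [c] is free because the same integral reappears as the second piece for a hub.
    Exchanging the sums turns the coefficients into their tail sums. *)
Lemma integral_volume_poly_source w (x c r : R) : 0 <= r ->
  (\int[mu]_(s in `[c, (c + r)%R]) (volume_poly w (x + (s - c)) (r - (s - c)))%:E =
   (volume_poly (Source :: w) x r)%:E)%E.
Proof.
move=> r0; rewrite /volume_poly.
rewrite (@integral_dpow R (fun j => (coef w j)%:R) id (fun j => size w - j)%N) //; congr EFin.
under eq_bigr => j _ do under eq_bigr => i _ do rewrite subnKC -1?ltnS //.
rewrite (exchange_coef (coef w) (fun i => dpow i x * dpow (size w - i).+1 r)).
rewrite [RHS]big_ord_recr /= [in X in _ + X]big1 => [|i]; last first.
  by move=> H; have := ltn_ord i; lia.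
rewrite mul0r addr0; apply: eq_bigr => i _; congr (_ * (_ * dpow _ _)).
by rewrite subSn // -ltnS.
Qed.

Lemma integral_volume_poly_sink w (x r : R) : 0 <= x ->
  (\int[mu]_(s in `[0%R, x]) (volume_poly w (x - s) r)%:E =
   (\sum_(j < (size w).+1) (coef w j)%:R * (dpow j.+1 x * dpow (size w - j) r))%:E)%E.
Proof.
move=> x0.
have := @integral_dpow R (fun j => (coef w j)%:R * dpow (size w - j) r) (fun=> 0%N) id (size w).+1 0 0 x x0.
rewrite add0r => E; transitivity (\int[mu]_(s in `[0%R, x])
  (\sum_(j < (size w).+1) (coef w j)%:R * dpow (size w - j) r * (dpow 0 (0 + (s - 0)) * dpow j (x - (s - 0))))%:E)%E.
  apply: eq_integral => s _; congr EFin; apply: eq_bigr => j _.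
  by rewrite dpow0 subr0; ring.
rewrite E; congr EFin; apply: eq_bigr => j _.
by rewrite big_ord1 dpow0 subn0; ring.
Qed.

Lemma integral_volume_poly_hub w (x r : R) : 0 <= x ->
  (\int[mu]_(s in `[0%R, x]) (volume_poly w s r)%:E =
   (\sum_(j < (size w).+1) (coef w j)%:R * (dpow j.+1 x * dpow (size w - j) r))%:E)%E.
Proof.
move=> x0.
have := @integral_dpow R (fun j => (coef w j)%:R * dpow (size w - j) r) id (fun=> 0%N) (size w).+1 0 0 x x0.
rewrite add0r => E; transitivity (\int[mu]_(s in `[0%R, x])
  (\sum_(j < (size w).+1) (coef w j)%:R * dpow (size w - j) r * (dpow j (0 + (s - 0)) * dpow 0 (x - (s - 0))))%:E)%E.
  apply: eq_integral => s _; congr EFin; apply: eq_bigr => j _.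
  by rewrite dpow0 subr0 add0r; ring.
rewrite E; congr EFin; apply: eq_bigr => j _.
rewrite big_ord_recl dpow0 subn0 addn0 big1 ?addr0 => [|i _]; last by rewrite dpowS0 mul0r.
by ring.
Qed.

Lemma integral_volume_poly_sink_tail w (x r : R) : 0 <= r ->
  (\int[mu]_(s in `[x, (x + r)%R]) (volume_poly w 0 (r - (s - x)))%:E =
   ((coef w 0)%:R * dpow (size w).+1 r)%:E)%E.
Proof.
move=> r0.
have := @integral_dpow R (fun j => (coef w 0)%:R) (fun=> 0%N) (fun=> size w) 1 0 x r r0.
rewrite !big_ord1 subn0 dpow0 mul1r => <-.
apply: eq_integral => s _; congr EFin.
by rewrite big_ord1 volume_poly0 dpow0 mul1r.
Qed.

(** Because [0.-1 = 0], the number [coef w 0] occurs twice: for j = 1 from the amounts covered by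
    the inflow, for j = 0 from those beyond it. *)
Lemma volume_poly_sink w (x r : R) : volume_poly (Sink :: w) x r =
  \sum_(j < (size w).+1) (coef w j)%:R * (dpow j.+1 x * dpow (size w - j) r) +
  (coef w 0)%:R * dpow (size w).+1 r.
Proof.
rewrite /volume_poly big_ord_recl /= dpow0 mul1r subn0 addrC; congr (_ + _).
Qed.

Lemma volume_poly_hub w (x r : R) : volume_poly (Hub :: w) x r =
  \sum_(j < (size w).+1) (coef w j)%:R * (dpow j.+1 x * dpow (size w - j) r) +
  volume_poly (Source :: w) x r.
Proof.
rewrite /volume_poly [LHS]big_ord_recl [X in _ = _ + X]big_ord_recl /= addrCA; congr (_ + _).
rewrite -big_split; apply: eq_bigr => i _ /=; rewrite -mulrDl; congr (_ * _).
rewrite -natrD (bigD1 i) ?leqnn //=; congr ((_ + _)%N%:R).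
by apply: eq_bigl => j; rewrite andbC ltn_neqAle eq_sym.
Qed.

Lemma integral_two_pieces_ge0 (h : R -> \bar R) (f g : R -> R) (x r : R) : 0 <= x ->
  measurable_fun setT f -> measurable_fun setT g ->
  (forall s, 0 <= s ->
    h s = (if 0 <= r then if s <= x then f s else if s <= x + r then g s else 0 else 0)%:E) ->
  (\int[mu]_s (if 0 <= s then h s else 0)%R =
   if (0 <= r)%R then \int[mu]_(s in `[0%R, x]) (f s)%:E + \int[mu]_(s in `[x, (x + r)%R]) (g s)%:E
   else 0)%E.
Proof.
move=> x0 mf mg hE; case: ifPn => r0; last first.
  apply: integral0_eq => s _; case: ifPn => // s0.
  by rewrite hE // (negbTE r0).
rewrite -integral_two_pieces //; apply: eq_integral => s _.
case: ifPn => s0 /=.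
  rewrite hE // r0; case: (leP s x) => //= sx.
have -> : (x < s) = false by apply/negbTE; rewrite -leNgt (le_trans _ x0) // ltW // ltNge.
by [].
Qed.

Lemma lebesgue_cost_region w (x r : R) : good_word w -> 0 <= x \/ sourceless w ->
  lebesgue_tuple (cost_region w x r) = (volume_fun w x r)%:E.
Proof.
elim: w => [|l w IH] in x r *.
  move=> _ _; rewrite /volume_fun /volume_poly /= big_ord1 !dpow0 !mulr1 diracE.
  have E : (Num.max (- x) 0 <= r) = (0 <= r + Num.min x 0).
    case: (leP 0 x) => x0; first by rewrite max_r ?oppr_le0 // addr0.
    by rewrite max_l; [rewrite -lerBlDr sub0r | rewrite oppr_ge0 ltW].
  case: ifPn => [H|/negP H]; [rewrite mem_set // | rewrite memNset //].
    by split => //=; rewrite E.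
  by case => _ /=; rewrite E.
rewrite cost_region_cons; case: l => /= good H.
- have {H} x0 : 0 <= x by case: H.
  rewrite (@integral_two_pieces_ge0 _ (fun s => volume_poly w (x + s) (r - s)) (fun s => volume_poly w (x + s) (r - s)) 0 r) //.
  + rewrite set_itv1 integral_set1 add0e add0r volume_fun_pos //.
    case: ifPn => // r0; rewrite -(integral_volume_poly_source w x 0 r0) add0r.
    by apply: eq_integral => s _; rewrite subr0.
  + by apply: measurable_volume_poly; [apply: measurable_funD | apply: measurable_funB].
  + by apply: measurable_volume_poly; [apply: measurable_funD | apply: measurable_funB].
  + move=> s s0; rewrite /= IH //; last by left; exact: addr_ge0.
    rewrite volume_fun_pos; last exact: addr_ge0.
    rewrite subr_ge0 add0r; case: (leP 0 r) => r0.
      by case: (leP s r) => sr; [case: ifP | rewrite ifF //; apply/negbTE; rewrite -ltNge (le_lt_trans r0)].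
    by rewrite ifF //; apply/negbTE; rewrite -ltNge (lt_le_trans r0).
- have {H good} [gw sw] : good_word w /\ sourceless w by case/andP: good.
  (* [X] is the available inflow, [r'] the budget once a deficit is paid. The sink is free up to [X]
     and charged beyond; a negative [x] leaves only the second piece. *)
  set X := Num.max x 0; set r' := r + Num.min x 0.
  have X0 : 0 <= X by rewrite le_max lexx orbT.
  have Xr : r + x = r' + X by rewrite /r' /X -addrA addr_min_max addr0.
  rewrite (@integral_two_pieces_ge0 _ (fun s => volume_poly w (X - s) r') (fun s => volume_poly w 0 (r' - (s - X))) X r') //.
  + rewrite /volume_fun -/X -/r'; case: ifPn => // r0.
    by rewrite integral_volume_poly_sink // integral_volume_poly_sink_tail // -EFinD volume_poly_sink.
  + by apply: measurable_volume_poly => //; apply: measurable_funB.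
  + by apply: measurable_volume_poly => //; do 2! apply: measurable_funB => //.
  + move=> s s0; rewrite /= subr0 IH //; last by right.
    have [x0|x0] := leP 0 x.
      have -> : X = x by rewrite /X max_l.
      have -> : r' = r by rewrite /r' min_r // addr0.
      have [sx|sx] := leP s x; first by rewrite volume_fun_pos ?subr_ge0.
      rewrite volume_fun_neg ?subr_le0 ?(ltW sx) // -{2}(opprB s x).
      have -> : (0 <= r + (x - s)) = (s <= x + r) by rewrite addrA subr_ge0 addrC.
      by case: (leP 0 r) => r0; case: (leP s (x + r)) => sr //; exfalso; lra.
    have E : X = 0 by rewrite /X max_r // ltW.
    rewrite volume_fun_neg ?subr_le0 ?(le_trans (ltW x0)) // addrA Xr E !addr0 !add0r subr_ge0 subr0.
    have [s0'|s0'] := leP s 0.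
      have s00 : s = 0 by apply/le_anti; rewrite s0 s0'.
      by rewrite s00 subr0 oppr0.
    case: (leP s r') => sr; last by case: ifP.
    by rewrite ifT // (le_trans s0).
(* As for the sink, what the hub passes on is charged only beyond [X]; but here the next hub
   receives all of [s], so its inflow is nonnegative. *)
- set X := Num.max x 0; set r' := r + Num.min x 0.
  have X0 : 0 <= X by rewrite le_max lexx orbT.
  have Xr : r + x = r' + X by rewrite /r' /X -addrA addr_min_max addr0.
  rewrite (@integral_two_pieces_ge0 _ (fun s => volume_poly w s r') (fun s => volume_poly w (X + (s - X)) (r' - (s - X))) X r') //.
  + rewrite /volume_fun -/X -/r'; case: ifPn => // r0.
    by rewrite integral_volume_poly_hub // integral_volume_poly_source // -EFinD volume_poly_hub.
  + exact: measurable_volume_poly.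
  + by apply: measurable_volume_poly => //; [apply: measurable_funD|]; do 2?[apply: measurable_funB] => //; apply: measurable_funB.
  + move=> s s0; rewrite /= IH //; last by left.
    rewrite volume_fun_pos // (addrC X (s - X)) subrK.
    have [sX|sX] := leP s X.
      suff -> : r - Num.max (s - x) 0 = r' by [].
      have [x0|x0] := leP 0 x.
        have XE : X = x by rewrite /X max_l.
        by rewrite max_r ?subr_le0 -?XE // subr0 /r' min_r // addr0.
      have XE : X = 0 by rewrite /X max_r // ltW.
      have s00 : s = 0 by apply/le_anti; rewrite s0 -XE sX.
      by rewrite s00 sub0r max_l ?oppr_ge0 ?ltW // opprK Xr XE addr0.
    have xX : x <= X by rewrite le_max lexx.
    rewrite max_l ?subr_ge0 ?(ltW (le_lt_trans xX sX)) //.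
    have -> : r - (s - x) = r' - (s - X) by rewrite !opprB !addrA -Xr; ring.
    by case: (leP 0 r') => r0; case: (leP s (X + r')) => sr; case: leP => sr2 //; exfalso; lra.
Qed.

End WordVolume.

(** The number of multisets of size [j] from [b] kinds, the discrete counterpart of [dpow j]; the
    truncated predecessor gives the right value 1 at b = j = 0. *)
Definition multichoose (b j : nat) := 'C((b + j).-1, j).

Lemma multichoose0 j : multichoose 0 j = (j == 0)%N.
Proof. by case: j => [|j]; rewrite /multichoose ?bin0 //= bin_small. Qed.

Lemma multichooseS b j : multichoose b.+1 j = (\sum_(i < j.+1) multichoose b i)%N.
Proof.
elim: j => [|j IH]; first by rewrite big_ord1 /multichoose !bin0.
by rewrite big_ord_recr -IH /= /multichoose !addSn !addnS /= binS addnC.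
Qed.

(** The extra unit at j = 0 is the contribution of level 0; it plays the part of the integral beyond
    the inflow. *)
Lemma sum_multichoose b j :
  (\sum_(i < b.+1) multichoose i j = multichoose b j.+1 + (j == 0))%N.
Proof.
elim: b => [|b IH]; first by rewrite big_ord1 !multichoose0.
rewrite big_ord_recr /= IH /multichoose !addSn !addnS /= addnAC; congr (_ + _)%N.
Qed.

Lemma exchange_coefn (a F : nat -> nat) m :
  (\sum_(j < m) a j * \sum_(i < j.+1) F i =
   \sum_(i < m) (\sum_(j < m | i <= j) a j) * F i)%N.
Proof.
transitivity (\sum_(j < m) \sum_(i < m | (i <= j)%N) a j * F i)%N.
  apply: eq_bigr => j _; rewrite big_distrr /=.
  by rewrite (big_ord_widen m (fun i => a j * F i)%N).
rewrite (exchange_big_dep xpredT) //=; apply: eq_bigr => i _.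
by rewrite big_distrl.
Qed.

Lemma coef_source_size w : coef (Source :: w) (size w).+1 = 0%N.
Proof. by rewrite /= big1 // => i H; have := ltn_ord i; lia. Qed.

Lemma walks_source w b : 
  (\sum_(j < (size w).+1) coef w j * multichoose b.+1 j =
   \sum_(j < (size w).+2) coef (Source :: w) j * multichoose b j)%N.
Proof.
under eq_bigr => j _ do rewrite multichooseS.
rewrite (exchange_coefn (coef w) (multichoose b)) [RHS]big_ord_recr.
by rewrite (coef_source_size w : coef (Source :: w) (@ord_max (size w).+1) = 0%N) mul0n /= addn0.
Qed.

(** A source forms tail sums of the coefficients, and a summation over levels raises [j] by one, up
    to a boundary term that feeds the coefficient 0: the same rules as for the volume. *)
Lemma walks_coef w b :
  walks b w = (\sum_(j < (size w).+1) coef w j * multichoose b j)%N.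
Proof.
elim: w b => [|l w IH] b.
  by rewrite big_ord1 /multichoose bin0.
case: l => /=.
- by rewrite IH walks_source.
- under eq_bigr do rewrite IH.
  rewrite exchange_big /= [RHS]big_ord_recl /=.
  under eq_bigr => j _ do rewrite -big_distrr /= sum_multichoose mulnDr.
  rewrite big_split /= addnC; congr (_ + _)%N.
  rewrite big_ord_recl /= big1 ?addn0 => [|i _]; last by rewrite muln0.
  by rewrite /multichoose bin0.
- under eq_bigr do rewrite IH walks_source.
  rewrite exchange_big /=.
  under eq_bigr => j _ do rewrite -big_distrr /= sum_multichoose mulnDr.
  rewrite big_split /= [X in (_ + X)%N]big_ord_recl /= [X in (_ + (_ + X))%N]big1 ?addn0 => [|i _]; last by rewrite muln0.
  rewrite [RHS]big_ord_recl addnC; congr (_ + _)%N.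
    by rewrite /multichoose bin0.
  rewrite [LHS]big_ord_recr.
  rewrite (_ : (\sum_(i < _ | _) coef w i)%N * _ = 0)%N ?[LHS]addn0 //.
  by rewrite -[X in (X * _)%N]/(coef (Source :: w) (size w).+1) coef_source_size.
Qed.

Lemma coef0_walks w : coef w 0 = walks 0 w.
Proof.
rewrite walks_coef big_ord_recl multichoose0 muln1 big1 ?addn0 // => i _.
by rewrite multichoose0 muln0.
Qed.

(** * The root polytope as a truncated cone *)

Section RootPolytope.
Variables (R : realType) (m : nat).
Implicit Types (x y : 'rV[R]_m) (d : 'I_m -> 'I_m -> R).

Lemma conic_hull0 (S : set 'rV[R]_m) : conic_hull S 0.
Proof.
by exists 0%N, (fun=> 0), (fun=> 0); split=> [[]//|//|]; rewrite big_ord0.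
Qed.

Lemma conic_hullD (S : set 'rV[R]_m) x y :
  conic_hull S x -> conic_hull S y -> conic_hull S (x + y).
Proof.
move=> [k [c [p [pS c0 ->]]]] [l [e [q [qS e0 ->]]]].
exists (k + l)%N, (fun i => match fintype.split i with inl j => c j | inr j => e j end),
  (fun i => match fintype.split i with inl j => p j | inr j => q j end); split.
- by move=> i; case: (fintype.split i).
- by move=> i; case: (fintype.split i).
rewrite big_split_ord /=; congr (_ + _); apply: eq_bigr => i _.
  by rewrite (unsplitK (inl i)).
by rewrite (unsplitK (inr i)).
Qed.

Lemma conic_hullZ (S : set 'rV[R]_m) (a : R) x : 0 <= a ->
  conic_hull S x -> conic_hull S (a *: x).
Proof.
move=> a0 [k [c [p [pS c0 ->]]]]; exists k, (fun i => a * c i), p; split=> // [i|].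
  exact: mulr_ge0.
by rewrite scaler_sumr; apply: eq_bigr => i _; rewrite scalerA.
Qed.

Lemma sub_conic_hull (S : set 'rV[R]_m) : S `<=` conic_hull S.
Proof.
move=> x Sx; exists 1%N, (fun=> 1), (fun=> x); split=> //.
by rewrite big_ord1 scale1r.
Qed.

Lemma conic_hull_sum (S : set 'rV[R]_m) k (c : 'I_k -> R) (p : 'I_k -> 'rV[R]_m) :
  (forall i, 0 <= c i) -> (forall i, conic_hull S (p i)) ->
  conic_hull S (\sum_i c i *: p i).
Proof.
move=> c0 pS; elim/big_rec: _ => [|i y _ Sy]; first exact: conic_hull0.
by apply: conic_hullD => //; exact: conic_hullZ.
Qed.

Definition pos_sum x : R := \sum_i Num.max (x 0 i) 0.

Lemma pos_sumD x y : pos_sum (x + y) <= pos_sum x + pos_sum y.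
Proof.
rewrite /pos_sum -big_split /=; apply: ler_sum => i _; rewrite mxE.
rewrite ge_max lerD ?le_max ?lexx //= addr_ge0 // le_max lexx orbT //.
Qed.

Lemma pos_sumZ a x : 0 <= a -> pos_sum (a *: x) = a * pos_sum x.
Proof.
move=> a0; rewrite /pos_sum mulr_sumr; apply: eq_bigr => i _.
by rewrite mxE maxr_pMr // mulr0.
Qed.

Lemma pos_sum0 : pos_sum 0 = 0.
Proof. by rewrite /pos_sum big1 // => i _; rewrite mxE maxxx. Qed.

Lemma pos_sum_conv k (c : 'I_k -> R) (p : 'I_k -> 'rV[R]_m) :
  (forall i, 0 <= c i) -> (forall i, pos_sum (p i) <= 1) ->
  pos_sum (\sum_i c i *: p i) <= \sum_i c i.
Proof.
move=> c0 p1; elim/big_rec2: _ => [|i y1 y2 _ IH]; first by rewrite pos_sum0.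
apply: le_trans (pos_sumD _ _) _; rewrite lerD // pos_sumZ //.
by rewrite -[leRHS]mulr1 ler_wpM2l.
Qed.

Lemma root_vectorE (i j v : 'I_m) : root_vector R i j 0 v = (v == i)%:R - (v == j)%:R.
Proof. by rewrite /root_vector !mxE !eqxx. Qed.

Lemma pos_sum_root (i j : 'I_m) : i != j -> pos_sum (root_vector R i j) = 1.
Proof.
move=> ij; rewrite /pos_sum (bigD1 i) //= root_vectorE eqxx (negbTE ij) subr0 max_l //.
rewrite big1 ?addr0 // => v vi; rewrite root_vectorE (negbTE vi) sub0r max_r //.
Qed.

(* Moving the amount [min] of the in- and outflow of [v] onto the arcs that
   bypass [v]; the in- and outflows of the other vertices do not change. *)
Lemma bypass_vertex (Q : 'I_m -> 'I_m -> Prop) d (v : 'I_m) :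
  (forall i j k, Q i j -> Q j k -> Q i k) -> (forall i, ~ Q i i) ->
  (forall i j, 0 <= d i j) -> (forall i j, d i j != 0 -> Q i j) ->
  exists d' : 'I_m -> 'I_m -> R, exists t : R,
    [/\ forall i j, 0 <= d' i j, forall i j, d' i j != 0 -> Q i j,
        forall i, \sum_j d' i j = \sum_j d i j - t * (i == v)%:R,
        forall j, \sum_i d' i j = \sum_i d i j - t * (j == v)%:R
      & Num.min (\sum_j d' v j) (\sum_i d' i v) = 0].
Proof.
move=> Qtr Qirr d0 dQ.
set O := \sum_j d v j; set I := \sum_i d i v.
have dvv : d v v = 0 by apply: contrapT => /eqP /dQ; exact: Qirr.
have O0 : 0 <= O by exact: sumr_ge0.
have I0 : 0 <= I by exact: sumr_ge0.
pose t := Num.min O I.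
have t0 : 0 <= t by rewrite le_min O0 I0.
have [tE|tN] := eqVneq t 0.
  exists d, 0; split=> // i; by rewrite mul0r subr0.
have tpos : 0 < t by rewrite lt_neqAle eq_sym tN.
have Op : 0 < O by rewrite (lt_le_trans tpos) // ge_min lexx.
have Ip : 0 < I by rewrite (lt_le_trans tpos) // ge_min lexx orbT.
(* The shares of the other vertices in the inflow and outflow of [v]: the arc from [i] to [j] will
   receive [t * (a i * b j)]. *)
pose a i := d i v / I; pose b j := d v j / O.
have a0 i : 0 <= a i by rewrite divr_ge0.
have b0 j : 0 <= b j by rewrite divr_ge0.
have av : a v = 0 by rewrite /a dvv mul0r.
have bv : b v = 0 by rewrite /b dvv mul0r.
have sa : \sum_i a i = 1 by rewrite -mulr_suml divff // gt_eqF.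
have sb : \sum_i b i = 1 by rewrite -mulr_suml divff // gt_eqF.
have ta i : t * a i <= d i v.
  by rewrite /a mulrCA -[leRHS]mulr1 ler_wpM2l // ler_pdivrMr // mul1r ge_min lexx orbT.
have tb i : t * b i <= d v i.
  by rewrite /b mulrCA -[leRHS]mulr1 ler_wpM2l // ler_pdivrMr // mul1r ge_min lexx.
have sdelta (w : 'I_m) : \sum_j ((j == w)%:R : R) = 1.
  by rewrite (bigD1 w) //= eqxx big1 ?addr0 // => j /negbTE ->.
pose d' i j := d i j + t * (a i * b j - a i * (j == v)%:R - (i == v)%:R * b j).
have row i : \sum_j d' i j = \sum_j d i j - t * (i == v)%:R.
  rewrite /d' big_split /= -mulr_sumr !sumrB -!mulr_sumr sb sdelta; ring.
have col j : \sum_i d' i j = \sum_i d i j - t * (j == v)%:R.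
  rewrite /d' big_split /= -mulr_sumr !sumrB -!mulr_suml -/I divff ?(gt_eqF Ip) // sdelta; ring.
exists d', t; split=> //.
- move=> i j; rewrite /d'.
  have [->|iv] := eqVneq i v; have [->|jv] := eqVneq j v.
  + by rewrite dvv av bv; lra.
  + by have := tb j; rewrite av /= ?mulr1n ?mulr0n; lra.
  + by have := ta i; rewrite bv /= ?mulr1n ?mulr0n; lra.
  + rewrite /= ?mulr0n mulr0 mul0r !subr0; apply: addr_ge0 => //.
    by apply: mulr_ge0 => //; exact: mulr_ge0.
- move=> i j; rewrite /d'.
  have [->|iv] := eqVneq i v; have [->|jv] := eqVneq j v.
  + by rewrite dvv av bv => /eqP; case; ring.
  + move=> H; apply: dQ; apply: contra_neq H => H; rewrite /b H av; ring.
  + move=> H; apply: dQ; apply: contra_neq H => H; rewrite /a H bv; ring.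
  + rewrite /= ?mulr0n mulr0 mul0r !subr0 => H; have [dij|] := eqVneq (d i j) 0; last exact: dQ.
    apply: (Qtr _ v); apply: dQ; apply: contra_neq H => H.
      by rewrite dij /a H; ring.
    by rewrite dij /b H; ring.
- rewrite row col eqxx mulr1 -/O -/I.
  rewrite /t; case: (leP O I) => OI; [rewrite subrr min_l // subr_ge0 // | rewrite subrr min_r // subr_ge0 ltW //].
Qed.

(** Vertices are bypassed one at a time; a vertex already balanced stays so, since its in- and
    outflow no longer change. *)
Lemma balanced_flow (Q : 'I_m -> 'I_m -> Prop) d :
  (forall i j k, Q i j -> Q j k -> Q i k) -> (forall i, ~ Q i i) ->
  (forall i j, 0 <= d i j) -> (forall i j, d i j != 0 -> Q i j) ->
  exists d' : 'I_m -> 'I_m -> R,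
    [/\ forall i j, 0 <= d' i j, forall i j, d' i j != 0 -> Q i j,
        forall i, \sum_j d' i j - \sum_j d' j i = \sum_j d i j - \sum_j d j i
      & forall i, Num.min (\sum_j d' i j) (\sum_j d' j i) = 0].
Proof.
move=> Qtr Qirr d0 dQ.
suff H l : exists d' : 'I_m -> 'I_m -> R,
    [/\ forall i j, 0 <= d' i j, forall i j, d' i j != 0 -> Q i j,
        forall i, \sum_j d' i j - \sum_j d' j i = \sum_j d i j - \sum_j d j i
      & forall i : 'I_m, (i < l)%N -> Num.min (\sum_j d' i j) (\sum_j d' j i) = 0].
  by have [d' [? ? ? H']] := H m; exists d'; split => // i; exact: H'.
elim: l => [|l [e [e0 eQ ed emin]]]; first by exists d; split.
have [ml|lm] := leqP m l.
  by exists e; split=> // i _; apply: emin; rewrite (leq_trans (ltn_ord i)).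
pose v := Ordinal lm.
have [e' [t [e'0 e'Q row col minv]]] := bypass_vertex v Qtr Qirr e0 eQ.
exists e'; split=> // [i|i].
  by rewrite row col -ed; ring.
rewrite ltnS leq_eqVlt => /orP[/eqP il|il].
  by have -> : i = v by exact/val_inj.
have iv : (i == v) = false by apply/negbTE; rewrite -val_eqE /= ltn_eqF.
by rewrite row col iv mulr0 !subr0 emin.
Qed.

Lemma convex_hull_fin (S : set 'rV[R]_m) (I : finType) (c : I -> R) (p : I -> 'rV[R]_m) :
  (forall i, S (p i)) -> (forall i, 0 <= c i) -> \sum_i c i = 1 ->
  convex_hull S (\sum_i c i *: p i).
Proof.
move=> pS c0 c1; exists #|I|, (c \o enum_val), (p \o enum_val); split=> // [i|i||].
- exact: pS.
- exact: c0.
- by rewrite -c1 (reindex (enum_val : 'I_#|I| -> I)) //; exact/onW_bij/enum_val_bij.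
- by rewrite (reindex (enum_val : 'I_#|I| -> I)) //; exact/onW_bij/enum_val_bij.
Qed.

Definition edge_vectors (E : rel 'I_m) : set 'rV[R]_m :=
  [set x | exists i j : 'I_m, [/\ (i < j)%N, E i j & x = root_vector R i j]].

(** Arcs are only required to increase and to lie in the cone: unlike being an edge, this is
    transitive, hence preserved by bypassing. *)
Lemma root_decomposition (E : rel 'I_m) x : conic_hull (edge_vectors E) x ->
  exists d, [/\ forall i j, 0 <= d i j,
    forall i j, d i j != 0 -> (i < j)%N /\ conic_hull (edge_vectors E) (root_vector R i j)
    & forall i, x 0 i = \sum_j d i j - \sum_j d j i].
Proof.
move=> [k [c [p [pS c0 ->]]]].
elim/big_rec: _ => [|l y _ [d [d0 dQ dy]]].
  exists (fun _ _ => 0); split=> // [i j|i]; first by rewrite eqxx.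
  by rewrite mxE !big1 ?subr0.
have [i [j [ij Eij pE]]] := pS l.
pose e a b := (a == i)%:R * (b == j)%:R : R.
exists (fun a b => d a b + c l * e a b); split.
- by move=> a b; rewrite addr_ge0 // !mulr_ge0 ?ler0n.
- move=> a b H; have [dab|] := eqVneq (d a b) 0; last exact: dQ.
  have : e a b != 0 by apply: contra_neq H => H; rewrite dab /= H mulr0 addr0.
  rewrite /e; case: (eqVneq a i) => [->|_]; case: (eqVneq b j) => [->|_]; rewrite ?mulr0 ?mul0r ?eqxx // => _.
  by split=> //; apply: sub_conic_hull; exists i, j.
- move=> a; rewrite !mxE dy pE root_vectorE !big_split /= -!mulr_sumr.
  rewrite /e -mulr_suml.
  have sdelta (v : 'I_m) : \sum_j ((j == v)%:R : R) = 1.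
    by rewrite (bigD1 v) //= eqxx big1 ?addr0 // => b /negbTE ->.
  by rewrite !sdelta; ring.
Qed.

(** [pos_sum] is sublinear and at most 1 on the generators, which gives one inclusion. Conversely,
    in a balanced flow no vertex has both in- and outflow, so the total flow is bounded by
    [pos_sum x], and the slack goes to the vertex 0 of the polytope. *)
Lemma root_polytopeE (E : rel 'I_m) :
  root_polytope R E = [set x | conic_hull (edge_vectors E) x /\ pos_sum x <= 1].
Proof.
apply/seteqP; split => x.
  move=> [k [c [p [pS c0 c1 ->]]]] /=; split.
    by apply: conic_hull_sum => // i; case: (pS i) => [->|[]//]; exact: conic_hull0.
  rewrite -c1; apply: pos_sum_conv => // i.
  case: (pS i) => [->|[[a [b [ab ->]]] _]]; first by rewrite pos_sum0.
  by rewrite pos_sum_root // -val_eqE /= ltn_eqF.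
move=> [/root_decomposition[d [d0 dQ xd]] x1].
pose Q (i j : 'I_m) := (i < j)%N /\ conic_hull (edge_vectors E) (root_vector R i j).
have Qtr i j k : Q i j -> Q j k -> Q i k.
  move=> [ij ci] [jk cj]; split; first exact: ltn_trans jk.
  have -> : root_vector R i k = root_vector R i j + root_vector R j k.
    by apply/rowP => v; rewrite [RHS]mxE !root_vectorE; ring.
  exact: conic_hullD.
have Qirr i : ~ Q i i by case; rewrite ltnn.
have [e [e0 eQ ed emin]] := balanced_flow Qtr Qirr d0 dQ.
have se : \sum_i \sum_j e i j <= 1.
  apply: le_trans x1; apply: ler_sum => i _; rewrite xd -ed.
  move: (emin i); case: (leP (\sum_j e i j) (\sum_j e j i)) => [_ ->|_ ->].
    by rewrite le_max lexx orbT.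
  by rewrite subr0 le_max lexx.
pose c (o : unit + 'I_m * 'I_m) :=
  match o with inl _ => 1 - \sum_i \sum_j e i j | inr ij => e ij.1 ij.2 end.
(* Only arcs that carry flow are known to lie in the cone; the others get the point 0. *)
pose p (o : unit + 'I_m * 'I_m) : 'rV[R]_m := match o with
  | inl _ => 0 | inr ij => if e ij.1 ij.2 == 0 then 0 else root_vector R ij.1 ij.2 end.
have -> : x = \sum_o c o *: p o.
  rewrite big_sumType /= scaler0 sumr_const mul0rn add0r.
  rewrite -(pair_bigA _ (fun i j => e i j *: (if e i j == 0 then 0 else root_vector R i j))) /=.
  apply/rowP => v; rewrite xd -ed summxE.
  transitivity (\sum_i \sum_j e i j * ((v == i)%:R - (v == j)%:R)).
    under [RHS]eq_bigr => i _ do (under eq_bigr => j _ do rewrite mulrBr; rewrite sumrB -mulr_suml).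
    rewrite sumrB; congr (_ - _).
      by rewrite [RHS](bigD1 v) //= eqxx mulr1 [X in _ = _ + X]big1 ?addr0 // => i; rewrite eq_sym => /negbTE ->; rewrite mulr0.
    apply: eq_bigr => i _; rewrite [RHS](bigD1 v) //= eqxx mulr1 [X in _ = _ + X]big1 ?addr0 // => j.
    by rewrite eq_sym => /negbTE ->; rewrite mulr0.
  apply: eq_bigr => i _; rewrite summxE; apply: eq_bigr => j _; rewrite mxE.
  by case: (eqVneq (e i j) 0) => [->|_]; rewrite ?mul0r // root_vectorE.
apply: convex_hull_fin.
- move=> [_|[i j]] /=; first by left.
  case: eqP => [_|/eqP H]; first by left.
  by right; have [ij cij] := eQ _ _ H; split => //; exists i, j.
- by move=> [_|[i j]] /=; rewrite ?subr_ge0.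
- rewrite big_sumType /= sumr_const card_unit mulr1n.
  by rewrite -(pair_bigA _ (fun i j => e i j)) /= subrK.
Qed.

End RootPolytope.

(** * Independence of the lattice frame *)

Section NormalizedVolume.
Variables (R : realType) (m : nat).
Local Notation "M ^r" := (map_mx (intr : int -> R) M) (at level 2, format "M ^r").

Lemma frame_point_affine_span (A : set 'rV[R]_m) d p0 (B : 'M[int]_(d, m)) (y : 'rV[int]_d) :
  lattice_frame A p0 B -> affine_span A (p0 + y *m B)^r.
Proof.
by case=> _ -> _; exists y^r => //; rewrite /frame_point map_mxD map_mxM.
Qed.

Lemma lattice_frame_change (A : set 'rV[R]_m) d p0 (B : 'M[int]_(d, m))
    d' p0' (B' : 'M[int]_(d', m)) :
  lattice_frame A p0 B -> lattice_frame A p0' B' ->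
  exists M : 'M[int]_(d', d), exists y, p0' = p0 + y *m B /\ B' = M *m B.
Proof.
move=> fB fB'; have [_ _ intB] := fB.
have /intB[y p0E] : affine_span A p0'^r.
  by have := frame_point_affine_span 0 fB'; rewrite mul0mx addr0.
have /choice[M ME] : forall i, exists z : 'rV[int]_d, row i B' = z *m B.
  move=> i; have /intB[z zE] := frame_point_affine_span (delta_mx 0 i) fB'.
  exists (z - y); rewrite mulmxBl rowE.
  apply: (addrI p0'); rewrite zE p0E -addrA; congr (_ + _).
  by rewrite addrC subrK.
exists (\matrix_i M i), y; split=> //.
by apply/row_matrixP => i; rewrite row_mul rowK ME.
Qed.

Lemma lattice_frame_mul (A : set 'rV[R]_m) d p0 (B : 'M[int]_(d, m))
    d' (M : 'M[int]_(d', d)) (M' : 'M[int]_(d, d')) :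
  lattice_frame A p0 B -> B = M' *m (M *m B) -> M' *m M = 1%:M.
Proof.
case=> rB _ _ BE.
have E : (M' *m M)^r = 1%:M.
  by apply: (row_free_inj rB); rewrite -map_mxM -mulmxA -BE mul1mx.
apply/matrixP => i j; apply: (@intr_inj R).
by move/matrixP: E => /(_ i j); rewrite mxE -(map_mx1 (intr : int -> R)) [RHS]mxE.
Qed.

Lemma normalized_volumeE (A : set 'rV[R]_m) d p0 (B : 'M[int]_(d, m)) :
  lattice_frame A p0 B ->
  measurable [set t : d.-tuple R | A (frame_point p0 B (\row_i tnth t i))] ->
  normalized_volume A = ((d`!)%:R%:E *
    lebesgue_tuple [set t : d.-tuple R | A (frame_point p0 B (\row_i tnth t i))])%E.
Proof.
move=> fB mA; rewrite /normalized_volume; set P := [set v | _].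
(* [xget] returns the value of an unspecified frame, so all frames must give the same one. *)
have uniq v : P v -> v = ((d`!)%:R%:E *
    lebesgue_tuple [set t : d.-tuple R | A (frame_point p0 B (\row_i tnth t i))])%E.
  move=> [d' [p0' [B' [fB' ->]]]].
  have [M [y [p0E BE]]] := lattice_frame_change fB fB'.
  have [M' [_ [_ B'E]]] := lattice_frame_change fB' fB.
  have M'M : M' *m M = 1%:M by apply: (lattice_frame_mul fB); rewrite -BE.
  have MM' : M *m M' = 1%:M by apply: (lattice_frame_mul fB'); rewrite -B'E.
  have dd : d' = d by apply/eqP; rewrite eqn_leq (mulmx1_min M'M) (mulmx1_min MM').
  subst d'; congr (_ * _)%E.
  have uM : M \in unitmx by case: (mulmx1_unit MM').
  have detM : `|\det M^r| = 1 :> R.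
    move: uM; rewrite unitmxE det_map_mx.
    by case/orP => /eqP ->; rewrite ?rmorphN rmorph1 ?normrN normr1.
  have uMr : M^r \in unitmx.
    by rewrite unitmxE unitfE -normr_gt0 detM.
  have frameE (t : d.-tuple R) : frame_point p0 B (tuple_row (affine_tuple M^r y^r t)) =
      frame_point p0' B' (tuple_row t).
    rewrite tuple_row_affine /frame_point p0E BE.
    by rewrite map_mxD !map_mxM mulmxDl mulmxA [in X in _ + X]addrC addrA.
  have := volume_scaling_unit uMr y^r mA; rewrite detM mul1e => <-.
  congr lebesgue_tuple; apply/seteqP; split => t; rewrite /mkset.
    by rewrite -[X in frame_point p0 B X]/(tuple_row (affine_tuple M^r y^r t)) frameE.
  by rewrite -[X in frame_point p0 B X]/(tuple_row (affine_tuple M^r y^r t)) frameE.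
apply: uniq; apply: xgetPex; exists ((d`!)%:R%:E *
    lebesgue_tuple [set t : d.-tuple R | A (frame_point p0 B (\row_i tnth t i))])%E.
by exists d, p0, B.
Qed.

End NormalizedVolume.

(** * Coefficients on the edges of a word as coordinates *)

Section WordTree.
Variable R : realType.

Definition edge_sign (e : nat * nat) (v : nat) : R := (v == e.1)%:R - (v == e.2)%:R.

Definition word_flow (E : seq (nat * nat)) (c : seq R) (v : nat) : R :=
  \sum_(k < size E) nth 0 c k * edge_sign (nth (0, 0)%N E k) v.

Lemma word_flow_cons e E s c v :
  word_flow (e :: E) (s :: c) v = s * edge_sign e v + word_flow E c v.
Proof. by rewrite /word_flow big_ord_recl. Qed.

Lemma word_flow_notin z o c v : v \notin word_vertices z o -> word_flow (word_edges z o) c v = 0.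
Proof.
move=> vo; rewrite /word_flow big1 // => k _.
have := mem_nth (0, 0)%N (ltn_ord k); move: (nth _ _ k) => e /word_edges_vertices/andP[e1 e2].
have N u : u \in word_vertices z o -> (v == u) = false by move=> uo; apply: contraNF vo => /eqP ->.
by rewrite /edge_sign !N // subrr mulr0.
Qed.

Lemma edge_sign_closed (P : R -> Prop) e v s :
  (forall x y, P x -> P y -> P (x - y)) -> P s -> P (s * edge_sign e v).
Proof.
move=> PB Ps; have P0 : P 0 by rewrite -(subrr s); exact: PB.
rewrite /edge_sign; case: eqP => _; case: eqP => _ /=.
- by rewrite subrr mulr0.
- by rewrite subr0 mulr1.
- by rewrite sub0r mulrN mulr1 -sub0r; exact: PB.
- by rewrite subrr mulr0.
Qed.

(* The first letter's own vertex only meets the first edge. *)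
Lemma word_flow_closed (P : R -> Prop) z o c :
  (forall x y, P x -> P y -> P (x - y)) ->
  uniq (word_vertices z o) -> size c = size o ->
  (forall v, P (word_flow (word_edges z o) c v)) -> forall k, (k < size c)%N -> P (nth 0 c k).
Proof.
move=> PB; have P0 x : P x -> P 0 by move=> Px; rewrite -(subrr x); exact: PB.
have PN x : P x -> P (- x) by move=> Px; rewrite -sub0r; apply: PB => //; exact: P0 Px.
elim: o c => [|[l u] o IH] [|s c] //= /andP[uo uniq_o] [sc] Pv.
have hu : (u == hub z o) = false.
  by apply: contraNF uo => /eqP ->; exact: hub_vertices.
have [e Ee] : exists e, word_edges z ((l, u) :: o) = e :: word_edges z o.
  by case: (l); eexists.
have Ps : P s.
  have := Pv u; have H := word_flow_notin c uo.
  case: l {Ee Pv} => /=; rewrite word_flow_cons H addr0 /edge_sign /= eqxx hu.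
  - by rewrite subr0 mulr1.
  - by rewrite sub0r mulrN mulr1 => /PN; rewrite opprK.
  - by rewrite subr0 mulr1.
case=> [|k] //= kc; apply: IH => // v.
have := Pv v; rewrite -/(word_edges z ((l, u) :: o)) Ee word_flow_cons => H.
have -> : word_flow (word_edges z o) c v =
    (s * edge_sign e v + word_flow (word_edges z o) c v) - s * edge_sign e v by ring.
exact: PB H (edge_sign_closed _ _ PB Ps).
Qed.

(** The inflow [x] is kept general for the induction: the letters already removed have sent [x] into
    the next hub, which lowers its coordinate by [x]. The vertex of a removed letter meets no later
    edge, so its coordinate is final. *)
Lemma cost_word_flow z o x c : uniq (word_vertices z o) -> size c = size o ->
  all (fun s => 0 <= s) c ->
  cost (letters o) x c = \sum_(v <- word_vertices z o)
    Num.max (word_flow (word_edges z o) c v - (v == hub z o)%:R * x) 0.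
Proof.
elim: o x c => [|[l u] o IH] x [|s c] //=.
  by move=> _ _ _; rewrite /word_vertices /= big_seq1 eqxx mul1r /word_flow big_ord0 sub0r.
move=> /andP[uo uniq_o] [sc] /andP[s0 c0].
have hu : (u == hub z o) = false.
  by apply: contraNF uo => /eqP ->; exact: hub_vertices.
have vu v : v \in word_vertices z o -> (v == u) = false.
  by move=> vo; apply: contraTF vo => /eqP ->.
have fu := word_flow_notin c uo.
rewrite /word_vertices /= big_cons -/(word_vertices z o); case: l => /=.
- rewrite word_flow_cons fu addr0 /edge_sign /= eqxx hu subr0 mulr1 mul0r subr0 max_l //.
  congr (_ + _); rewrite IH //; apply: eq_big_seq => v vo.
  by rewrite word_flow_cons /edge_sign /= vu //= mulr0n; congr (Num.max _ _); ring.
- rewrite word_flow_cons fu addr0 /edge_sign /= eqxx hu sub0r mul0r subr0 max_r ?add0r; last first.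
    by rewrite mulrN mulr1 oppr_le0.
  rewrite IH //; apply: eq_big_seq => v vo.
  by rewrite word_flow_cons /edge_sign /= vu //= mulr0n; congr (Num.max _ _); ring.
- rewrite word_flow_cons fu addr0 /edge_sign /= eqxx hu subr0 mulr1 mul1r.
  congr (_ + _); rewrite IH //; apply: eq_big_seq => v vo.
  by rewrite word_flow_cons /edge_sign /= vu //= mulr0n; congr (Num.max _ _); ring.
Qed.

Lemma measurable_cost d (T : measurableType d) (w : seq letter) (f : T -> R)
    (g : T -> (size w).-tuple R) : measurable_fun setT f -> measurable_fun setT g ->
  measurable_fun setT (fun y => cost w (f y) (g y)).
Proof.
elim: w f g => [|l w IH] f g mf mg.
  rewrite (_ : (fun y => _) = (fun y => Num.max (- f y) 0)); last first.
    by apply/funext => y /=.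
  by apply: measurable_maxr => //; exact: measurableT_comp.
have mh : measurable_fun setT (fun y => thead (g y)).
  exact: (measurableT_comp (@measurable_tnth _ R _ ord0) mg).
have mt : measurable_fun setT (fun y => [tuple of behead (g y)] : (size w).-tuple R).
  exact: (measurableT_comp (@measurable_behead _ R _) mg).
rewrite (_ : (fun y => _) = (fun y => step_cost l (f y) (thead (g y)) +
    cost w (next l (f y) (thead (g y))) [tuple of behead (g y)])); last first.
  by apply/funext => y; rewrite [in LHS](tuple_eta (g y)) cost_cons.
have mstep (h : T -> R) : measurable_fun setT h ->
    measurable_fun setT (fun y => step_cost l (f y) (h y)).
  by move=> mh'; case: (l) => //=; apply: measurable_maxr => //; exact: measurable_funB.
have mnext (h : T -> R) : measurable_fun setT h ->
    measurable_fun setT (fun y => next l (f y) (h y)).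
  by move=> mh'; case: (l) => //=; [exact: measurable_funD|exact: measurable_funB].
by apply: measurable_funD; [exact: mstep|apply: IH => //; exact: mnext].
Qed.

Lemma measurable_cost_region w x r : measurable (@cost_region R w x r).
Proof.
apply: (measurableI [set t | all (fun s => 0 <= s) (t : (size w).-tuple R)] [set t | cost w x t <= r]).
  have -> : [set t : (size w).-tuple R | all (fun s => 0 <= s) t] =
      \bigcap_(i in [set: 'I_(size w)]) [set t | 0 <= tnth t i].
    apply/seteqP; split => t /=; first by move/all_tnthP => H i _; exact: H.
    by move=> H; apply/all_tnthP => i; exact: H.
  apply: fin_bigcap_measurable => // i _.
  rewrite -[X in measurable X]setTI.
  apply: (@measurable_fun_le _ _ _ _ (fun=> 0) (fun t => tnth t i)) => //.
  exact: measurable_tnth.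
rewrite -[X in measurable X]setTI.
apply: (@measurable_fun_le _ _ _ _ (fun t : (size w).-tuple R => cost w x t) (fun=> r)) => //.
exact: measurable_cost.
Qed.

End WordTree.

(** * The normalized volume of the polytope of a word *)

Section WordPolytope.
Variables (R : realType) (m : nat) (E : rel 'I_m) (z : nat) (o : seq (letter * nat)).
Local Notation "M ^r" := (map_mx (intr : int -> R) M) (at level 2, format "M ^r").
Hypothesis vertices_uniq : uniq (word_vertices z o).
Hypothesis vertices_perm : perm_eq (word_vertices z o) (iota 0 m).
Hypothesis edges_lt : all (fun e => e.1 < e.2)%N (word_edges z o).
Hypothesis edgesE : forall i j : 'I_m, (i < j)%N && E i j = ((i : nat, j : nat) \in word_edges z o).
Hypothesis word_good : good_word (letters o).

Let d := size (letters o).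
Let edge (k : 'I_d) := nth (0, 0)%N (word_edges z o) k.

Definition edge_frame : 'M[int]_(d, m) :=
  \matrix_(k, v) ((v == (edge k).1 :> nat)%:R - (v == (edge k).2 :> nat)%:R).

Let edge_in k : edge k \in word_edges z o.
Proof. by apply: mem_nth; rewrite size_word_edges. Qed.

Let vertexE v : (v \in word_vertices z o) = (v < m)%N.
Proof. by rewrite (perm_mem vertices_perm) mem_iota. Qed.

Let edge_root k : exists i j : 'I_m, [/\ (i < j)%N, E i j & row k edge_frame^r = root_vector R i j].
Proof.
have := edge_in k; case Ek : (edge k) => [a b] kin.
have /andP[] := word_edges_vertices kin; rewrite !vertexE /= => am bm.
have ab : (a < b)%N := allP edges_lt _ kin.
exists (Ordinal am), (Ordinal bm).
have /andP[_ Eab] : (Ordinal am < Ordinal bm)%N && E (Ordinal am) (Ordinal bm) by rewrite edgesE.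
split=> //; apply/rowP => v; rewrite !mxE eqxx /= Ek /= rmorphB /= !natz.
by rewrite -!val_eqE /=; congr (_ - _); case: eqP.
Qed.

Let mul_edge_frame (t : 'rV[R]_d) (v : 'I_m) :
  (t *m edge_frame^r) 0 v = word_flow (word_edges z o) [seq t 0 k | k <- enum 'I_d] v.
Proof.
rewrite mxE /word_flow size_word_edges; apply: eq_bigr => k _; rewrite !mxE.
rewrite (nth_map k) ?size_enum_ord // nth_ord_enum; congr (_ * _).
by rewrite rmorphB /= /edge_sign; congr (_ - _); case: eqP.
Qed.

Let word_flow_out (t : seq R) v : (m <= v)%N -> word_flow (word_edges z o) t v = 0.
Proof. by move=> mv; apply: word_flow_notin; rewrite vertexE -leqNgt. Qed.

(** With [P] being equality to 0 this is the independence of the edges; with [P] being integrality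
    it is their unimodularity. *)
Let enum_flow_closed (P : R -> Prop) (t : 'rV[R]_d) : P 0 ->
  (forall x y, P x -> P y -> P (x - y)) ->
  (forall v, P ((t *m edge_frame^r) 0 v)) -> forall k, P (t 0 k).
Proof.
move=> P0 PB Pv k.
have sz : size [seq t 0 k | k <- enum 'I_d] = size o by rewrite size_map size_enum_ord /d size_map.
have := @word_flow_closed R P z o _ PB vertices_uniq sz _ k.
rewrite (nth_map k) ?size_enum_ord // nth_ord_enum; apply; last by rewrite sz -(size_map fst).
move=> v; have [vm|] := ltnP v m; last by move/word_flow_out ->.
by have := Pv (Ordinal vm); rewrite mul_edge_frame.
Qed.

Let edge_frame_free : row_free edge_frame^r.
Proof.
apply: inj_row_free => t tB0; apply/rowP => k; rewrite [RHS]mxE.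
apply: (@enum_flow_closed (fun x => x = 0)) => // [x y -> ->|v]; first by rewrite subrr.
by rewrite tB0 mxE.
Qed.

Let conic_edge_frame (t : 'rV[R]_d) :
  conic_hull (@edge_vectors R m E) (t *m edge_frame^r) <-> (forall k, 0 <= t 0 k).
Proof.
split=> [[l [c [p [pS c0 tE]]]]|t0].
  have /choice[k kE] : forall i, exists k, p i = row k edge_frame^r.
    move=> i; have [a [b [ab Eab ->]]] := pS i.
    have : (a : nat, b : nat) \in word_edges z o by rewrite -edgesE ab.
    move/(nthP (0, 0)%N) => [k]; rewrite size_word_edges => kd Ek.
    exists (Ordinal kd); apply/rowP => v; rewrite root_vectorE !mxE /edge /= Ek rmorphB /=.
    by rewrite -!val_eqE /=; congr (_ - _); case: eqP.
  have : t = \sum_i c i *: delta_mx 0 (k i).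
    apply: (row_free_inj edge_frame_free); rewrite tE mulmx_suml; apply: eq_bigr => i _.
    by rewrite kE rowE -scalemxAl.
  move=> -> j; rewrite summxE; apply: sumr_ge0 => i _; rewrite !mxE.
  by apply: mulr_ge0 => //; exact: ler0n.
rewrite mulmx_sum_row; apply: conic_hull_sum => // k.
apply: sub_conic_hull; have [i [j [ij Eij ->]]] := edge_root k.
by exists i, j.
Qed.

Let pos_sum_edge_frame (t : d.-tuple R) : all (fun s => 0 <= s) t ->
  pos_sum (\row_i tnth t i *m edge_frame^r) = cost (letters o) 0 t.
Proof.
move=> t0; rewrite (cost_word_flow 0 vertices_uniq) //; last by rewrite size_tuple /d size_map.
rewrite (perm_big _ vertices_perm) /= -[m in iota 0 m]subn0 big_mkord /pos_sum.
apply: eq_bigr => v _; rewrite mul_edge_frame mulr0 subr0; congr (Num.max (word_flow _ _ _) 0).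
transitivity (map (tnth t) (enum 'I_d)); last exact: map_tnth_enum.
by apply: eq_map => k; rewrite mxE.
Qed.

Let root_polytope_frame (t : 'rV[R]_d) : root_polytope R E (t *m edge_frame^r) <->
  (forall k, 0 <= t 0 k) /\ pos_sum (t *m edge_frame^r) <= 1.
Proof. by rewrite root_polytopeE /= conic_edge_frame. Qed.

Let root_polytope_range x : root_polytope R E x -> exists t : 'rV[R]_d, x = t *m edge_frame^r.
Proof.
rewrite root_polytopeE => -[[l [c [p [pS _ ->]]]] _].
have /choice[t tE] : forall i, exists t : 'rV[R]_d, p i = t *m edge_frame^r.
  move=> i; have [a [b [ab Eab ->]]] := pS i.
  have : (a : nat, b : nat) \in word_edges z o by rewrite -edgesE ab.
  move/(nthP (0, 0)%N) => [k]; rewrite size_word_edges => kd Ek.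
  exists (delta_mx 0 (Ordinal kd)); apply/rowP => v.
  rewrite -rowE root_vectorE !mxE /edge /= Ek rmorphB /=.
  by rewrite -!val_eqE /=; congr (_ - _); case: eqP.
exists (\sum_i c i *: t i); rewrite mulmx_suml; apply: eq_bigr => i _.
by rewrite tE -scalemxAl.
Qed.

Let row_in_polytope k : root_polytope R E (row k edge_frame^r).
Proof.
have [i [j [ij Eij ->]]] := edge_root k; rewrite root_polytopeE /=; split.
  by apply: sub_conic_hull; exists i, j.
by rewrite pos_sum_root // -val_eqE /= ltn_eqF.
Qed.

Let frame_point0 (t : 'rV[R]_d) : frame_point 0 edge_frame t = t *m edge_frame^r.
Proof. by rewrite /frame_point map_mx0 add0r. Qed.

Let edge_lattice_frame : lattice_frame (root_polytope R E) 0 edge_frame.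
Proof.
have spanE : affine_span (root_polytope R E) = range (@frame_point R d m 0 edge_frame).
  apply/seteqP; split => x.
    move=> [k [c [p [pS _ ->]]]].
    have /choice[t tE] := fun i => root_polytope_range (pS i).
    exists (\sum_i c i *: t i) => //; rewrite frame_point0 mulmx_suml.
    by apply: eq_bigr => i _; rewrite tE -scalemxAl.
  move=> [t _ <-]; rewrite frame_point0.
  (* The point 0 of the polytope absorbs the weight [1 - \sum_k t 0 k], so the affine span is the
     whole linear span of the edges. *)
  exists d.+1, (fun i => if unlift ord0 i is Some k then t 0 k else 1 - \sum_k t 0 k),
    (fun i => if unlift ord0 i is Some k then row k edge_frame^r else 0); split.
  - move=> i; case: (unlift ord0 i) => [k|]; first exact: row_in_polytope.
    by rewrite root_polytopeE /= pos_sum0; split => //; exact: conic_hull0.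
  - rewrite big_ord_recl unlift_none [X in _ + X](eq_bigr (fun k => t 0 k)) ?subrK // => k _.
    by rewrite liftK.
  - rewrite big_ord_recl unlift_none scaler0 add0r mulmx_sum_row.
    by apply: eq_bigr => k _; rewrite liftK.
split=> //; move=> y; rewrite spanE => -[t _]; rewrite frame_point0 => tE.
have /choice[f fE] : forall k, exists a : int, t 0 k = a%:~R.
  apply: (@enum_flow_closed (fun x => exists a : int, x = a%:~R)) => [|x x' [a ->] [a' ->]|v]; first by exists 0.
    by exists (a - a'); rewrite rmorphB.
  by exists (y 0 v); rewrite tE mxE.
exists (\row_k f k); rewrite add0r; apply/rowP => v; apply: (@intr_inj R).
move/rowP: tE => /(_ v); rewrite mxE [in RHS]mxE => <-; rewrite mxE rmorph_sum.
by apply: eq_bigr => k _; rewrite rmorphM /= fE !mxE.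
Qed.

Lemma normalized_volume_word :
  normalized_volume (root_polytope R E) = ((walks 0 (letters o))%:R)%:E.
Proof.
have regionE : [set t : d.-tuple R | root_polytope R E (frame_point 0 edge_frame (\row_i tnth t i))] =
    @cost_region R (letters o) 0 1.
  apply/seteqP; split => t; rewrite /cost_region /mkset frame_point0 root_polytope_frame.
    move=> [t0 t1]; have t0' : all (fun s => 0 <= s) t.
      by apply/all_tnthP => i; have := t0 i; rewrite mxE.
    by split => //; rewrite -pos_sum_edge_frame.
  move=> [t0 t1]; split; last by rewrite pos_sum_edge_frame.
  by move=> i; rewrite mxE; move/all_tnthP: t0; exact.
rewrite (normalized_volumeE edge_lattice_frame) regionE; last exact: measurable_cost_region.
rewrite lebesgue_cost_region //; last by left.
(* At inflow 0 and budget 1 the volume is [coef (letters o) 0] divided by the factorial of [d]. *)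
rewrite /volume_fun min_l // max_l // addr0 ler01 volume_poly0 coef0_walks /dpow expr1n.
by rewrite -EFinM mulrCA div1r mulfV ?mulr1 // pnatr_eq0 -lt0n fact_gt0.
Qed.

End WordPolytope.

Theorem theorem6p1 (R : realType) (n : nat) (w : 'S_n.+1) :
  one_dominant w ->
  normalized_volume (root_polytope R (tree_edge w))
    = (#|reduced_pipes w|%:R)%:E
  /\
  normalized_volume (root_polytope R (tree_edge w))
    = (grothendieck w (0 : R) [tuple 1 | i < n])%:E.
Proof.
move=> wdom; rewrite grothendieck0; last exact: reduced_pipes_exists.
suff -> : normalized_volume (root_polytope R (tree_edge w)) = (#|reduced_pipes w|%:R)%:E by [].
have [H [L_gt0 Hn]] := nonzero_rows wdom; have L0 := row_length0 wdom.
have [mE _ _] := labelled_boundaryE wdom L_gt0 Hn.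
rewrite card_reduced_pipes_walks // -(walks_tree_word L0 L_gt0 Hn).
apply: (@normalized_volume_word R _ _ (tree_word (row_length w) H H).2).
- by rewrite (perm_uniq (perm_tree_word _ _ _)) iota_uniq.
- by rewrite mE perm_tree_word.
- exact: tree_word_edges_lt.
- exact: tree_edgeE.
- exact: good_tree_word.
Qed.
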